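(* Let $T:[0,1]\to[0,1]$ be a Thaler map, and let $\mu$, $Y$, $A_0$, $A_1$, $\alpha$, $\ell$ and $a(\cdot)$ be as described in the context. Assume that $G\in\{u\in L^\infty(\mu):u\ge0\}$ is supported on $[\varepsilon,1-\varepsilon]$ for some $\varepsilon\in(0,1/2)$. Then there exists a constant $C_2\in(0,\infty)$ such that, for any positive-valued sequences $\{c(n)\}_{n\ge0}$ and $\{\tilde c(n)\}_{n\ge0}$ satisfying $c(n)\to0$, $c(n)n\to\infty$ and $\tilde c(n)\to0$, $\tilde c(n)a(n)\to\infty$ $(n\to\infty)$, we have $$\limsup_{n\to\infty}\frac{\ell(c(n)n)}{c(n)^\alpha\ell(n)}\,\mu_G\Big(\frac{Z_n^Y}{n}\le c(n)\Big)\le C_2,\qquad \limsup_{n\to\infty}\frac{1}{\tilde c(n)}\,\mu_G\Big(\frac{S_n^Y}{a(n)}\le\tilde c(n)\Big)\le C_2,$$ and $$\limsup_{n\to\infty}\frac{\ell(c(n)n)}{c(n)^\alpha\ell(n)}\,\mu_G\Big(\frac{S_n^{A_i}}{n}\le c(n)\Big)\le C_2\qquad(i=0,1).$$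
   Context: Thaler map. $T:[0,1]\to[0,1]$ satisfies: (i) for some $c\in(0,1)$ the restrictions $T:[0,c)\to[0,1)$ and $T:(c,1]\to(0,1]$ are strictly increasing, onto, and extend to $C^2$ maps $T_0:[0,c]\to[0,1]$ and $T_1:[c,1]\to[0,1]$ respectively; (ii) $T_0'>1$ and $T_0''>0$ on $(0,c]$, $T_1'>1$ and $T_1''<0$ on $[c,1)$, and $T'(0)=T'(1)=1$; (iii) there exist $p\in(1,\infty)$, $a\in(0,\infty)$ and a positive measurable $\ell^*:(0,\infty)\to(0,\infty)$ slowly varying at $0$ with $Tx-x\sim a^{-p}(1-x-T(1-x))\sim x^{p+1}\ell^*(x)$ $(x\to0+)$. Here $f\sim g$ means $f/g\to1$; a positive measurable function $\ell$ on $(0,\infty)$ is slowly varying at $\infty$ (resp. $0$) if $\ell(\lambda t)\sim\ell(t)$ as $t\to\infty$ (resp. $t\to0+$) for all $\lambda>0$. Invariant measure. Let $f_i$ be the inverse of $T_i$ $(i=0,1)$. It is known that $T$ admits an invariant density $h(x)=h_0(x)\frac{x(1-x)}{(x-f_0(x))(f_1(x)-x)}$, $x\in(0,1)$, with $h_0$ continuous and positive on $[0,1]$. Put $d\mu(x)=h(x)\,dx$; then $\mu$ is a $\sigma$-finite infinite measure on $([0,1],\mathcal B([0,1]))$ and $T$ is conservative, ergodic and $\mu$-preserving. Sets. Let $\gamma\in(0,c)$ be a $2$-periodic point of $T$ (so $T\gamma\in(c,1)$, $T^2\gamma=\gamma$). Fix arbitrary $c_0\in(0,\gamma]$, $c_1\in[T\gamma,1)$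 and set $A_0=[0,c_0)$, $Y=[c_0,c_1]$, $A_1=(c_1,1]$. Then $\mu(Y)\in(0,\infty)$ and $\mu(A_0)=\mu(A_1)=\infty$. Notation. For $0\le u\in L^1(\mu)$, $\mu_u(A)=\int_Au\,d\mu$; $\mu_u(\text{condition})$ is the $\mu_u$-measure of the set of points satisfying the condition. $\varphi(x)=\min\{k\ge1:T^kx\in Y\}$ ($\min\emptyset=\infty$), $Y_0=Y$, $Y_n=Y^c\cap\{\varphi=n\}$ for $n\ge1$, $w_n^Y=\sum_{k=0}^{n-1}\mu(Y_k)$, $w_n^{Y,A_i}=\sum_{k=0}^{n-1}\mu(Y_k\cap A_i)$, $Q^Y(s)=\sum_{n\ge0}e^{-ns}(w^Y_{n+1}-w^Y_n)$ for $s>0$. $Z_n^Y(x)=\max\{0\le k\le n:T^kx\in Y\}$ ($\max\emptyset=0$) and $S_n^A(x)=\sum_{k=1}^n1_A(T^kx)$. Parameters. $\alpha=1/p$, $\beta_0=\frac{T'(c-)}{T'(c-)+T'(c+)a^{-1}}$, $\beta_1=1-\beta_0$. It is known that there is a positive function $\ell:(0,\infty)\to(0,\infty)$ slowly varying at $\infty$ with $w_n^{Y,A_i}\sim\beta_in^{1-\alpha}\ell(n)$ $(n\to\infty,\ i=0,1)$; $\ell$ denotes such a function. Finally $a(t)=\frac{t}{\Gamma(1+\alpha)Q^Y(t^{-1})}$ for $t>0$ (the function $a(\cdot)$ is not to be confused with the constant $a$ in (iii)). *)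

(* Defs.v *)
From HB Require Import structures.
From mathcomp Require Export all_boot all_order all_algebra.
From mathcomp Require Export all_classical all_reals all_analysis.
Export Order.TTheory GRing.Theory Num.Theory numFieldNormedType.Exports.

Set Implicit Arguments.
Unset Strict Implicit.
Unset Printing Implicit Defensive.

Local Open Scope classical_set_scope.
Local Open Scope ring_scope.

Definition asymp_equiv (R : realType) (I : Type) (F : set_system I)
    (f g : I -> R) : Prop :=
  f x / g x @[x --> F] --> (1 : R).

Definition positive_measurable (R : realType) (l : R -> R) : Prop :=
  (forall t, 0 < t -> 0 < l t) /\
  measurable_fun (`]0, +oo[ : set (measurableTypeR R)) l.

Definition slowly_varying_pinfty (R : realType) (l : R -> R) : Prop :=
  positive_measurable l /\
  forall lam, 0 < lam -> asymp_equiv +oo (fun t => l (lam * t)) l.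

Definition slowly_varying_zero (R : realType) (l : R -> R) : Prop :=
  positive_measurable l /\
  forall lam, 0 < lam -> asymp_equiv (0 : R)^'+ (fun t => l (lam * t)) l.

(* Derivatives relative to a domain [D]: they are one-sided at the endpoints of
   an interval, and do not depend on the values of [f] outside of [D]. *)
Definition diff_quotient (R : realType) (f : R -> R) (x y : R) : R :=
  (f y - f x) / (y - x).

Definition derivable_on (R : realType) (D : set R) (f : R -> R) : Prop :=
  forall x, D x -> cvg (diff_quotient f x y @[y --> within D x^']).

Definition derive_on (R : realType) (D : set R) (f : R -> R) (x : R) : R :=
  lim (diff_quotient f x y @[y --> within D x^']).

Definition C2_on (R : realType) (D : set R) (f : R -> R) : Prop :=
  [/\ derivable_on D f, derivable_on D (derive_on D f) &
      {within D, continuous (derive_on D (derive_on D f))}].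

(* [T] is a total function on [R], of which only the values on [0, 1] matter;
   likewise [T0] is only relevant on [0, c] and [T1] on [c, 1]. The value of
   [T] at [c] is an arbitrary element of [0, 1]. *)
Record thaler_map (R : realType) (T : R -> R) (c : R) (T0 T1 : R -> R)
    (p a : R) (lstar : R -> R) : Prop := ThalerMap {
  thaler_self : {in `[0, 1], forall x, T x \in `[0, 1]} ;
  thaler_c : c \in `]0, 1[ ;
  thaler_incr0 : {in `[0, c[ &, {homo T : x y / x < y}} ;
  thaler_onto0 : T @` `[0, c[%classic = `[0, 1[%classic ;
  thaler_incr1 : {in `]c, 1] &, {homo T : x y / x < y}} ;
  thaler_onto1 : T @` `]c, 1]%classic = `]0, 1]%classic ;
  thaler_ext0 : {in `[0, c[, T0 =1 T} ;
  thaler_ran0 : {in `[0, c], forall x, T0 x \in `[0, 1]} ;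
  thaler_C2_0 : C2_on `[0, c]%classic T0 ;
  thaler_ext1 : {in `]c, 1], T1 =1 T} ;
  thaler_ran1 : {in `[c, 1], forall x, T1 x \in `[0, 1]} ;
  thaler_C2_1 : C2_on `[c, 1]%classic T1 ;
  thaler_d0 : {in `]0, c], forall x, 1 < derive_on `[0, c]%classic T0 x} ;
  thaler_dd0 : {in `]0, c], forall x,
    0 < derive_on `[0, c]%classic (derive_on `[0, c]%classic T0) x} ;
  thaler_d1 : {in `[c, 1[, forall x, 1 < derive_on `[c, 1]%classic T1 x} ;
  thaler_dd1 : {in `[c, 1[, forall x,
    derive_on `[c, 1]%classic (derive_on `[c, 1]%classic T1) x < 0} ;
  thaler_fix0 : derive_on `[0, c]%classic T0 0 = 1 ;
  thaler_fix1 : derive_on `[c, 1]%classic T1 1 = 1 ;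
  thaler_p : 1 < p ;
  thaler_a : 0 < a ;
  thaler_lstar : slowly_varying_zero lstar ;
  thaler_tangency : asymp_equiv (0 : R)^'+
    (fun x => T x - x)
    (fun x => a `^ (- p) * (1 - x - T (1 - x))) ;
  thaler_order : asymp_equiv (0 : R)^'+
    (fun x => a `^ (- p) * (1 - x - T (1 - x)))
    (fun x => x `^ (p + 1) * lstar x) }.

(* [f] is the inverse of the bijection [g : D -> [0, 1]]. *)
Definition inverse_branch (R : realType) (D : set R) (g f : R -> R) : Prop :=
  forall y, y \in `[0, 1] -> D (f y) /\ g (f y) = y.

Definition thaler_density (R : realType) (h0 f0 f1 : R -> R) (x : R) : R :=
  h0 x * (x * (1 - x) / ((x - f0 x) * (f1 x - x))).

(* Measures on [0, 1] are represented as measures on the Borel sets of [R]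
   that vanish outside of [0, 1]. *)
Definition has_density01 (R : realType)
    (mu : {measure set (measurableTypeR R) -> \bar R}) (h : R -> R) : Prop :=
  forall A : set (measurableTypeR R), measurable A ->
    (mu A = \int[lebesgue_measure]_(x in A `&` `]0%R, 1%R[%classic) (h x)%:E)%E.

Definition preserves01 (R : realType)
    (mu : {measure set (measurableTypeR R) -> \bar R}) (T : R -> R) : Prop :=
  forall A : set (measurableTypeR R), measurable A ->
    mu (`[0, 1]%classic `&` T @^-1` A) = mu A.

Definition weighted (R : realType)
    (mu : {measure set (measurableTypeR R) -> \bar R}) (u : R -> R)
    (A : set R) : \bar R :=
  (\int[mu]_(x in A) (u x)%:E)%E.

(* The infimum of the empty set is [+oo]. *)
Definition hitting_time (R : realType) (T : R -> R) (Y : set R) (x : R) :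
    \bar R :=
  ereal_inf [set (k%:R)%:E | k in [set k : nat | (1 <= k)%N /\ Y (iter k T x)]].

Definition layer (R : realType) (T : R -> R) (Y : set R) (n : nat) : set R :=
  if n is 0 then Y
  else (`[0, 1]%classic `\` Y) `&` [set x | hitting_time T Y x = n%:R%:E].

(* The measures below are finite when [mu] is [T]-invariant and [mu Y] is
   finite, because [layer T Y k] is included in the preimage of [Y] under the
   [k]-th iterate of [T]. *)
Definition wandering_on (R : realType)
    (mu : {measure set (measurableTypeR R) -> \bar R}) (T : R -> R)
    (Y A : set R) (n : nat) : R :=
  \sum_(0 <= k < n) fine (mu (layer T Y k `&` A)).

Definition wandering (R : realType)
    (mu : {measure set (measurableTypeR R) -> \bar R}) (T : R -> R)
    (Y : set R) (n : nat) : R :=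
  \sum_(0 <= k < n) fine (mu (layer T Y k)).

Definition laplace_wandering (R : realType)
    (mu : {measure set (measurableTypeR R) -> \bar R}) (T : R -> R)
    (Y : set R) (s : R) : R :=
  limn (series (fun n : nat => expR (- (n%:R * s)) *
    (wandering mu T Y n.+1 - wandering mu T Y n))).

Definition Gamma (R : realType) (x : R) : R :=
  \int[lebesgue_measure]_(t in `]0, +oo[%classic) (t `^ (x - 1) * expR (- t)).

Definition return_seq (R : realType)
    (mu : {measure set (measurableTypeR R) -> \bar R}) (T : R -> R)
    (Y : set R) (alpha t : R) : R :=
  t / (Gamma (1 + alpha) * laplace_wandering mu T Y t^-1).

(* The maximum over an empty range is [0]. *)
Definition last_visit (R : realType) (T : R -> R) (Y : set R) (n : nat)
    (x : R) : nat :=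
  \max_(0 <= k < n.+1 | iter k T x \in Y) k.

Definition occupation (R : realType) (T : R -> R) (A : set R) (n : nat)
    (x : R) : R :=
  \sum_(1 <= k < n.+1) \1_A (iter k T x).

Definition beta0 (R : realType) (T : R -> R) (c a : R) : R :=
  let dl := lim (derive1 T x @[x --> c^'-]) in
  let dr := lim (derive1 T x @[x --> c^'+]) in
  dl / (dl + dr * a^-1).

(* Main.v *)
From HB Require Import structures.
Require Import Defs.
From mathcomp Require Import zify ring lra measurable_realfun ess_sup_inf.


(** Why the bounds hold.  Write [mu] for the invariant measure, [B b t] for the
    points of [Y] whose orbit then spends the times [1 .. t] in the far set
    [A b] next to the neutral fixed point [b], and [rho n] for
    [n ^ (1 - alpha) * l n].  Invariance alone relates [mu (B b t)] to the
    layers of [A b]; as these are nonincreasing in [t] and their partial sums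
    are asymptotic to a multiple of [rho], one gets
    [sum_(t <= n) mu (B b t) <= C rho n] and [mu (B b n) >= C' rho n / n]
    ([tail_sum_le], [tail_ge]).

    Sojourn times.  Let [X] be the points of a core interval [Om] that spend at
    most [m] of the first [n] times in [A b].  For most times [j <= n] the
    orbit of such a point is in [Y] or in the opposite far set, so that [j]
    belongs to an excursion in the opposite direction, begun at the last visit
    [k] to [Y].  Integrating this count bounds [n * mu X] by the sum over [k]
    and [t] of [mu (E k `&` T^-k (B (~~ b) t))], where [E k] requires a visit
    to [Y] at time [k] and a short sojourn in [A b] before.  If the past
    [E k] and the future [B] were independent, this would be at most a constant
    times [(sum_k mu (E k)) * rho n].  Moreover the events
    [E k `&` T^-k (B b (m + J))] are disjoint, since an excursion that long
    spoils all later [E j]; independence again yields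
    [sum_k mu (E k) <= C / mu (B b (m + J))], which is of order [m / rho m].
    Hence [mu X <= C (m / rho m) (rho n / n)] ([measure_short_sojourn]), and
    with [m] close to [c n * n] this is [C (c n) ^ alpha * l n / l (c n * n)] up
    to a bounded factor; the passage from [l m] to [l (c n * n)] uses a uniform
    bound for slowly varying functions ([slowly_varying_ratio_bounded]).

    Independence.  What is needed is [quasi_independence]: up to a constant
    factor, the conditional law of the position in [Y] at time [k] given the
    first [k] branches is [mu] restricted to [Y].  This is a distortion bound
    for all compositions of inverse branches on [[y0, y1]], uniform in their
    length.  Neutral fixed points make the usual argument by exponential
    contraction unavailable.  Instead, invariance shows that an inverse branch
    decreases the [mu]-measure of an interval by at least a constant times the
    length of its image ([branch_measure_drop]): the lengths along a
    composition then have a telescoping bound, and so has the logarithm of the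
    distortion ([word_distortion]).

    Number of visits.  At most [N + 1] of the visits to [Y] before time [n] are
    followed by at most [N] further visits up to time [n].  Together with
    invariance this gives [n * mu (few visits) <= C N rho n] directly
    ([measure_few_visits]), and [a n] is at most of order [n / rho n].

    Last visit.  If [Y] is not visited between the times [m] and [n], then the
    orbit is during that period on a single side, hence at most [m] times in
    the far set of the other side: the event is covered by two short sojourns.

    Finally, [G] is bounded and carried by [[eps, 1 - eps]], which is contained
    in [Om] when [Om] is chosen large, so [mu_G] is at most a multiple of [mu]
    restricted to [Om]. *)

Set Implicit Arguments.
Unset Strict Implicit.
Unset Printing Implicit Defensive.

Local Open Scope classical_set_scope.
Local Open Scope ring_scope.

(** * C2 expanding branches *)

Lemma derive_on_expansion (R : realType) (D : set R) (f : R -> R) (x e : R) :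
  derivable_on D f -> D x -> 0 < e ->
  exists2 d, 0 < d & forall y, D y -> `|y - x| < d ->
    `|f y - f x - derive_on D f x * (y - x)| <= e * `|y - x|.
Proof.
move=> dfD Dx e0; have fx := dfD x Dx.
have /cvgrPdist_le/(_ _ e0) : diff_quotient f x y @[y --> within D x^'] -->
  derive_on D f x by exact: fx.
rewrite !near_withinE.
move=> /nbhs_ballP[d /= d0 H]; exists d => // y Dy yxd.
have [->|yx] := eqVneq y x; first by rewrite !subrr mulr0 subrr !normr0 mulr0.
have yx0 : y - x != 0 by rewrite subr_eq0.
have := H y _ yx Dy; rewrite /ball /= distrC => /(_ yxd) {}H.
have -> : f y - f x - derive_on D f x * (y - x) =
  (y - x) * (diff_quotient f x y - derive_on D f x).
  by rewrite /diff_quotient; field.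
by rewrite normrM mulrC ler_wpM2r// distrC.
Qed.

Lemma derivable_on_within_continuous (R : realType) (D : set R) (f : R -> R) :
  derivable_on D f -> {within D, continuous f}.
Proof.
move=> dfD; apply/subspace_continuousP => x Dx.
have [d d0 H] := derive_on_expansion dfD Dx ltr01.
set g := derive_on D f x in H.
apply/cvgrPdist_le => e e0; rewrite near_withinE.
have g1 : 0 < `|g| + 1 by rewrite ltr_pwDr.
apply/nbhs_ballP; exists (Num.min d (e / (`|g| + 1))) => /=.
  by rewrite lt_min d0 divr_gt0.
move=> y; rewrite /ball /= distrC lt_min => /andP[yd ye] Dy.
rewrite distrC.
have -> : f y - f x = (f y - f x - g * (y - x)) + g * (y - x) by ring.
apply: (le_trans (ler_normD _ _)).
rewrite normrM; have := H y Dy yd; move: ye; rewrite ltr_pdivlMr//; lra.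
Qed.

(** In the interior of the interval the relative derivative is the ordinary
    one, and continuity at the endpoints is enough for the mean value theorem. *)
Lemma derivable_on_MVT (R : realType) (u v : R) (f : R -> R) :
  derivable_on `[u, v]%classic f ->
  forall x y, u <= x -> x < y -> y <= v ->
  exists2 z, x < z < y & f y - f x = derive_on `[u, v]%classic f z * (y - x).
Proof.
move=> df x y ux xy yv.
have [||z zxy ->] := @MVT R f (derive_on `[u, v]%classic f) x y xy.
- move=> z; rewrite in_itv/= => /andP[xz zy].
  have Dz : `[u, v]%classic z by rewrite /= in_itv/=; apply/andP; split; lra.
  set l := derive_on _ f z.
  suff H : (h^-1 *: ((f \o shift z) (h *: 1) - f z)) @[h --> (0:R)^'] --> l.
    by apply: DeriveDef; [apply: cvgP H|exact: cvg_lim H].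
  apply/cvgrPdist_le => e e0.
  have [d d0 H] := derive_on_expansion df Dz e0.
  rewrite near_withinE; apply/nbhs_ballP.
  exists (Num.min d (Num.min (z - x) (y - z))) => /=.
    by rewrite !lt_min d0/=; apply/andP; split; lra.
  move=> h; rewrite /ball/= sub0r normrN !lt_min => /and3P[hd h1 h2] h0.
  have {h1}/andP[h3 h4] : - (z - x) < h < z - x by rewrite -ltr_norml.
  have {h2}/andP[h5 h6] : - (y - z) < h < y - z by rewrite -ltr_norml.
  have Dh : `[u, v]%classic (h + z) by rewrite /= in_itv/=; apply/andP; split; lra.
  have := H _ Dh; rewrite addrK => /(_ hd); rewrite -/l => {}H.
  have -> : l - h^-1 *: (f (h *: 1 + z) - f z) =
      - (h^-1 * (f (h + z) - f z - l * h)).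
    by rewrite /GRing.scale/= mulr1; field.
  rewrite normrN normrM normfV mulrC ler_pdivrMr ?normr_gt0//.
- apply: continuous_subspaceW (derivable_on_within_continuous df).
  by move=> z /=; rewrite !in_itv/= => /andP[? ?]; apply/andP; split; lra.
by exists z => //; move: zxy; rewrite in_itv.
Qed.

Lemma C2_on_derive_lipschitz (R : realType) (u v : R) (f : R -> R) :
  u < v -> C2_on `[u, v]%classic f ->
  exists2 M, 0 <= M & forall x y, x \in `[u, v] -> y \in `[u, v] ->
    `|derive_on `[u, v]%classic f y - derive_on `[u, v]%classic f x|
      <= M * `|y - x|.
Proof.
move=> uv [_ dg cg]; set g := derive_on _ f in dg cg *.
have [p pin Hp] := EVT_max (ltW uv) cg.
have [q qin Hq] := EVT_min (ltW uv) cg.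
set g' := derive_on _ g in cg Hp Hq.
exists (`|g' p| + `|g' q|); first by rewrite addr_ge0.
have H x y : u <= x -> x < y -> y <= v ->
    `|g y - g x| <= (`|g' p| + `|g' q|) * `|y - x|.
  move=> ux xy yv; have [z /andP[xz zy] ->] := derivable_on_MVT dg ux xy yv.
  rewrite normrM ler_wpM2r//.
  have zin : z \in `[u, v] by rewrite in_itv/=; apply/andP; split; lra.
  have := Hp z zin; have := Hq z zin; rewrite -/g'.
  have := ler_norm (g' p); have := lerNnormlW (lexx `|g' q|).
  have := normr_ge0 (g' p); have := normr_ge0 (g' q).
  rewrite ler_norml => *; apply/andP; split; lra.
move=> x y; rewrite !in_itv/= => /andP[ux xv] /andP[uy yv].
have [xy|yx|->] := ltgtP x y.
- exact: H.
- by rewrite distrC (distrC y); exact: H.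
- by rewrite !subrr !normr0 mulr0.
Qed.

(** The last conclusion is the one-step distortion bound.  By the mean value
    theorem the two difference quotients are values [f' z] and [f' z'] with
    [z], [z'] in [[s, t]]; they differ by at most [M * (t - s)], and dividing
    by [f' z' >= 1] turns this into a bound on their ratio. *)
Lemma expanding_branch (R : realType) (u v : R) (f : R -> R) :
  u < v -> C2_on `[u, v]%classic f ->
  (forall x, u < x < v -> 1 < derive_on `[u, v]%classic f x) ->
  (forall x y, u <= x -> x < y -> y <= v -> y - x < f y - f x) /\
  exists M1 M, [/\ 1 <= M1, 0 <= M,
    (forall x y, u <= x -> x < y -> y <= v -> f y - f x <= M1 * (y - x)) &
    forall s t x y x' y', u <= s -> t <= v ->
      s <= x -> x < y -> y <= t -> s <= x' -> x' < y' -> y' <= t ->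
      (f y - f x) * (y' - x') <=
        (1 + M * (t - s)) * ((f y' - f x') * (y - x))].
Proof.
move=> uv C2f g1; have [M M0 gM] := C2_on_derive_lipschitz uv C2f.
have [df _ _] := C2f; set g := derive_on _ f in g1 gM.
have mvt x y : u <= x -> x < y -> y <= v ->
    exists2 z, x < z < y & f y - f x = g z * (y - x).
  exact: derivable_on_MVT.
have ivt z x y : u <= x -> y <= v -> x < z < y -> z \in `[u, v].
  by rewrite in_itv/= => ? ? /andP[? ?]; apply/andP; split; lra.
have g1' z x y : u <= x -> y <= v -> x < z < y -> 1 < g z.
  by move=> ? ? /andP[? ?]; apply: g1; apply/andP; split; lra.
split.
  move=> x y ux xy yv; have [z zxy ->] := mvt _ _ ux xy yv.
  by rewrite -[ltLHS]mul1r ltr_pM2r ?subr_gt0// (g1' z x y).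
exists (`|g u| + M * (v - u) + 1), M; split => //.
- rewrite -[leLHS]add0r lerD2r addr_ge0// mulr_ge0//; lra.
- move=> x y ux xy yv; have [z zxy ->] := mvt _ _ ux xy yv.
  rewrite ler_wpM2r ?subr_ge0 ?(ltW xy)//.
  have uin : u \in `[u, v] by rewrite in_itv/= lexx ltW.
  have zin := ivt z x y ux yv zxy.
  have := gM _ _ uin zin; have := ler_norm (g u); have := ler_norm (g z - g u).
  move: zxy => /andP[xz zy]; rewrite (ger0_norm (_ : 0 <= z - u)); last lra.
  have : M * (z - u) <= M * (v - u) by rewrite ler_wpM2l//; lra.
  lra.
- move=> s t x y x' y' us tv sx xy yt sx' xy' yt'.
  have ux : u <= x by lra.
  have yv : y <= v by lra.
  have ux' : u <= x' by lra.
  have yv' : y' <= v by lra.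
  have [z zxy ->] := mvt _ _ ux xy yv.
  have [z' zxy' ->] := mvt _ _ ux' xy' yv'.
  have -> : (1 + M * (t - s)) * (g z' * (y' - x') * (y - x)) =
    ((1 + M * (t - s)) * g z') * (y - x) * (y' - x') by ring.
  rewrite ler_wpM2r ?subr_ge0 ?(ltW xy')// ler_wpM2r ?subr_ge0 ?(ltW xy)//.
  have zin := ivt z x y ux yv zxy; have zin' := ivt z' x' y' ux' yv' zxy'.
  have := gM _ _ zin' zin; have := ler_norm (g z - g z').
  have gz1 := g1' z' x' y' ux' yv' zxy'.
  move: zxy zxy' => /andP[xz zy] /andP[xz' zy'].
  have zz : `|z - z'| <= t - s by rewrite ler_norml; apply/andP; split; lra.
  have : M * `|z - z'| <= M * (t - s) by rewrite ler_wpM2l.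
  have : M * (t - s) <= M * (t - s) * g z'.
    by rewrite ler_peMr ?mulr_ge0//; lra.
  lra.
Qed.

(** * Slowly varying functions *)

Lemma lebesgue_measure_shift (R : realType) (u : R) (A : set R) :
  measurable (A : set (measurableTypeR R)) ->
  lebesgue_measure ((fun x : R => x + u) @^-1` A) = lebesgue_measure A :> \bar R.
Proof.
move=> mA.
have mf : measurable_fun setT
    ((fun x => x + u) : measurableTypeR R -> measurableTypeR R).
  exact: measurable_funD.
pose F : {mfun (measurableTypeR R) >-> (measurableTypeR R)} :=
  HB.pack ((fun x => x + u) : measurableTypeR R -> measurableTypeR R)
    (isMeasurableFun.Build _ _ _ _ _ mf).
suff : lebesgue_measure A = pushforward lebesgue_measure F A :> \bar R by move=> ->.
apply: lebesgue_measure_unique => //= _ [[a b]] _ <-.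
rewrite /pushforward /=.
have -> : (fun x => x + u) @^-1` `]a, b] = `]a - u, b - u]%classic.
  by apply/seteqP; split => x /=; rewrite !in_itv/= ltrBlDr lerBrDr.
rewrite !lebesgue_measure_itv/= !lte_fin ltrD2r.
by rewrite -!EFinD opprB addrA subrK.
Qed.

Lemma lebesgue_measure_exhaustion (R : realType) (a e : R)
    (V : nat -> set (measurableTypeR R)) :
  0 <= a -> 0 < e -> (forall n, measurable (V n)) -> nondecreasing_seq V ->
  \bigcup_n V n = `[0, a]%classic ->
  exists N, forall n, (N <= n)%N -> ((a - e)%:E < lebesgue_measure (V n))%E.
Proof.
move=> a0 e0 mV ndV VE.
have : lebesgue_measure \o V @ \oo --> (a%:E : \bar R).
  have -> : a%:E = lebesgue_measure (\bigcup_n V n) :> \bar R.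
    rewrite VE lebesgue_measure_itv/= lte_fin.
    move: a0; rewrite le_eqVlt => /orP[/eqP <-|->]; first by rewrite ltxx.
    by rewrite sube0.
  apply: nondecreasing_cvg_mu => //.
  by rewrite VE; exact: measurable_itv.
move=> VE'; have ae : (a - e)%:E = ((fun x => x - e) a)%:E :> \bar R by [].
have /VE' [N _ HN] : nbhs (a%:E : \bar R) [set y | ((a - e)%:E < y)%E].
  by apply: (nbhs_open_ereal_gt (f := fun x => x - e)); rewrite gtrBl.
by exists N => n Nn; exact: HN.
Qed.

(** A uniform one-sided bound for the pointwise convergence
    [l (lam * t) / l t --> 1].  If it fails, there are [t n --> +oo] and
    [s n = expR (u n) * t n], [0 <= u n <= 1], with [4 * l (s n) < l (t n)].
    The set [V n] of the [v] in [[0, 2]] such that [l (t m) <= 2 * l (expR v * t m)]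
    for all [m >= n], and the set [W n] of the [v] in [[0, 1]] such that
    [l (expR v * s m) <= 2 * l (s m)] for all [m >= n], increase to the whole
    intervals.  For large [n] the measures of [V n] and of the translate
    [u n + W n] inside [[0, 2]] add up to more than [2], so these sets share a
    point [v], and comparing both values with [l (expR v * t n)] gives
    [l (t n) <= 4 * l (s n)]. *)
Lemma slowly_varying_ratio_bounded (R : realType) (l : R -> R) :
  slowly_varying_pinfty l ->
  exists2 t0, 0 < t0 & forall t lam, t0 <= t -> 1 <= lam <= 2 ->
    l t <= 4 * l (lam * t).
Proof.
move=> [[lpos lmeas] lsv].
have [//|/forall2NP H] := pselect (exists2 t0, 0 < t0 &
  forall t lam, t0 <= t -> 1 <= lam <= 2 -> l t <= 4 * l (lam * t)).
have /choice[g gP] n : exists tu : R * R, [/\ n.+1%:R <= tu.1, 0 <= tu.2 <= 1 &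
    4 * l (expR tu.2 * tu.1) < l tu.1].
  have [/negP|] := H n.+1%:R; first by rewrite ltr0Sn.
  move=> /existsNP[t /existsNP[lam /not_implyP[nt /not_implyP[/andP[l1 l2]]]]].
  move=> /negP; rewrite -ltNge => lt.
  have lam0 : 0 < lam by lra.
  exists (t, ln lam); split => //=; last by rewrite lnK.
  have := @le_ln1Dx R (lam - 1); rewrite (_ : 1 + (lam - 1) = lam); last by ring.
  move=> H1.
  by rewrite ln_ge0//= (le_trans (H1 _))//; lra.
pose t n := (g n).1; pose u n := (g n).2.
pose s n := expR (u n) * t n.
have tn n : n.+1%:R <= t n by have [] := gP n.
have t0 n : 0 < t n by apply: lt_le_trans (tn n); rewrite ltr0n.
have u01 n : 0 <= u n <= 1 by have [] := gP n.
have sn n : n.+1%:R <= s n.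
  apply: (le_trans (tn n)); rewrite /s ler_peMl//; first exact: ltW.
  by rewrite -expR0 ler_expR; have /andP[] := u01 n.
have s0 n : 0 < s n by apply: lt_le_trans (sn n); rewrite ltr0n.
have lts n : 4 * l (s n) < l (t n) by have [] := gP n.
have mle (r : nat -> R) m : 0 < r m ->
    measurable_fun setT (fun v : measurableTypeR R => l (expR v * r m)).
  move=> rm; apply: (@measurable_comp _ _ _ (measurableTypeR R) (measurableTypeR R)
    (measurableTypeR R) `]0, +oo[%classic l setT (fun v => expR v * r m)) => //.
  - by move=> _ [v _ <-] /=; rewrite in_itv/= andbT mulr_gt0// expR_gt0.
  - by apply: measurable_funM => //; exact: measurable_expR.
have cvg_r (r : nat -> R) : (forall n, n.+1%:R <= r n) -> r n @[n --> \oo] --> +oo.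
  move=> rn; apply/cvgryPge => A; exists (Num.trunc `|A|) => // n /= An.
  apply: le_trans (rn n); apply: (le_trans (ler_norm A)).
  apply/ltW/(lt_le_trans (truncnS_gt _)).
  by rewrite ler_nat ltnS.
have evt (r : nat -> R) v : (forall n, n.+1%:R <= r n) ->
    l (expR v * r n) / l (r n) @[n --> \oo] --> (1 : R).
  move=> rn.
  exact: cvg_comp (cvg_r r rn) (lsv (expR v) (expR_gt0 _)).
pose V n : set (measurableTypeR R) := `[0, 2]%classic `&`
  \bigcap_(m in [set m | (n <= m)%N]) [set v | l (t m) <= 2 * l (expR v * t m)].
pose W n : set (measurableTypeR R) := `[0, 1]%classic `&`
  \bigcap_(m in [set m | (n <= m)%N]) [set v | l (expR v * s m) <= 2 * l (s m)].
have mV n : measurable (V n).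
  apply: measurableI; first exact: measurable_itv.
  apply: bigcap_measurable; first by exists n => /=.
  move=> m _; rewrite -[X in measurable X]setTI.
  have := @measurable_fun_ler _ _ R setT (cst (l (t m)))
    (fun v : measurableTypeR R => 2 * l (expR v * t m)).
  have -> : [set v | l (t m) <= 2 * l (expR v * t m)] =
    (fun v => cst (l (t m)) v <= 2 * l (expR v * t m)) @^-1` [set true] by [].
  apply => //; apply: measurable_funM => //; exact: mle.
have mW n : measurable (W n).
  apply: measurableI; first exact: measurable_itv.
  apply: bigcap_measurable; first by exists n => /=.
  move=> m _; rewrite -[X in measurable X]setTI.
  have := @measurable_fun_ler _ _ R setT
    (fun v : measurableTypeR R => l (expR v * s m)) (cst (2 * l (s m))).
  have -> : [set v | l (expR v * s m) <= 2 * l (s m)] =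
    (fun v => l (expR v * s m) <= cst (2 * l (s m)) v) @^-1` [set true] by [].
  apply => //; exact: mle.
have VE : \bigcup_n V n = `[0, 2]%classic.
  apply/seteqP; split=> [v [n _ []//]|v v02].
  have /cvgrPdist_le/(_ (1/2))[|N _ HN] := evt t v tn; first by lra.
  exists N => //; split=> // m /= Nm; have := HN m Nm => /=.
  have lm : 0 < l (t m) by exact: lpos.
  move=> /ler_normlP[_]; rewrite lerBlDl -lerBlDr ler_pdivlMr//; lra.
have WE : \bigcup_n W n = `[0, 1]%classic.
  apply/seteqP; split=> [v [n _ []//]|v v02].
  have /cvgrPdist_le/(_ (1/2))[|N _ HN] := evt s v sn; first by lra.
  exists N => //; split=> // m /= Nm; have := HN m Nm => /=.
  have lm : 0 < l (s m) by exact: lpos.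
  rewrite distrC => /ler_normlP[_]; rewrite lerBlDl ler_pdivrMr//; lra.
have ndV : nondecreasing_seq V.
  move=> m n mn; apply/subsetPset => v [v02 Vv]; split=> // k /= nk.
  by apply: Vv => /=; exact: leq_trans nk.
have ndW : nondecreasing_seq W.
  move=> m n mn; apply/subsetPset => v [v02 Vv]; split=> // k /= nk.
  by apply: Vv => /=; exact: leq_trans nk.
have h12 : 0 < 1 / 2 :> R by lra.
have h2 : 0 <= 2 :> R by lra.
have h22 : 2 <= 2 - 1 / 2 + (1 - 1 / 2) :> R by lra.
have [N1 HN1] := lebesgue_measure_exhaustion h2 h12 mV ndV VE.
have [N2 HN2] := lebesgue_measure_exhaustion ler01 h12 mW ndW WE.
pose n := maxn N1 N2.
have {HN1} Vn := HN1 n (leq_maxl _ _); have {HN2} Wn := HN2 n (leq_maxr _ _).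
pose W' : set (measurableTypeR R) := (fun x => x + - u n) @^-1` (W n).
have mW' : measurable W'.
  have mf : measurable_fun setT
      ((fun x => x + - u n) : measurableTypeR R -> measurableTypeR R).
    exact: measurable_funD.
  by rewrite -[W']setTI; exact: mf.
have Wn' : ((1 - 1 / 2)%:E < lebesgue_measure W')%E.
  by have -> := lebesgue_measure_shift (- u n) (mW n).
have : V n `&` W' !=set0.
  apply/set0P/eqP => VW.
  have : (lebesgue_measure (V n `|` W') <= lebesgue_measure (`[0%R, 2%R]%classic : set (measurableTypeR R)))%E.
    apply: le_measure; rewrite ?inE//.
      exact: measurableU.
    move=> v /= [[]//|[+ _]]; rewrite !in_itv/=; have /andP[ua ub] := u01 n.
    move=> /andP[va vb]; rewrite -(subrK (u n) v) addr_ge0//=.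
    by rewrite (_ : 2 = 1 + 1 :> R)// lerD.
  rewrite measureU// lebesgue_measure_itv/= lte_fin ltr0n/= sube0.
  move=> /(lt_le_trans (lteD Vn Wn')); rewrite -EFinD lte_fin ltNge.
  by rewrite h22.
move=> [v [[_ /(_ n (leqnn n)) /= Vv] [_ /(_ n (leqnn n)) /= Wv]]].
have := lts n; rewrite ltNge; move=> /negP; case.
apply: (le_trans Vv); rewrite (_ : 4 = 2 * 2 :> R); last by ring.
rewrite -mulrA ler_pM2l//; apply: le_trans Wv.
by rewrite /s mulrA -expRD subrK.
Qed.

(** * Counting and last visits *)

Section counting.
Context d (X : measurableType d) (R : realType).
Context (mu : {measure set X -> \bar R}) (I : Type) (s : seq I).
Context (F : I -> set X) (mF : forall i, measurable (F i)).

Let count x : \bar R := ((\sum_(i <- s) (x \in F i))%N%:R)%:E.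

Let countE x : count x = \sum_(i <- s) (\1_(F i) x)%:E.
Proof. by rewrite /count sumEFin natr_sum. Qed.

Let mF1 i : measurable_fun setT (fun x => (\1_(F i) x)%:E : \bar R).
Proof. by apply/measurable_EFinP; exact: measurable_indic. Qed.

Let integral_count : (\int[mu]_x count x = \sum_(i <- s) mu (F i))%E.
Proof.
under eq_integral do rewrite countE.
have -> := @ge0_integral_sum _ _ _ mu _ measurableT _ _ mF1.
  by apply: eq_bigr => i _; rewrite integral_indic// setIT.
by move=> i x _; rewrite lee_fin.
Qed.

Let measurable_count D : measurable_fun D count.
Proof.
rewrite (funext countE); exact/measurable_funTS/emeasurable_sum.
Qed.

(** This and the following bound integrate the number of the sets [F i] that
    contain a point. *)
Lemma measure_count_ge (r : nat) (C : set X) : measurable C ->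
  (forall x, C x -> (r <= \sum_(i <- s) (x \in F i))%N) ->
  (r%:R%:E * mu C <= \sum_(i <- s) mu (F i))%E.
Proof.
move=> mC H; rewrite -integral_count -integral_cst//.
apply: (@le_trans _ _ (\int[mu]_(x in C) count x)%E).
  apply: ge0_le_integral => //.
  - by move=> x _; rewrite lee_fin.
  - by move=> x Cx; rewrite lee_fin ler_nat H.
apply: ge0_subset_integral => //.
by move=> x _; rewrite lee_fin.
Qed.

Lemma measure_count_le (r : nat) (C : set X) : measurable C ->
  (forall x, (\sum_(i <- s) (x \in F i) <= r * (x \in C))%N) ->
  (\sum_(i <- s) mu (F i) <= r%:R%:E * mu C)%E.
Proof.
move=> mC H; rewrite -integral_count -(setIT C) -integral_indic//.
have mC1 : measurable_fun setT (fun x => (\1_C x)%:E : \bar R).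
  by apply/measurable_EFinP; exact: measurable_indic.
rewrite -ge0_integralZl//.
apply: ge0_le_integral => //.
- by move=> x _; rewrite lee_fin.
- exact: measurable_funeM.
- by move=> x _; rewrite -EFinM lee_fin indicE -natrM ler_nat H.
Qed.

Hypothesis Ffin : forall i, (mu (F i) < +oo)%E.

Let fineF : (\sum_(i <- s) mu (F i) = (\sum_(i <- s) fine (mu (F i)))%:E)%E.
Proof.
by rewrite -sumEFin; apply: eq_bigr => i _; rewrite fineK// ge0_fin_numE.
Qed.

Lemma fine_measure_count_ge (r : nat) (C : set X) : measurable C ->
  (mu C < +oo)%E ->
  (forall x, C x -> (r <= \sum_(i <- s) (x \in F i))%N) ->
  r%:R * fine (mu C) <= \sum_(i <- s) fine (mu (F i)).
Proof.
move=> mC Cfin H; rewrite -lee_fin EFinM -fineF fineK ?ge0_fin_numE//.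
exact: measure_count_ge.
Qed.

Lemma fine_measure_count_le (r : nat) (C : set X) : measurable C ->
  (mu C < +oo)%E ->
  (forall x, (\sum_(i <- s) (x \in F i) <= r * (x \in C))%N) ->
  \sum_(i <- s) fine (mu (F i)) <= r%:R * fine (mu C).
Proof.
move=> mC Cfin H; rewrite -lee_fin EFinM -fineF (fineK (x := mu C)) ?ge0_fin_numE//.
exact: measure_count_le.
Qed.
End counting.

(** Used to decompose the times [j] according to the time [k] of the last
    visit and the time [j - k] elapsed since. *)
Lemma sum_diagonal_le (n : nat) (a : nat -> nat -> nat) :
  (\sum_(0 <= j < n) \sum_(0 <= k < j.+1) a k (j - k) <=
   \sum_(0 <= k < n) \sum_(0 <= t < n) a k t)%N.
Proof.
rewrite (eq_big_nat _ _ (F2 := fun j => \sum_(0 <= k < n | (k <= j)%N) a k (j - k))%N).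
  rewrite (exchange_big_dep_nat xpredT)//=; apply: leq_sum => k _.
  rewrite (_ : \sum_(0 <= j < n | (k <= j)%N) a k (j - k)%N =
               \sum_(k <= j < n) a k (j - k)%N)%N.
    rewrite -{1}(add0n k) big_addn; under eq_bigr do rewrite addnK.
    by rewrite [leqRHS](big_cat_nat (leq0n (n - k)) (leq_subr _ _))/= leq_addr.
  have [kn|nk] := leqP k n.
    rewrite (big_cat_nat (leq0n k) kn)/= [X in (X + _)%N](_ : _ = 0%N).
      by rewrite add0n big_nat_cond [RHS]big_nat_cond; apply: eq_bigl => j; lia.
    by rewrite big_nat_cond big_pred0// => j; lia.
  rewrite [RHS]big_geq ?(ltnW nk)// big_nat_cond big_pred0// => j; lia.
move=> j /andP[_ jn].
rewrite (big_cat_nat (leq0n j.+1) jn)/= [X in (_ + X)%N](_ : _ = 0%N).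
  by rewrite addn0 big_nat_cond [RHS]big_nat_cond; apply: eq_bigl => k; lia.
by rewrite big_nat_cond big_pred0// => k; lia.
Qed.

Lemma sum_exclusive_le1 (m n : nat) (P : nat -> bool) :
  (forall i j, (m <= i)%N -> (i < j)%N -> (j < n)%N -> P i -> P j -> False) ->
  (\sum_(m <= i < n) P i <= 1)%N.
Proof.
move=> H; elim: n H => [|n IH] H; first by rewrite big_geq.
have [mn|nm] := leqP m n; last by rewrite big_geq.
rewrite big_nat_recr//=; case Pn : (P n) => /=; last first.
  by rewrite addn0 IH// => i j mi ij jn; apply: H => //; lia.
rewrite big_nat_cond big1// => i /andP[/andP[mi iN] _].
by case Pi : (P i) => //; have := H i n mi iN (leqnn _) Pi Pn.
Qed.

(** Only the last [N + 1] times at which [y] holds have at most [N] successors. *)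
Lemma count_recent_le (y : nat -> bool) (N n : nat) :
  (\sum_(0 <= u < n.+1) (y u && (\sum_(u.+1 <= i < n.+1) y i <= N)) <= N.+1)%N.
Proof.
elim: n y => [|n IH] y.
  by rewrite big_nat1; case: (y 0%N && _).
rewrite big_nat_recl//=; set b := (y 0%N && _); case bE : b.
  move: bE => /andP[_ bN]; rewrite add1n ltnS; apply: leq_trans bN.
  rewrite big_add1/=.
  by apply: leq_sum => i _; case: (y i.+1) => //=; exact: leq_b1.
rewrite add0n; apply: leq_trans (IH (fun i => y i.+1)).
apply: eq_leq; apply: eq_bigr => u _; congr (nat_of_bool (_ && (_ <= _)%N)).
by rewrite big_add1.
Qed.

Lemma last_time (X : Type) (T : X -> X) (Y : set X) x i j : (i <= j)%N -> Y (iter i T x) ->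
  exists k, [/\ (k <= j)%N, Y (iter k T x) &
    forall i', (k < i' <= j)%N -> ~ Y (iter i' T x)].
Proof.
elim: j => [|j IH].
  by rewrite leqn0 => /eqP -> Yx; exists 0%N; split => // i' ?; lia.
move=> ij Yi; have [Yj|nYj] := pselect (Y (iter j.+1 T x)).
  by exists j.+1; split => // i' ?; lia.
have ij' : (i <= j)%N.
  rewrite -ltnS ltn_neqAle ij andbT; apply/eqP => ijE.
  by apply: nYj; rewrite -ijE.
have [k [kj Yk H]] := IH ij' Yi; exists k; split => //; first exact: leqW.
move=> i' /andP[ki]; rewrite leq_eqVlt => /orP[/eqP ->//|i'j].
by apply: H; rewrite ki.
Qed.

Lemma iter_side (X : Type) (T : X -> X) (Y C : set X) x k j :
  (forall x, C x -> C (T x) \/ Y (T x)) -> C (iter k.+1 T x) ->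
  (forall i, (k < i <= j)%N -> ~ Y (iter i T x)) ->
  forall i, (k < i <= j)%N -> C (iter i T x).
Proof.
move=> stepC C1 nY; elim=> [//|i IH] /andP[]; rewrite ltnS leq_eqVlt.
move=> /orP[/eqP <- //|ki] ij.
have /stepC[//|] : C (iter i T x) by apply: IH; lia.
by move=> Yi; case: (nY i.+1) => //; lia.
Qed.

(** * Excursions of a measure-preserving map *)
Section system.
Context d (X : measurableType d) (R : realType).
Context (mu : {measure set X -> \bar R}) (T : X -> X).
Context (mT : measurable_fun setT T).
Context (Tinv : forall A, measurable A -> mu (T @^-1` A) = mu A).

Lemma measurable_iter k A : measurable A -> measurable (iter k T @^-1` A).
Proof.
elim: k A => [//|k IH] A mA.
rewrite (_ : iter k.+1 T @^-1` A = iter k T @^-1` (T @^-1` A))//.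
by apply: IH; rewrite -[_ @^-1` _]setTI; exact: mT.
Qed.

Lemma measure_iter k A : measurable A -> mu (iter k T @^-1` A) = mu A.
Proof.
elim: k A => [//|k IH] A mA.
rewrite (_ : iter k.+1 T @^-1` A = iter k T @^-1` (T @^-1` A))//.
by rewrite IH ?Tinv//; rewrite -[_ @^-1` _]setTI; exact: mT.
Qed.

(** Excursions and return layers describe the same parts of orbits seen from
    their start in [Y] and from their points outside of [Y]; only the latter
    occur in the wandering rates. *)
Definition excursion (Y A : set X) (t : nat) : set X :=
  [set x | Y x /\ forall j, (0 < j <= t)%N -> A (iter j T x)].

Definition return_layer (Y A : set X) (t : nat) : set X :=
  [set x | (forall j, (j < t)%N -> A (iter j T x)) /\ Y (iter t T x)].

Lemma measurable_excursion Y A t : measurable Y -> measurable A ->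
  measurable (excursion Y A t).
Proof.
move=> mY mA.
rewrite (_ : excursion Y A t = Y `&`
    \bigcap_(j in [set j | (0 < j <= t)%N]) (iter j T @^-1` A)).
  apply: measurableI => //; apply: bigcap_measurableType => j _.
  exact: measurable_iter.
by apply/seteqP; split => x [Yx H]; split.
Qed.

Lemma measurable_return_layer Y A t : measurable Y -> measurable A ->
  measurable (return_layer Y A t).
Proof.
move=> mY mA.
rewrite (_ : return_layer Y A t =
    \bigcap_(j in [set j | (j < t)%N]) (iter j T @^-1` A) `&` iter t T @^-1` Y).
  apply: measurableI; last exact: measurable_iter.
  by apply: bigcap_measurableType => j _; exact: measurable_iter.
by apply/seteqP; split => x [Yx H]; split.
Qed.

Lemma excursion_sub Y A t : excursion Y A t `<=` Y.
Proof. by move=> x []. Qed.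

Lemma excursionS Y A t : excursion Y A t.+1 `<=` excursion Y A t.
Proof. by move=> x [Yx H]; split => // j ?; apply: H; lia. Qed.

(** The hypotheses say that [A] can only be entered from [Y] and only be left
    to [Y].  Splitting an excursion of length [t], respectively the preimage of
    the return layer, according to what happens at the next, respectively
    previous, time shows that excursions and layers lose the same mass from [t]
    to [t + 1], namely the measure of the points of [Y] that return to [Y]
    after exactly [t] steps in [A].  Hence their measures differ by a constant. *)
Section one_side.
Context (Y A : set X) (mY : measurable Y) (mA : measurable A).
Context (Yfin : (mu Y < +oo)%E) (AY : forall x, A x -> Y x -> False).
Context (stepA : forall x, A x -> A (T x) \/ Y (T x)).
Context (backA : forall x, A (T x) -> A x \/ Y x).

Let q t := fine (mu (return_layer Y A t)).
Let b t := fine (mu (excursion Y A t)).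

Let excursion_fin t : (mu (excursion Y A t) < +oo)%E.
Proof.
apply: le_lt_trans Yfin; apply: le_measure; rewrite ?inE//.
- exact: measurable_excursion.
- exact: excursion_sub.
Qed.

Let return_layer_fin t : (mu (return_layer Y A t) < +oo)%E.
Proof.
apply: le_lt_trans Yfin; rewrite -(measure_iter t mY).
apply: le_measure; rewrite ?inE.
- exact: measurable_return_layer.
- exact: measurable_iter.
- by move=> x [].
Qed.

Let first_return t := Y `&` T @^-1` return_layer Y A t.

Let mTR t : measurable (T @^-1` return_layer Y A t).
Proof. exact: (@measurable_iter 1 _ (measurable_return_layer t mY mA)). Qed.

Let m_first_return t : measurable (first_return t).
Proof. exact: measurableI. Qed.

Let first_return_fin t : (mu (first_return t) < +oo)%E.
Proof.
by apply: le_lt_trans Yfin; apply: le_measure; rewrite ?inE//; exact: subIsetl.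
Qed.

Let measure_return_layerS t : (0 < t)%N ->
  (mu (return_layer Y A t) = mu (return_layer Y A t.+1) + mu (first_return t))%E.
Proof.
move=> t0; rewrite -(Tinv (measurable_return_layer t mY mA)).
rewrite -measureU//; last 2 first.
- exact: measurable_return_layer.
- by rewrite -subset0 => x [[/(_ 0%N) + _] [Yx _]]; move=> /(_ isT) /AY; exact.
congr (mu _); apply/seteqP; split => x.
- move=> [H Yx]; have /backA[Ax|Yx'] : A (T x) by exact: (H 0%N).
    left; split; last by rewrite iterSr.
    by case=> [//|j jt]; rewrite iterSr; apply: H.
  by right; split.
- move=> [[H Yx]|[_ []//]]; split; last by rewrite -iterSr.
  by move=> j jt; rewrite -iterSr; apply: H; lia.
Qed.

Let measure_excursionS t : (0 < t)%N ->
  (mu (excursion Y A t) = mu (excursion Y A t.+1) + mu (first_return t))%E.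
Proof.
move=> t0; rewrite -measureU//; last 2 first.
- exact: measurable_excursion.
- rewrite -subset0 => x [[_ H] [_ [_ Yx]]].
  by apply: (AY _ Yx); rewrite -iterSr; apply: H; lia.
congr (mu _); apply/seteqP; split => x.
- move=> [Yx H]; have /stepA[Ax|Yx'] : A (iter t T x) by apply: H; lia.
    left; split => // j /andP[j0]; rewrite leq_eqVlt => /orP[/eqP ->//|jt].
    by apply: H; lia.
  right; split => //; split; last by rewrite -iterSr.
  by move=> j jt; rewrite -iterSr; apply: H; lia.
- move=> [[Yx H]|[Yx [H _]]]; split => // j jt; first by apply: H; lia.
  by case: j jt => // j jt; rewrite iterSr; apply: H; lia.
Qed.

Let excursion_diff t : (0 < t)%N -> b t - b t.+1 = q t - q t.+1.
Proof.
move=> t0; rewrite /b /q measure_excursionS// measure_return_layerS//.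
by rewrite !fineD ?ge0_fin_numE//; ring.
Qed.

Let excursion_diffn t L : (0 < t)%N -> b t - b (t + L)%N = q t - q (t + L)%N.
Proof.
move=> t0; elim: L => [|L IH]; first by rewrite addn0 !subrr.
have := @excursion_diff (t + L) (ltn_addr _ t0); rewrite addnS; lra.
Qed.

Lemma return_layer_noninc s t : (0 < s)%N -> (s <= t)%N -> q t <= q s.
Proof.
move=> s0 /subnKC <-; elim: (t - s)%N => [|L IH]; first by rewrite addn0.
apply: le_trans IH; rewrite addnS /q [leRHS](_ : _ = fine (mu
  (return_layer Y A (s + L).+1) + mu (first_return (s + L)))%E); last first.
  by rewrite -measure_return_layerS//; lia.
by rewrite fineD ?ge0_fin_numE// lerDl fine_ge0.
Qed.

Lemma excursion_ge s L : (0 < s)%N -> q s - q (s + L)%N <= b s.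
Proof. by move=> s0; rewrite -excursion_diffn// gerBl fine_ge0. Qed.

(** The constant difference is at most zero, as infinite excursions are
    negligible. *)
Lemma excursion_le t : mu (\bigcap_t excursion Y A t) = 0%E -> (0 < t)%N ->
  b t <= q t.
Proof.
move=> B0 t0.
have cB : mu \o excursion Y A @ \oo --> (0%E : \bar R).
  rewrite -B0; apply: nonincreasing_cvg_mu => //.
  - by move=> i; exact: measurable_excursion.
  - by apply: bigcap_measurableType => i _; exact: measurable_excursion.
  - by apply/nonincreasing_seqP => n; apply/subsetPset; exact: excursionS.
have cb : b n @[n --> \oo] --> (0 : R).
  by apply: (fine_cvg cB).
apply/ler_addgt0Pl => e e0.
have /cvgrPdist_le/(_ _ e0)[N _ HN] := cb.
have := HN (t + N)%N (leq_addl _ _); rewrite /= sub0r normrN.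
have := excursion_diffn N t0; have : 0 <= q (t + N)%N by exact: fine_ge0.
have := ler_norm (b (t + N)%N); lra.
Unshelve. all: by end_near. Qed.

End one_side.
End system.

(** * Few visits and short sojourns *)

Lemma measurable_count_le d (X : measurableType d) (I : Type) (s : seq I)
    (F : I -> set X) (N : nat) : (forall i, measurable (F i)) ->
  measurable [set x | (\sum_(i <- s) (x \in F i) <= N)%N].
Proof.
move=> mF.
elim: s N => [|i s IH] N.
  rewrite (_ : [set x | _] = setT)//.
  by apply/seteqP; split => x //= _; rewrite big_nil.
rewrite (_ : [set x | _] =
    (~` F i `&` [set x | (\sum_(i <- s) (x \in F i) <= N)%N]) `|`
    (F i `&` (if N is N'.+1 then [set x | (\sum_(i <- s) (x \in F i) <= N')%N]
              else set0))).
  apply: measurableU; apply: measurableI => //; first exact: measurableC.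
  by case: N.
apply/seteqP; split => x /=; rewrite big_cons.
  have [/set_mem xFi|/negP xFi] := boolP (x \in F i); rewrite ?add0n ?add1n.
    by right; split => //; case: N H.
  by left; split => //; move=> /mem_set.
case=> -[xFi].
  by rewrite memNset.
by rewrite mem_set// add1n; case: N.
Qed.

Section visits.
Context d (X : measurableType d) (R : realType).
Context (mu : {measure set X -> \bar R}) (T : X -> X).
Context (mT : measurable_fun setT T).
Context (Tinv : forall A, measurable A -> mu (T @^-1` A) = mu A).
Context (Y : set X) (mY : measurable Y) (Yfin : (mu Y < +oo)%E).

Definition few_visits (A : set X) (N n : nat) : set X :=
  [set x | (\sum_(1 <= i < n.+1) (iter i T x \in A) <= N)%N].

Lemma measurable_few_visits A N n : measurable A ->
  measurable (few_visits A N n).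
Proof.
move=> mA; apply: (@measurable_count_le _ _ _ _ (fun i => iter i T @^-1` A)) => i.
exact: measurable_iter.
Qed.

Let sub_fin (A B : set X) : measurable A -> measurable B -> A `<=` B ->
  (mu B < +oo)%E -> (mu A < +oo)%E.
Proof.
by move=> mA mB AB; apply: le_lt_trans; apply: le_measure; rewrite ?inE.
Qed.

Let sum_pairs n (V : nmodType) (a : nat -> nat -> V) :
  \sum_(p <- [seq (k, t) | k <- index_iota 0 n, t <- index_iota 0 n]) a p.1 p.2
  = \sum_(0 <= k < n) \sum_(0 <= t < n) a k t.
Proof. by rewrite big_allpairs. Qed.

(** Every time [j <= n] is decomposed as [k + t], where [k] is the time of the
    last visit to [Y] up to [j].  A point with at most [N] visits then lies, for
    [n + 1] pairs [(k, t)], in the set of the points that visit [Y] at most [N]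
    times up to [k] and start at time [k] an excursion of length [t].  For
    fixed [t], invariance allows to shift these sets so that all excursions
    start at time [n]; a point then belongs to at most [N + 1] of them, one for
    each of the most recent visits. *)
Lemma measure_few_visits N n :
  n.+1%:R * fine (mu (Y `&` few_visits Y N n)) <=
  N.+1%:R * \sum_(0 <= t < n.+1) fine (mu (excursion T Y (~` Y) t)).
Proof.
pose C := excursion T Y (~` Y).
have mC t : measurable (C t).
  by apply: measurable_excursion => //; exact: measurableC.
pose V k := Y `&` few_visits Y N k.
have mV k : measurable (V k).
  by apply: measurableI => //; exact: measurable_few_visits.
pose F (p : nat * nat) := V p.1 `&` iter p.1 T @^-1` C p.2.
have mF p : measurable (F p).
  by apply: measurableI => //; exact: measurable_iter.
have Ffin p : (mu (F p) < +oo)%E.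
  by apply: (sub_fin _ mY) => // x [[]].
have Vfin : (mu (V n) < +oo)%E by apply: (sub_fin _ mY) => // x [].
have /= := @fine_measure_count_ge _ _ _ mu _
  [seq (k, t) | k <- index_iota 0 n.+1, t <- index_iota 0 n.+1] F mF Ffin n.+1
  _ (mV n) Vfin.
rewrite (sum_pairs n.+1 (fun k t => fine (mu (F (k, t))))) => H.
apply: (le_trans (H _)) => {H}.
  move=> x [Yx xN].
  rewrite (sum_pairs n.+1 (fun k t => nat_of_bool (x \in F (k, t)))).
  apply: leq_trans (sum_diagonal_le _ _).
  rewrite -[leqLHS]card_ord -sum1_card big_mkord; apply: leq_sum => -[j /= jn] _.
  have [k [kj Yk H]] := last_time (T := T) (i := 0) (leq0n j) Yx.
  rewrite (big_cat_nat (leq0n k) (leqW kj))/= [X in (_ + X)%N]big_ltn ?ltnS//=.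
  rewrite (_ : x \in F _); first by lia.
  apply/mem_set; split => /=; last first.
    split => // i ij; rewrite /= -iterD; apply: H; lia.
  split => //; apply: leq_trans xN.
  rewrite [leqRHS](big_cat_nat (isT : (1 <= k.+1)%N))/= ?leq_addr//; lia.
rewrite exchange_big/= mulr_sumr; apply: ler_sum => t _.
pose G k := iter (n - k) T @^-1` F (k, t).
have mG k : measurable (G k) by exact: measurable_iter.
have GF k : mu (G k) = mu (F (k, t)) by rewrite measure_iter.
have Cfin : (mu (C t) < +oo)%E by apply: (sub_fin _ mY) => // x [].
have nCfin : (mu (iter n T @^-1` C t) < +oo)%E by rewrite measure_iter.
rewrite (eq_bigr (fun k => fine (mu (G k)))) => [|k _]; last by rewrite GF.
rewrite -[X in _ * fine X](measure_iter mT Tinv n (mC t)).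
apply: fine_measure_count_le => // [k||x]; first by rewrite GF.
  exact: measurable_iter.
have [xC|xC] := boolP (x \in iter n T @^-1` C t); last first.
  rewrite muln0 leqn0; apply/eqP; rewrite big_nat_cond big1// => k.
  rewrite andbT ltnS => /andP[_ kn]; rewrite memNset// => -[_ /= xC'].
  by move/negP : xC; apply; apply/mem_set; rewrite /= -(subnKC kn) iterD.
rewrite muln1; apply: leq_trans (count_recent_le (fun i => iter i T x \in Y) N n).
rewrite big_nat_rev/= big_nat_cond [leqRHS]big_nat_cond; apply: leq_sum => u.
rewrite add0n andbT ltnS subSS => /andP[_ un].
have [/set_mem[[/= Yu xN] _]|//] := boolP (x \in _).
move: Yu; rewrite subKn// => Yu; rewrite mem_set//=.
move: xN; rewrite /few_visits /= -(@leq_add2r 0)%N.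
rewrite (_ : \sum_(u.+1 <= i < n.+1) (iter i T x \in Y) =
   \sum_(1 <= i < (n - u).+1) (iter i T (iter u T x) \in Y))%N; last first.
  rewrite -{1}(add1n u) big_addn (_ : n.+1 - u = (n - u).+1)%N; last by lia.
  by apply: eq_bigr => i _; rewrite iterD.
by rewrite subKn// !addn0 => ->.
Qed.

(** Outside of [Y], the space splits into [A] and the opposite set [A'] as far
    as orbits that start in the core [Om] are concerned.  The set [D] is the part
    of [A] where the orbit stays during [J] steps.  Sojourns are counted by
    visits to [D] up to time [k - J] because this depends on the symbols of the
    orbit before time [k] only, as the approximate independence of past and
    future demands. *)
Section sojourn.
Context (A A' D Om : set X) (J m : nat) (K : R).
Context (mA : measurable A) (mA' : measurable A').
Context (mD : measurable D) (mOm : measurable Om).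
Context (Omfin : (mu Om < +oo)%E).
Context (AY : forall x, A x -> Y x -> False).
Context (stepA : forall x, A x -> A (T x) \/ Y (T x)).
Context (stepA' : forall x, A' x -> A' (T x) \/ Y (T x)).
Context (stepY : forall x, Y x -> [\/ Y (T x), A (T x) | A' (T x)]).
Context (DA : D `<=` A).
Context (AD : forall x, (forall i, (i < J)%N -> A (iter i T x)) -> D x).
Context (Om_entry : forall x, Om x -> exists2 i, (i < J)%N & Y (iter i T x)).

Definition short_past k : set X :=
  Om `&` iter k T @^-1` Y `&` few_visits D m (k - J).

Let B := excursion T Y A.
Let B' := excursion T Y A'.
Let E := short_past.
Let s := (m + J)%N.

Hypothesis K0 : 0 <= K.
Hypothesis quasi_indep_le : forall k t, (J <= k)%N ->
  fine (mu (E k `&` iter k T @^-1` B' t)) * fine (mu Y) <=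
  K * (fine (mu (E k)) * fine (mu (B' t))).
Hypothesis quasi_indep_ge : forall k, (J <= k)%N ->
  fine (mu (E k)) * fine (mu (B s)) <=
  K * (fine (mu (E k `&` iter k T @^-1` B s)) * fine (mu Y)).
Hypothesis Ypos : 0 < fine (mu Y).
Hypothesis Bpos : 0 < fine (mu (B s)).

Let mB t : measurable (B t). Proof. exact: measurable_excursion. Qed.
Let mB' t : measurable (B' t). Proof. exact: measurable_excursion. Qed.
Let B'fin t : (mu (B' t) < +oo)%E.
Proof. by apply: (sub_fin _ mY) => // x []. Qed.

Let mE k : measurable (E k).
Proof.
apply: measurableI; last exact: measurable_few_visits.
by apply: measurableI => //; exact: measurable_iter.
Qed.

Let mEB k t (C : nat -> set X) : (forall t, measurable (C t)) ->
  measurable (E k `&` iter k T @^-1` C t).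
Proof. by move=> mC; apply: measurableI => //; exact: measurable_iter. Qed.

(** An excursion into [A] of length [m + J] that starts at time [i] contains
    more than [m] visits to [D], hence excludes a short past at a later visit to
    [Y]: the events are disjoint. *)
Let sum_E_B n : \sum_(J <= k < n) fine (mu (E k `&` iter k T @^-1` B s)) <=
  fine (mu Om).
Proof.
rewrite -[leRHS]mul1r.
apply: (@fine_measure_count_le _ _ _ mu _ (index_iota J n)
  (fun k => E k `&` iter k T @^-1` B s) _ _ 1) => //.
- by move=> k; exact: mEB.
- by move=> k; apply: (sub_fin _ mOm) => //; [exact: mEB|move=> x [[[]]]].
move=> x; rewrite mul1n; have [Omx|nOmx] := pselect (Om x); last first.
  rewrite big1// => k _; rewrite memNset// => -[[[]]] //.
rewrite mem_set//; apply: sum_exclusive_le1 => i j Ji ij jn.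
move=> /set_mem[_ [_ BA]] /set_mem[[[_ Yj] +] _].
rewrite /few_visits /= leqNgt => /negP; apply.
have iA k : (i < k <= i + s)%N -> A (iter k T x).
  by move=> ?; rewrite (_ : k = (k - i) + i)%N ?iterD; [apply: BA|]; lia.
have isj : (i + s < j)%N.
  rewrite ltnNge; apply/negP => jis.
  by apply: (AY _ Yj); apply: iA; lia.
have iD k : (i < k <= i + m.+1)%N -> D (iter k T x).
  by move=> ?; apply: AD => u uJ; rewrite -iterD; apply: iA; lia.
rewrite (@big_cat_nat _ _ _ i.+1)/=; [|lia|lia].
rewrite [X in (_ + X)%N](@big_cat_nat _ _ _ (i + m.+1).+1)/=; [|lia|lia].
rewrite (eq_big_nat _ _ (F2 := fun=> 1%N)
  (m := i.+1) (n := (i + m.+1).+1)); last first.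
  by move=> k ?; rewrite mem_set//; apply: iD; lia.
by rewrite sum_nat_const_nat; lia.
Qed.

Let sum_E n : \sum_(J <= k < n) fine (mu (E k)) <=
  K * fine (mu Om) * fine (mu Y) / fine (mu (B s)).
Proof.
rewrite ler_pdivlMr// mulr_suml.
apply: (@le_trans _ _ (\sum_(J <= k < n)
    K * (fine (mu (E k `&` iter k T @^-1` B s)) * fine (mu Y)))).
  by rewrite big_nat_cond [leRHS]big_nat_cond; apply: ler_sum => k /andP[/andP[Jk _] _]; exact: quasi_indep_ge.
rewrite -mulr_sumr -mulr_suml -mulrA ler_wpM2l//.
by rewrite ler_wpM2r// ltW.
Qed.

Let F (p : nat * nat) := if (p.1 < J)%N then iter p.1 T @^-1` B' p.2
  else E p.1 `&` iter p.1 T @^-1` B' p.2.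

Let mF p : measurable (F p).
Proof. by rewrite /F; case: ifP => _; [exact: measurable_iter|exact: mEB]. Qed.

Let Ffin p : (mu (F p) < +oo)%E.
Proof.
rewrite /F; case: ifP => _; first by rewrite measure_iter.
by apply: (sub_fin _ mOm) => //; [exact: mEB|move=> x [[[]]]].
Qed.

(** At all but [m + J] of the times up to [n] the orbit is outside of [A] and
    has visited the set [Y]; such a time belongs to an excursion into [A'] that
    starts at the last visit [k].  For [k < J] the sets [F] record no past:
    there are only [J] such times, and invariance bounds their measure. *)
Let count_F n x : Om x -> few_visits A m n x ->
  (n.+1 - J - m <= \sum_(0 <= k < n.+1) \sum_(0 <= t < n.+1) (x \in F (k, t)))%N.
Proof.
move=> Omx xm; apply: leq_trans (sum_diagonal_le _ _).
have [i iJ Yi] := Om_entry Omx.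
have [nJ|Jn] := leqP n.+1 J; first by rewrite (eqP nJ).
apply: (@leq_trans (\sum_(J <= j < n.+1) (iter j T x \notin A))).
  rewrite leq_subLR -[leqLHS]muln1 -sum_nat_const_nat.
  rewrite (eq_bigr (fun j => (iter j T x \in A) + (iter j T x \notin A))%N);
    last by move=> j _; case: (_ \in A).
  rewrite big_split/= leq_add2r; apply: leq_trans xm.
  by rewrite [leqRHS](@big_cat_nat _ _ _ J)/= ?leq_addl; lia.
rewrite [leqRHS](@big_cat_nat _ _ _ J)//=; last exact: ltnW.
apply: leq_trans (leq_addl _ _).
rewrite big_nat_cond [leqRHS]big_nat_cond; apply: leq_sum => j.
rewrite andbT => /andP[Jj jn].
have [//|/negP njA] := boolP (_ \in A).
have [k [kj Yk H]] := last_time (leq_trans (ltnW iJ) Jj) Yi.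
rewrite (big_cat_nat (leq0n k) (leqW kj))/= [X in (_ + X)%N]big_ltn ?ltnS//=.
rewrite (_ : x \in F _); first by lia.
have xB' : B' (j - k) (iter k T x).
  split => // u uj; rewrite -iterD.
  have kj' : (k < j)%N by lia.
  have [Y1|A1|A1] := stepY Yk.
  - by have := H k.+1; rewrite ltnSn kj' => /(_ isT); rewrite iterS.
  - case: njA; apply/mem_set.
    by apply: (iter_side stepA A1 H); rewrite kj' leqnn.
  - by apply: (iter_side stepA' A1 H); lia.
apply/mem_set; rewrite /F /=; case: ltnP => // Jk; split => //; split => //.
apply: leq_trans xm; apply: (@leq_trans (\sum_(1 <= u < (k - J).+1) (iter u T x \in A))).
  apply: leq_sum => u _; have [/set_mem/DA xA|//] := boolP (_ \in D).
  by rewrite mem_set.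
by rewrite [leqRHS](@big_cat_nat _ _ _ (k - J).+1)/= ?leq_addr//; lia.
Qed.

(** The number of times spent in [Y] or on excursions into [A'] is at least
    [n + 1 - J - m] on the event.  Its integral is estimated with
    quasi-independence, used twice: to separate the excursions into [A'] from
    the short past that precedes them, and to bound the sum of the measures of
    the short pasts by means of a single long excursion into [A]. *)
Lemma measure_short_sojourn n :
  (n.+1 - J - m)%:R * fine (mu (Om `&` few_visits A m n)) <=
  (J%:R + K ^+ 2 * fine (mu Om) / fine (mu (B s))) *
    \sum_(0 <= t < n.+1) fine (mu (B' t)).
Proof.
have mXn : measurable (Om `&` few_visits A m n).
  by apply: measurableI => //; exact: measurable_few_visits.
have Xfin : (mu (Om `&` few_visits A m n) < +oo)%E.
  by apply: (sub_fin _ mOm) => // x [].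
have H := @fine_measure_count_ge _ _ _ mu _
  [seq (k, t) | k <- index_iota 0 n.+1, t <- index_iota 0 n.+1] F mF Ffin
  (n.+1 - J - m) _ mXn Xfin.
apply: (le_trans (H _)) => {H}.
  move=> x [Omx xm].
  rewrite (sum_pairs n.+1 (fun k t => nat_of_bool (x \in F (k, t)))).
  exact: count_F.
rewrite (sum_pairs n.+1 (fun k t => fine (mu (F (k, t))))).
set W := \sum_(0 <= t < n.+1) fine (mu (B' t)).
have W0 : 0 <= W by apply: sumr_ge0 => t _; exact: fine_ge0.
pose cf k := if (k < J)%N then 1 else K * fine (mu (E k)) / fine (mu Y).
apply: (@le_trans _ _ (\sum_(0 <= k < n.+1) cf k * W)).
  apply: ler_sum => k _; rewrite /W mulr_sumr; apply: ler_sum => t _.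
  rewrite /F /cf /=; case: ltnP => Jk; first by rewrite measure_iter// mul1r.
  by rewrite mulrAC ler_pdivlMr// -mulrA quasi_indep_le.
rewrite -mulr_suml ler_wpM2r//.
have cf0 k : 0 <= cf k.
  by rewrite /cf; case: ifP => // _; rewrite divr_ge0 ?mulr_ge0 ?fine_ge0.
apply: (@le_trans _ _ (\sum_(0 <= k < J + n.+1) cf k)).
  by rewrite [leRHS](@big_cat_nat _ _ _ n.+1)//= ?lerDl ?sumr_ge0//; lia.
rewrite (@big_cat_nat _ _ _ J)//=; last by lia.
apply: lerD.
  rewrite (eq_big_nat _ _ (F2 := fun=> 1)); last first.
    by move=> k /andP[_ kJ]; rewrite /cf kJ.
  by rewrite sumr_const_nat subn0.
rewrite (eq_big_nat _ _ (F2 := fun k => K / fine (mu Y) * fine (mu (E k)))).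
  rewrite -mulr_sumr; apply: le_trans (ler_wpM2l _ (sum_E _)) _.
    by rewrite divr_ge0// ltW.
  rewrite le_eqVlt; apply/orP; left; apply/eqP; field.
  by rewrite !gt_eqF.
by move=> k /andP[Jk _]; rewrite /cf ltnNge Jk/= mulrAC.
Qed.

End sojourn.
End visits.

(** * Interval maps with two full expanding branches *)

Definition branch_lo (R : realType) (c : R) (b : bool) : R := if b then c else 0.
Definition branch_hi (R : realType) (c : R) (b : bool) : R := if b then 1 else c.

(** The branch on the left of [c] has the index [false], the other one [true];
    [f b] is the inverse of [g b].  Orbits that start outside of [[0, 1]] stay
    outside, so that a measure on the whole line that is carried by [[0, 1]]
    can be invariant under [T] without any restriction of the preimages. *)
Record two_branches (R : realType) (c : R) (T : R -> R) (g f : bool -> R -> R)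
    (M1 M : R) : Prop := TwoBranches {
  tb_c : 0 < c < 1 ;
  tb_M1 : 1 <= M1 ;
  tb_M : 0 <= M ;
  tb_expand : forall b x y, branch_lo c b <= x -> x < y -> y <= branch_hi c b ->
    y - x < g b y - g b x ;
  tb_lip : forall b x y, branch_lo c b <= x -> x < y -> y <= branch_hi c b ->
    g b y - g b x <= M1 * (y - x) ;
  tb_dist : forall b s t x y x' y', branch_lo c b <= s -> t <= branch_hi c b ->
    s <= x -> x < y -> y <= t -> s <= x' -> x' < y' -> y' <= t ->
    (g b y - g b x) * (y' - x') <=
      (1 + M * (t - s)) * ((g b y' - g b x') * (y - x)) ;
  tb_inv : forall b y, 0 <= y <= 1 ->
    branch_lo c b <= f b y <= branch_hi c b /\ g b (f b y) = y ;
  tb_T0 : forall x, 0 <= x < c -> T x = g false x ;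
  tb_T1 : forall x, c < x <= 1 -> T x = g true x ;
  tb_lo : forall b, g b (branch_lo c b) = 0 ;
  tb_hi : forall b, g b (branch_hi c b) = 1 ;
  tb_Tc : 0 <= T c <= 1 ;
  tb_out : forall x, ~ (0 <= x <= 1) -> ~ (0 <= T x <= 1) }.

Section branches.
Context (R : realType) (c : R) (T : R -> R) (g f : bool -> R -> R) (M1 M : R).
Context (S : two_branches c T g f M1 M).

Let c0 : 0 < c. Proof. by have /andP[] := tb_c S. Qed.
Let c1 : c < 1. Proof. by have /andP[] := tb_c S. Qed.

Let lohi b : branch_lo c b < branch_hi c b.
Proof. by case: b => /=. Qed.

Let lo0 b : 0 <= branch_lo c b.
Proof. by case: b => //=; exact: ltW. Qed.

Let hi1 b : branch_hi c b <= 1.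
Proof. by case: b => //=; exact: ltW. Qed.

Definition side (b : bool) : set R :=
  if b then `]c, 1]%classic else `[0, c[%classic.

Lemma side_itv b x : side b x -> branch_lo c b <= x <= branch_hi c b.
Proof.
by case: b => /=; rewrite in_itv/= => /andP[? ?]; apply/andP; split => //; exact: ltW.
Qed.

Lemma side_oo b x : branch_lo c b < x -> x < branch_hi c b -> side b x.
Proof.
by case: b => /=; rewrite in_itv/= => ? ?; apply/andP; split => //; exact: ltW.
Qed.

Lemma side_T b x : side b x -> T x = g b x.
Proof. by case: b => /=; rewrite in_itv/=; [exact: (tb_T1 S)|exact: (tb_T0 S)]. Qed.

Lemma g_lt b x y : branch_lo c b <= x -> x < y -> y <= branch_hi c b ->
  g b x < g b y.
Proof. by move=> lx xy yh; have := tb_expand S lx xy yh; lra. Qed.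

Lemma g_ltE b x y : branch_lo c b <= x <= branch_hi c b ->
  branch_lo c b <= y <= branch_hi c b -> (g b x < g b y) = (x < y).
Proof.
move=> /andP[lx xh] /andP[ly yh].
have [xy|yx|->] := ltgtP x y; last by rewrite ltxx.
- exact: g_lt.
- by apply/negbTE; rewrite -leNgt ltW// g_lt.
Qed.

Lemma f_itv b y : 0 <= y <= 1 -> branch_lo c b <= f b y <= branch_hi c b.
Proof. by move=> /(tb_inv S b)[]. Qed.

Lemma fK b y : 0 <= y <= 1 -> g b (f b y) = y.
Proof. by move=> /(tb_inv S b)[]. Qed.

Lemma f_ltE b x y : 0 <= x <= 1 -> 0 <= y <= 1 -> (f b x < f b y) = (x < y).
Proof. by move=> x01 y01; rewrite -(@g_ltE b) ?f_itv// !fK. Qed.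

Lemma f_leE b x y : 0 <= x <= 1 -> 0 <= y <= 1 -> (f b x <= f b y) = (x <= y).
Proof. by move=> x01 y01; rewrite !leNgt f_ltE. Qed.

Lemma gK b x : branch_lo c b <= x <= branch_hi c b -> 0 <= g b x <= 1 ->
  f b (g b x) = x.
Proof.
move=> xb gx; apply/eqP; rewrite eq_le !leNgt.
rewrite -(@g_ltE b x (f b (g b x))) ?f_itv//.
by rewrite -(@g_ltE b (f b (g b x)) x) ?f_itv// fK// ltxx.
Qed.

Lemma g_itv b x : branch_lo c b <= x <= branch_hi c b -> 0 <= g b x <= 1.
Proof.
move=> xb; have /andP[lx xh] := xb; apply/andP; split.
- by rewrite -[X in X <= _](tb_lo S b) leNgt g_ltE// -?leNgt// lexx ltW.
- by rewrite -[X in _ <= X](tb_hi S b) leNgt g_ltE// -?leNgt// lexx ltW.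
Qed.

Lemma T_itv x : 0 <= x <= 1 -> 0 <= T x <= 1.
Proof.
move=> /andP[x0 x1]; have [xc|cx|->] := ltgtP x c; last exact: (tb_Tc S).
- have sx : side false x by rewrite /= in_itv/= x0.
  by rewrite (side_T sx) g_itv//; exact: side_itv.
- have sx : side true x by rewrite /= in_itv/= cx.
  by rewrite (side_T sx) g_itv//; exact: side_itv.
Qed.

Lemma T_itvE x : (0 <= T x <= 1) = (0 <= x <= 1).
Proof. by apply/idP/idP; [apply: contraTT => /negP/(tb_out S)/negP|exact: T_itv]. Qed.

Lemma f_lo b y : 0 < y <= 1 -> branch_lo c b < f b y.
Proof.
move=> /andP[y0 y1]; have y01 : 0 <= y <= 1 by rewrite ltW.
have lob : branch_lo c b <= branch_lo c b <= branch_hi c b by rewrite lexx ltW.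
by rewrite -(@g_ltE b) ?f_itv// fK// (tb_lo S).
Qed.

Lemma f_hi b y : 0 <= y < 1 -> f b y < branch_hi c b.
Proof.
move=> /andP[y0 y1]; have y01 : 0 <= y <= 1 by rewrite y0 ltW.
have lob : branch_lo c b <= branch_hi c b <= branch_hi c b by rewrite lexx ltW.
by rewrite -(@g_ltE b) ?f_itv// fK// (tb_hi S).
Qed.

Lemma f_01 b y : 0 < y < 1 -> 0 < f b y < 1.
Proof.
move=> /andP[y0 y1]; apply/andP; split.
  by apply: le_lt_trans (lo0 b) _; rewrite f_lo// y0 ltW.
by apply: lt_le_trans (hi1 b); rewrite f_hi// y1 ltW.
Qed.

Lemma side_preimage b x z1 z2 : 0 < z1 < 1 -> 0 < z2 < 1 ->
  side b x /\ z1 < T x < z2 <-> f b z1 < x < f b z2.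
Proof.
move=> /andP[z10 z11] /andP[z20 z21].
have z1in : 0 <= z1 <= 1 by rewrite !ltW.
have z2in : 0 <= z2 <= 1 by rewrite !ltW.
have E : branch_lo c b <= x <= branch_hi c b ->
    (z1 < g b x < z2) = (f b z1 < x < f b z2).
  move=> xb; rewrite -(@g_ltE b (f b z1) x) ?f_itv//.
  by rewrite -(@g_ltE b x (f b z2)) ?f_itv// !fK.
split=> [[sx]|/andP[xl xr]].
  by rewrite (side_T sx) E// side_itv.
have sx : side b x.
  apply: side_oo.
  - by apply: le_lt_trans xl; have /andP[] := f_itv b z1in.
  - by apply: lt_le_trans xr _; have /andP[] := f_itv b z2in.
by split=> //; rewrite (side_T sx) E ?xl ?side_itv.
Qed.

Fixpoint cylinder (w : seq bool) : set R :=
  if w is b :: v then side b `&` T @^-1` cylinder v else setT.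

Definition word_map (w : seq bool) (y : R) : R := foldr f y w.

Lemma word_map_01 w y : 0 < y < 1 -> 0 < word_map w y < 1.
Proof. by move=> y01; elim: w => //= b w IH; exact: f_01. Qed.

Lemma word_map_lt w y z : 0 < y < 1 -> 0 < z < 1 -> y < z ->
  word_map w y < word_map w z.
Proof.
move=> y01 z01 yz; elim: w => //= b w IH.
have /andP[? ?] := word_map_01 w y01; have /andP[? ?] := word_map_01 w z01.
by rewrite f_ltE// !ltW.
Qed.

(** On an open interval of final positions the cylinder of [w] is the image
    under the composition of inverse branches that is coded by [w]. *)
Lemma cylinder_preimage w x y1 y2 : 0 < y1 < 1 -> 0 < y2 < 1 ->
  cylinder w x /\ y1 < iter (size w) T x < y2 <->
  word_map w y1 < x < word_map w y2.
Proof.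
move=> y101 y201; elim: w x => [|b w IH] x; first by split=> [[]|].
rewrite [size _]/= iterSr [word_map _ y1]/= [word_map _ y2]/=.
rewrite -side_preimage ?word_map_01// -IH /=.
by split=> [[[? ?] ?]|[? [? ?]]].
Qed.

Lemma cylinder_rcons w b :
  cylinder (rcons w b) = cylinder w `&` iter (size w) T @^-1` side b.
Proof.
elim: w => [|b' w IH] /=; first by apply/seteqP; split => x /= [].
rewrite IH; apply/seteqP; split => x /=; rewrite -iterS iterSr.
  by move=> [? []].
by move=> [[? ?] ?].
Qed.

Lemma cylinder_side w x j : cylinder w x -> (j < size w)%N ->
  side (nth false w j) (iter j T x).
Proof.
elim: w x j => [|b w IH] x [|j]//=; first by case.
by move=> [_ /IH H] jw; rewrite -iterS iterSr; exact: H.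
Qed.

Lemma side_inj b b' x : side b x -> side b' x -> b = b'.
Proof.
by case: b b' => -[]//=; rewrite !in_itv/= => /andP[? ?] /andP[? ?]; exfalso; lra.
Qed.

End branches.

(** * Distortion of compositions of inverse branches *)

Section distortion.
Context (R : realType) (c : R) (T : R -> R) (g f : bool -> R -> R) (M1 M : R).
Context (S : two_branches c T g f M1 M).
Context (mu : {measure set (measurableTypeR R) -> \bar R}) (eta : R).
Context (mT : measurable_fun setT (T : measurableTypeR R -> measurableTypeR R)).
Context (Tinv : forall A : set (measurableTypeR R), measurable A -> mu (T @^-1` A) = mu A).
Context (eta0 : 0 < eta).
Context (mu_ge : forall x y, 0 < x -> x < y -> y < 1 ->
  ((eta * (y - x))%:E <= mu `]x, y[%classic)%E).
Context (mu_fin : forall x y, 0 < x -> y < 1 -> (mu `[x, y]%classic < +oo)%E).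

Let itvm x y := fine (mu `]x, y[%classic).

Lemma mu_oo_fin x y : 0 < x -> y < 1 -> (mu `]x, y[%classic < +oo)%E.
Proof.
move=> x0 y1; apply: le_lt_trans (mu_fin x0 y1); apply: le_measure.
- by rewrite inE; exact: measurable_itv.
- by rewrite inE; exact: measurable_itv.
- by move=> z /=; rewrite !in_itv/= => /andP[? ?]; rewrite !ltW.
Qed.

Let M10 : 0 < M1. Proof. exact: lt_le_trans (tb_M1 S). Qed.

(** The preimage of [z1, z2] is the union of its images under both inverse
    branches, and invariance says that the measures add up to that of [z1, z2].
    The image under the other branch has measure at least [eta] times its
    length, which is at least [(z2 - z1) / M1], and [f b] is a contraction. *)
Lemma branch_measure_drop b z1 z2 : 0 < z1 -> z1 < z2 -> z2 < 1 ->
  itvm (f b z1) (f b z2) + eta / M1 * (f b z2 - f b z1) <= itvm z1 z2.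
Proof.
move=> z10 z12 z21.
have z1in : 0 < z1 < 1 by rewrite z10 (lt_trans z12).
have z2in : 0 < z2 < 1 by rewrite z21 (lt_trans z10).
have z1in' : 0 <= z1 <= 1 by have /andP[? ?] := z1in; rewrite !ltW.
have z2in' : 0 <= z2 <= 1 by have /andP[? ?] := z2in; rewrite !ltW.
have fin b' : (mu `]f b' z1, f b' z2[%classic < +oo)%E.
  have /andP[? _] := f_01 S b' z1in; have /andP[_ ?] := f_01 S b' z2in.
  exact: mu_oo_fin.
have lt b' : f b' z1 < f b' z2 by rewrite (f_ltE S).
have diff b' : f b' z2 - f b' z1 <= z2 - z1 <= M1 * (f b' z2 - f b' z1).
  have /andP[l1 h1] := f_itv S b' z1in'; have /andP[l2 h2] := f_itv S b' z2in'.
  have := tb_expand S l1 (lt b') h2; have := tb_lip S l1 (lt b') h2.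
  by rewrite !(fK S)// => ? ?; apply/andP; split => //; exact: ltW.
have sum_le : itvm (f b z1) (f b z2) + itvm (f (~~ b) z1) (f (~~ b) z2) <=
    itvm z1 z2.
  have sub b' : `]f b' z1, f b' z2[%classic `<=` side c b'.
    by move=> x /=; rewrite in_itv/= => /(side_preimage S)[].
  have finz : (mu `]z1, z2[%classic < +oo)%E by exact: mu_oo_fin.
  rewrite -lee_fin EFinD !fineK ?ge0_fin_numE//.
  rewrite -(Tinv (A := `]z1, z2[%classic)); last exact: measurable_itv.
  rewrite -measureU; [|exact: measurable_itv|exact: measurable_itv|]; last first.
    rewrite -subset0 => x [/sub sx /sub sx'].
    by have := side_inj sx sx'; case: (b).
  apply: le_measure; rewrite ?inE.
  - by apply: measurableU; exact: measurable_itv.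
  - by rewrite -[_ @^-1` _]setTI; apply: mT => //; exact: measurable_itv.
  - by move=> x [|] /=; rewrite !in_itv/= => /(side_preimage S)[].
apply: le_trans sum_le; rewrite lerD2l.
have /andP[d1 _] := diff b; have /andP[_ d2] := diff (~~ b).
have /andP[f0 _] := f_01 S (~~ b) z1in; have /andP[_ f1] := f_01 S (~~ b) z2in.
have := mu_ge f0 (lt _) f1.
rewrite -[X in (_ <= X)%E]fineK ?ge0_fin_numE// lee_fin; apply: le_trans.
rewrite -mulrA ler_wpM2l ?(ltW eta0)// mulrC ler_pdivrMr// mulrC.
exact: le_trans d1 d2.
Qed.

Context (a1 a2 : R) (a10 : 0 < a1) (a12 : a1 < a2) (a21 : a2 < 1).

Let in01 y : a1 <= y -> y <= a2 -> 0 < y < 1.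
Proof.
by move=> ? ?; apply/andP; split; [exact: lt_le_trans a10 _|exact: le_lt_trans a21].
Qed.

Lemma word_map_le w y z : a1 <= y -> y <= z -> z <= a2 ->
  word_map f w y <= word_map f w z.
Proof.
move=> ay; rewrite le_eqVlt => /orP[/eqP -> //|yz] za.
by apply/ltW/(word_map_lt S) => //; apply: in01 => //; lra.
Qed.

(** Each letter multiplies the distortion by at most [1 + M * L], hence by at
    most [expR (M * L)], where [L] is the length of the current image of
    [[a1, a2]].  By [branch_measure_drop], [L] is at most [M1 / eta] times the
    simultaneous decrease of the measure of that image, so the exponents
    telescope: however long the word is, their sum is at most
    [M * M1 / eta] times the measure of [[a1, a2]]. *)
Lemma word_distortion w y1 y2 z1 z2 :
  a1 <= y1 -> y1 < y2 -> y2 <= a2 -> a1 <= z1 -> z1 < z2 -> z2 <= a2 ->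
  (word_map f w y2 - word_map f w y1) * (z2 - z1) <=
  expR (M * M1 / eta *
    (itvm a1 a2 - itvm (word_map f w a1) (word_map f w a2))) *
  ((word_map f w z2 - word_map f w z1) * (y2 - y1)).
Proof.
move=> ay1 y12 ya2 az1 z12 za2.
have y1i : 0 < y1 < 1 by apply: in01 => //; lra.
have y2i : 0 < y2 < 1 by apply: in01 => //; lra.
have z1i : 0 < z1 < 1 by apply: in01 => //; lra.
have z2i : 0 < z2 < 1 by apply: in01 => //; lra.
have a1i : 0 < a1 < 1 by apply: in01 => //; lra.
have a2i : 0 < a2 < 1 by apply: in01 => //; lra.
elim: w => [|b w IH].
  by rewrite /= subrr mulr0 expR0 mul1r mulrC.
set L := fun u v => word_map f w v - word_map f w u in IH *.
have Wi y : 0 < y < 1 -> 0 <= word_map f w y <= 1.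
  by move=> /(word_map_01 S w)/andP[? ?]; rewrite !ltW.
have Lz : 0 < word_map f w z2 - word_map f w z1.
  by rewrite subr_gt0 (word_map_lt S).
have drop := branch_measure_drop b
  (proj1 (andP (word_map_01 S w a1i))) (word_map_lt S w a1i a2i a12)
  (proj2 (andP (word_map_01 S w a2i))).
have /andP[la1 _] := f_itv S b (Wi _ a1i).
have /andP[_ ha2] := f_itv S b (Wi _ a2i).
have wle y z : a1 <= y -> y <= z -> z <= a2 ->
    f b (word_map f w y) <= f b (word_map f w z).
  exact: (@word_map_le (b :: w)).
have wlt y z : 0 < y < 1 -> 0 < z < 1 -> y < z ->
    f b (word_map f w y) < f b (word_map f w z).
  exact: (@word_map_lt _ _ _ _ _ _ _ S (b :: w)).
have := tb_dist S la1 ha2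
  (wle a1 z1 (lexx _) az1 (ltW (lt_le_trans z12 za2))) (wlt _ _ z1i z2i z12)
  (wle z2 a2 (le_trans az1 (ltW z12)) za2 (lexx _))
  (wle a1 y1 (lexx _) ay1 (ltW (lt_le_trans y12 ya2))) (wlt _ _ y1i y2i y12)
  (wle y2 a2 (le_trans ay1 (ltW y12)) ya2 (lexx _)).
rewrite !(fK S) ?Wi//=.
set l := f b (word_map f w a2) - f b (word_map f w a1) in drop *.
set mw := itvm (word_map f w a1) (word_map f w a2) in IH drop *.
set mb := itvm (f b (word_map f w a1)) _ in drop *.
set dy := f b (word_map f w y2) - _; set dz := f b (word_map f w z2) - _.
rewrite -/(L y1 y2) -/(L z1 z2) in Lz IH * => Hd.
have dz0 : 0 < dz by rewrite subr_gt0 wlt.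
have l0 : 0 <= l by rewrite subr_ge0 wle// ltW.
have M0 := tb_M S.
rewrite -(ler_pM2l Lz).
have y120 : 0 < y2 - y1 by rewrite subr_gt0.
have z120 : 0 < z2 - z1 by rewrite subr_gt0.
apply: (@le_trans _ _ ((1 + M * l) * dz * (L y1 y2 * (z2 - z1)))).
  have := ler_wpM2r (ltW z120) Hd; set A := leLHS; set B := leRHS => AB.
  have -> : L z1 z2 * (dy * (z2 - z1)) = A by rewrite /A; ring.
  by apply: (le_trans AB); rewrite le_eqVlt; apply/orP; left; apply/eqP; rewrite /B; ring.
have k0 : 0 <= (1 + M * l) * dz.
  by apply: mulr_ge0; [rewrite addr_ge0// mulr_ge0|exact: ltW].
apply: (le_trans (ler_wpM2l k0 IH)).
set e1 := expR _; set e2 := expR _.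
have e12 : (1 + M * l) * e1 <= e2.
  apply: (@le_trans _ _ (expR (M * l) * e1)).
    by rewrite ler_wpM2r ?expR_ge0// expR_ge1Dx.
  rewrite /e1 /e2 -expRD ler_expR.
  have -> : M * l = M * M1 / eta * (eta / M1 * l).
    by field; rewrite !gt_eqF.
  rewrite -mulrDr ler_wpM2l//; last by lra.
  by rewrite divr_ge0 ?mulr_ge0// ltW.
rewrite (_ : (1 + M * l) * dz * _ = (1 + M * l) * e1 * (dz * L z1 z2 * (y2 - y1))); last by ring.
rewrite (_ : L z1 z2 * _ = e2 * (dz * L z1 z2 * (y2 - y1))); last by ring.
by rewrite ler_wpM2r// !mulr_ge0// ltW.
Qed.

End distortion.

(** * Quasi-independence of past and future *)

Fixpoint words (k : nat) : seq (seq bool) :=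
  if k is k'.+1 then [seq rcons w b | w <- words k', b <- [:: false; true]]
  else [:: [::]].

Lemma size_words k w : w \in words k -> size w = k.
Proof.
elim: k w => [|k IH] w; first by rewrite inE => /eqP ->.
by move=> /allpairsP[[v b] /= [/IH <- _ ->]]; rewrite size_rcons.
Qed.

Section quasi_independence.
Context (R : realType) (c : R) (T : R -> R) (g f : bool -> R -> R) (M1 M : R).
Context (S : two_branches c T g f M1 M).
Context (mu : {measure set (measurableTypeR R) -> \bar R}) (eta : R).
Context (mT : measurable_fun setT (T : measurableTypeR R -> measurableTypeR R)).
Context (Tinv : forall A : set (measurableTypeR R), measurable A ->
  mu (T @^-1` A) = mu A).
Context (eta0 : 0 < eta).
Context (mu_ge : forall x y, 0 < x -> x < y -> y < 1 ->
  ((eta * (y - x))%:E <= mu `]x, y[%classic)%E).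
Context (mu_fin : forall x y, 0 < x -> y < 1 -> (mu `[x, y]%classic < +oo)%E).
Context (mu_pt : forall x, mu [set x] = 0%E).

Let mpre k (A : set (measurableTypeR R)) : measurable A ->
  measurable (iter k T @^-1` A : set (measurableTypeR R)).
Proof. exact: (measurable_iter mT). Qed.

Lemma mu_preimage_pt k x : mu (iter k T @^-1` [set x]) = 0%E.
Proof. by rewrite (measure_iter mT Tinv)//; exact: measurable_set1. Qed.

Lemma measurable_side b : measurable (side c b : set (measurableTypeR R)).
Proof. by case: b => /=; exact: measurable_itv. Qed.

Lemma measurable_cylinder w : measurable (cylinder c T w : set (measurableTypeR R)).
Proof.
elim: w => [|b w IH] /=; first exact: measurableT.
by apply: measurableI; [exact: measurable_side|exact: (mpre 1 IH)].
Qed.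

Lemma iter_itv k x : 0 <= x <= 1 -> 0 <= iter k T x <= 1.
Proof. by move=> x01; elim: k => //= k IH; exact: (T_itv S). Qed.

(** The cylinders of length [k] cover everything except the preimages of the
    discontinuity, which are negligible. *)
Lemma measure_words k (A : set (measurableTypeR R)) :
  measurable A -> A `<=` `[0, 1]%classic ->
  (mu A = \sum_(w <- words k) mu (A `&` cylinder c T w))%E.
Proof.
move=> mA A01; elim: k => [|k IH]; first by rewrite /= big_seq1 setIT.
rewrite IH.
rewrite -[words k.+1]/([seq rcons w b | w <- words k, b <- [:: false; true]]).
rewrite big_allpairs_dep big_seq [RHS]big_seq; apply: eq_bigr => w wk.
transitivity (mu (A `&` cylinder c T (rcons w false)) +
  mu (A `&` cylinder c T (rcons w true)))%E; last by rewrite big_cons big_seq1.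
rewrite -measureU; last 3 first.
- by apply: measurableI => //; exact: measurable_cylinder.
- by apply: measurableI => //; exact: measurable_cylinder.
- rewrite -subset0 => x; rewrite !cylinder_rcons => -[[_ [_ s0]] [_ [_ s1]]].
  by have := side_inj s0 s1.
rewrite -setIUr !cylinder_rcons -setIUr (size_words wk).
set B := (X in _ = mu X).
have mB : measurable B.
  apply: measurableI => //; apply: measurableI; first exact: measurable_cylinder.
  by apply: measurableU; apply: mpre; exact: measurable_side.
have mN : measurable (A `&` cylinder c T w `&` iter k T @^-1` [set c]).
  apply: measurableI; last by apply: mpre; exact: measurable_set1.
  by apply: measurableI => //; exact: measurable_cylinder.
rewrite -(measureU0 mB mN); last first.
  have mc := mpre k (measurable_set1 c).
  exact: (subset_measure0 mN mc (@subIsetr _ _ _) (mu_preimage_pt k c)).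
congr (mu _); apply/seteqP; split => x; last first.
  by move=> [[? [? _]]|[]].
move=> [Ax wx]; have x01 : 0 <= x <= 1 by have := A01 _ Ax; rewrite /= in_itv.
have /andP[y0 y1] := iter_itv k x01.
have [yc|cy|yc] := ltgtP (iter k T x) c; last by right; split.
- by left; split => //; split => //; left; rewrite /= in_itv/= y0.
- by left; split => //; split => //; right; rewrite /= in_itv/= cy.
Qed.

(** Intervals are only specified up to their endpoints, so as to cover at once
    the open, closed and half-open ones; the endpoints are negligible. *)
Definition between (y1 y2 : R) (I : set (measurableTypeR R)) :=
  [/\ measurable I, `]y1, y2[%classic `<=` I & I `<=` `[y1, y2]%classic].

Lemma measure_between k (A I : set (measurableTypeR R)) y1 y2 :
  measurable A -> between y1 y2 I ->
  mu (A `&` iter k T @^-1` I) = mu (A `&` iter k T @^-1` `]y1, y2[%classic).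
Proof.
move=> mA [mI subI Isub].
have mo : measurable (`]y1, y2[%classic : set (measurableTypeR R)).
  exact: measurable_itv.
have m1 x : measurable (iter k T @^-1` [set x] : set (measurableTypeR R)).
  by apply: mpre; exact: measurable_set1.
set N := A `&` iter k T @^-1` I `&`
  (iter k T @^-1` [set y1] `|` iter k T @^-1` [set y2]).
have mAI : measurable (A `&` iter k T @^-1` I : set (measurableTypeR R)).
  by apply: measurableI => //; exact: mpre.
have mN : measurable N by apply: measurableI => //; apply: measurableU.
have mAo : measurable (A `&` iter k T @^-1` `]y1, y2[%classic : set (measurableTypeR R)).
  by apply: measurableI => //; exact: mpre.
rewrite -[RHS](measureU0 mAo mN).
  congr (mu _); apply/seteqP; split => x.
    move=> [Ax Ix]; have := Isub _ Ix; rewrite /= in_itv/= => /andP[].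
    rewrite le_eqVlt => /orP[/eqP e _|l1].
      by right; split => //; left.
    rewrite le_eqVlt => /orP[/eqP e|l2]; first by right; split => //; right.
    by left; split => //; rewrite /= in_itv/= l1.
  by move=> [[Ax Ix]|[]//]; split => //; exact: subI.
have m12 := measurableU _ _ (m1 y1) (m1 y2).
apply: (subset_measure0 mN m12 (@subIsetr _ _ _)).
by apply: null_set_setU => //; exact: mu_preimage_pt.
Qed.

Context (a1 a2 : R) (a10 : 0 < a1) (a12 : a1 < a2) (a21 : a2 < 1).
Context (u0 v0 H : R) (u00 : 0 < u0) (v01 : v0 < 1).
Context (au : u0 <= a1) (av : a2 <= v0) (H0 : 0 < H).
Context (mu_le : forall x y, u0 <= x -> x < y -> y <= v0 ->
  (mu `]x, y[%classic <= (H * (y - x))%:E)%E).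

Let Lam := expR (M * M1 / eta * fine (mu `]a1, a2[%classic)).

(** The event [E] belongs to the past before time [k]: for points that are in
    [[a1, a2]] at time [k] it is determined by the first [k] symbols. *)
Section past_event.
Context (k : nat) (E : set (measurableTypeR R)) (mE : measurable E).
Context (Euv : E `<=` `[u0, v0]%classic).
Context (Edet : forall w x x', size w = k -> cylinder c T w x ->
  cylinder c T w x' -> a1 <= iter k T x <= a2 -> a1 <= iter k T x' <= a2 ->
  E x -> E x').

Let EI y1 y2 w :=
  E `&` iter k T @^-1` `]y1, y2[%classic `&` cylinder c T w.

Let E01 : E `<=` `[0, 1]%classic.
Proof.
move=> x /Euv /=; rewrite !in_itv/= => /andP[? ?].
by apply/andP; split; [apply: le_trans (ltW u00) _|apply: le_trans (ltW v01)].
Qed.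

Let mEo y1 y2 : measurable (E `&` iter k T @^-1` `]y1, y2[%classic
  : set (measurableTypeR R)).
Proof. by apply: measurableI => //; apply: mpre; exact: measurable_itv. Qed.

Let mEI y1 y2 w : measurable (EI y1 y2 w).
Proof. by apply: measurableI => //; exact: measurable_cylinder. Qed.

Let mE_fin (B : set (measurableTypeR R)) : measurable B -> B `<=` E ->
  (mu B < +oo)%E.
Proof.
move=> mB BE; apply: le_lt_trans (mu_fin u00 v01); apply: le_measure.
- by rewrite inE.
- by rewrite inE; exact: measurable_itv.
- exact: subset_trans Euv.
Qed.

Let mEI_fin y1 y2 w : (mu (EI y1 y2 w) < +oo)%E.
Proof. by apply: mE_fin => // x [[]]. Qed.

(** If the word [w] is compatible with [E], then the event is an interval, the
    image under [word_map f w] of the prescribed positions at time [k].  The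
    lengths of two such intervals are compared by [word_distortion]; the
    density is bounded on [[u0, v0]], where [E] is contained, and bounded below
    everywhere. *)
Let word_bound w y1 y2 z1 z2 : size w = k ->
  a1 <= y1 -> y1 < y2 -> y2 <= a2 -> a1 <= z1 -> z1 < z2 -> z2 <= a2 ->
  eta * (fine (mu (EI y1 y2 w)) * (z2 - z1)) <=
  H * Lam * (fine (mu (EI z1 z2 w)) * (y2 - y1)).
Proof.
move=> wk ay1 y12 ya2 az1 z12 za2.
have [A1 A2 A3 U1 V1] := And5 a10 a12 a21 au av.
have yz0 (x y : R) : x < y -> 0 <= y - x by move=> ?; rewrite subr_ge0 ltW.
have Lam0 : 0 < Lam by exact: expR_gt0.
have [[x0 [[Ex0 w0] Yx0]]|none] := pselect
    (exists x, (E x /\ cylinder c T w x) /\ a1 <= iter k T x <= a2); last first.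
  rewrite (_ : EI y1 y2 w = set0) ?measure0/= ?mul0r ?mulr0.
    by rewrite !mulr_ge0 ?fine_ge0 ?yz0// ltW.
  rewrite -subset0 => x [[Ex /= +] wx]; rewrite in_itv/= => /andP[? ?].
  by apply: none; exists x; split => //; apply/andP; split; lra.
have EIE (p q : R) : a1 <= p -> p < q -> q <= a2 ->
    EI p q w = `]word_map f w p, word_map f w q[%classic.
  move=> ap pq qa; have p01 : 0 < p < 1. by apply/andP; split; lra.
  have q01 : 0 < q < 1 by apply/andP; split; lra.
  apply/seteqP; split => x.
    move=> [[_ /= xpq] wx]; rewrite in_itv/=; apply/(cylinder_preimage S) => //.
    by rewrite wk; move: xpq; rewrite in_itv.
  rewrite /= in_itv/= => /(cylinder_preimage S)[]//; rewrite wk => wx xpq.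
  split => //; split; last by rewrite /= in_itv.
  apply: (Edet wk w0 wx) => //; move: xpq => /andP[? ?]; apply/andP; split; lra.
have wlt (p q : R) : a1 <= p -> p < q -> q <= a2 -> word_map f w p < word_map f w q.
  by move=> *; apply: (word_map_lt S) => //; apply/andP; split; lra.
have w01 (p : R) : a1 <= p -> p <= a2 -> 0 < word_map f w p < 1.
  by move=> *; apply: (word_map_01 S); apply/andP; split; lra.
have up : fine (mu (EI y1 y2 w)) <= H * (word_map f w y2 - word_map f w y1).
  rewrite -lee_fin fineK ?ge0_fin_numE// EIE//.
  have sub (x : R) : word_map f w y1 < x < word_map f w y2 -> u0 <= x <= v0.
    move=> xw; suff /Euv : E x by rewrite /= in_itv.
    have : EI y1 y2 w x by rewrite EIE//= in_itv.
    by case=> -[].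
  have wy := wlt _ _ ay1 y12 ya2.
  apply: mu_le => //; rewrite leNgt; apply/negP => lt.
  - set m := Num.min u0 (word_map f w y2).
    have m1 : word_map f w y1 < m by rewrite lt_min lt.
    have := sub ((word_map f w y1 + m) / 2); rewrite (midf_lt m1).1.
    have mu0 : m <= u0 by rewrite ge_min lexx.
    have mw : m <= word_map f w y2 by rewrite ge_min lexx orbT.
    have q := (midf_lt m1).2 => /(_ (lt_le_trans q mw)) /andP[+ _].
    by rewrite leNgt (lt_le_trans q mu0).
  - set m := Num.max v0 (word_map f w y1).
    have m1 : m < word_map f w y2 by rewrite gt_max lt.
    have := sub ((m + word_map f w y2) / 2); rewrite (midf_lt m1).2 andbT.
    have mu0 : v0 <= m by rewrite le_max lexx.
    have mw : word_map f w y1 <= m by rewrite le_max lexx orbT.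
    have q := (midf_lt m1).1 => /(_ (le_lt_trans mw q)) /andP[_ +].
    by rewrite leNgt (le_lt_trans mu0 q).
have down : eta * (word_map f w z2 - word_map f w z1) <= fine (mu (EI z1 z2 w)).
  rewrite -lee_fin fineK ?ge0_fin_numE// EIE//.
  have /andP[? _] := w01 z1 az1 (ltW (lt_le_trans z12 za2)).
  have /andP[_ ?] := w01 z2 (le_trans az1 (ltW z12)) za2.
  by apply: mu_ge => //; exact: wlt.
have dist := word_distortion S mT Tinv eta0 mu_ge mu_fin a10 a12 a21 w
  ay1 y12 ya2 az1 z12 za2.
have Lam_le : expR (M * M1 / eta * (fine (mu `]a1, a2[%classic) -
    fine (mu `]word_map f w a1, word_map f w a2[%classic))) <= Lam.
  rewrite ler_expR ler_wpM2l//.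
    by rewrite divr_ge0 ?mulr_ge0 ?(tb_M S) ?(ltW eta0)// (le_trans _ (tb_M1 S)).
  by rewrite gerBl fine_ge0.
have ly0 : 0 <= word_map f w y2 - word_map f w y1 by rewrite subr_ge0 ltW// wlt.
have lz0 : 0 <= word_map f w z2 - word_map f w z1 by rewrite subr_ge0 ltW// wlt.
apply: (@le_trans _ _ (eta * (H * ((word_map f w y2 - word_map f w y1) * (z2 - z1))))).
  by rewrite ler_wpM2l ?(ltW eta0)// mulrA ler_wpM2r// yz0.
apply: (@le_trans _ _ (eta * (H * (Lam *
    ((word_map f w z2 - word_map f w z1) * (y2 - y1)))))).
  rewrite ler_wpM2l ?(ltW eta0)// ler_wpM2l ?(ltW H0)//.
  by apply: (le_trans dist); rewrite ler_wpM2r// mulr_ge0// yz0.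
rewrite (_ : eta * _ = H * Lam * ((eta * (word_map f w z2 - word_map f w z1)) *
  (y2 - y1))); last by ring.
by rewrite ler_wpM2l ?mulr_ge0 ?(ltW H0) ?(ltW Lam0)// ler_wpM2r// yz0.
Qed.

Let open_bound y1 y2 z1 z2 :
  a1 <= y1 -> y1 < y2 -> y2 <= a2 -> a1 <= z1 -> z1 < z2 -> z2 <= a2 ->
  eta * (fine (mu (E `&` iter k T @^-1` `]y1, y2[%classic)) * (z2 - z1)) <=
  H * Lam * (fine (mu (E `&` iter k T @^-1` `]z1, z2[%classic)) * (y2 - y1)).
Proof.
move=> ay1 y12 ya2 az1 z12 za2.
have sumE p q : fine (mu (E `&` iter k T @^-1` `]p, q[%classic)) =
    \sum_(w <- words k) fine (mu (EI p q w)).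
  rewrite (measure_words k (mEo p q)); last by move=> x [/E01].
  rewrite -sum_fine; first by apply: eq_bigr.
  by move=> w _; rewrite ge0_fin_numE ?mEI_fin.
rewrite !sumE !mulr_suml !mulr_sumr big_seq [leRHS]big_seq.
by apply: ler_sum => w /size_words wk; exact: word_bound.
Qed.

(** Sum the estimate over all words; lengths are then replaced by measures. *)
Lemma quasi_independence (I J : set (measurableTypeR R)) y1 y2 z1 z2 :
  a1 <= y1 -> y1 < y2 -> y2 <= a2 -> a1 <= z1 -> z1 < z2 -> z2 <= a2 ->
  between y1 y2 I -> between z1 z2 J ->
  fine (mu (E `&` iter k T @^-1` I)) * fine (mu J) <=
  (H / eta) ^+ 2 * Lam * (fine (mu (E `&` iter k T @^-1` J)) * fine (mu I)).
Proof.
move=> ay1 y12 ya2 az1 z12 za2 bI bJ.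
have [A1 A2 A3 U1 V1] := And5 a10 a12 a21 au av.
rewrite (measure_between k mE bI) (measure_between k mE bJ).
have mub (p q : R) B : between p q B -> mu B = mu `]p, q[%classic.
  move=> bB; have := measure_between 0 measurableT bB.
  by rewrite !setTI.
rewrite (mub _ _ _ bI) (mub _ _ _ bJ).
have ofin (p q : R) : a1 <= p -> q <= a2 -> (mu `]p, q[%classic < +oo)%E.
  by move=> ? ?; apply: (mu_oo_fin mu_fin); lra.
have up : fine (mu `]z1, z2[%classic) <= H * (z2 - z1).
  by rewrite -lee_fin fineK ?ge0_fin_numE ?ofin//; apply: mu_le => //; lra.
have down : eta * (y2 - y1) <= fine (mu `]y1, y2[%classic).
  by rewrite -lee_fin fineK ?ge0_fin_numE ?ofin//; apply: mu_ge => //; lra.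
have := open_bound ay1 y12 ya2 az1 z12 za2.
set P := fine (mu (E `&` iter k T @^-1` `]y1, y2[%classic)).
set Q := fine (mu (E `&` iter k T @^-1` `]z1, z2[%classic)) => PQ.
have P0 : 0 <= P by exact: fine_ge0.
have Q0 : 0 <= Q by exact: fine_ge0.
have Lam0 : 0 < Lam by exact: expR_gt0.
rewrite -(ler_pM2l eta0) -(ler_pM2l eta0).
apply: (@le_trans _ _ (eta * (H * (eta * (P * (z2 - z1)))))).
  rewrite !ler_wpM2l ?(ltW eta0)//.
  rewrite (_ : H * _ = eta * (P * (H * (z2 - z1)))); last by ring.
  by rewrite !ler_wpM2l ?(ltW eta0).
apply: (@le_trans _ _ (eta * (H * (H * Lam * (Q * (y2 - y1)))))).
  by rewrite ler_wpM2l ?(ltW eta0)// ler_wpM2l ?(ltW H0).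
rewrite (_ : eta * _ = H ^+ 2 * Lam * (Q * (eta * (y2 - y1)))); last by ring.
rewrite [leRHS](_ : _ = H ^+ 2 * Lam * (Q * fine (mu `]y1, y2[%classic))).
  by rewrite ler_wpM2l ?mulr_ge0 ?exprn_ge0 ?(ltW H0) ?(ltW Lam0)// ler_wpM2l.
by field; rewrite gt_eqF.
Qed.

End past_event.
End quasi_independence.

(** * Neighbourhoods of the neutral fixed points *)

Definition outer (R : realType) (b : bool) (a : R) : set R :=
  if b then `]a, 1]%classic else `[0, a[%classic.

Section outer_sets.
Context (R : realType) (c : R) (T : R -> R) (g f : bool -> R -> R) (M1 M : R).
Context (S : two_branches c T g f M1 M).

Lemma outer_side b x : outer b c x <-> side c b x.
Proof. by case: b. Qed.

Lemma outer_T b b' (x z : R) : 0 < z < 1 -> side c b' x ->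
  outer b z (T x) <-> outer b (f b' z) x.
Proof.
move=> z01 sx; have /andP[z0 z1] := z01.
have zi : 0 <= z <= 1 by rewrite !ltW.
have xi := side_itv sx.
have Tx : 0 <= T x <= 1 by rewrite (side_T S sx) (g_itv S).
have x01 : 0 <= x <= 1 by rewrite -(T_itvE S).
have /andP[Tx0 Tx1] := Tx; have /andP[x0 x1] := x01.
case: b; rewrite /outer /= !in_itv/= ?Tx0 ?Tx1 ?x0 ?x1 ?andbT/=.
- by rewrite (side_T S sx) -(g_ltE S (f_itv S b' zi) xi) (fK S).
- by rewrite (side_T S sx) -(g_ltE S xi (f_itv S b' zi)) (fK S).
Qed.

Lemma f_outward b (z : R) : 0 < z < 1 -> if b then z < f b z else f b z < z.
Proof.
move=> z01; have /andP[z0 z1] := z01; have zi : 0 <= z <= 1 by rewrite !ltW.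
have /andP[fl fh] := f_itv S b zi.
case: b fl fh => /= fl fh.
- have fz1 : f true z < 1 by apply: (f_hi S true); rewrite z1 ltW.
  have := tb_expand S (b := true) fl fz1 (lexx _); rewrite (fK S)// (tb_hi S true); lra.
- have fz0 : 0 < f false z by apply: (f_lo S false); rewrite z0 ltW.
  have := tb_expand S (b := false) (lexx _) fz0 fh.
  by rewrite (fK S)// (tb_lo S false) /=; lra.
Qed.

Lemma iter_f_01 b n (a : R) : 0 < a < 1 -> 0 < iter n (f b) a < 1.
Proof. by move=> a01; elim: n => //= n; exact: (f_01 S). Qed.

Lemma iter_f_mono b n m (a : R) : 0 < a < 1 ->
  if b then iter n (f b) a <= iter (n + m) (f b) a
  else iter (n + m) (f b) a <= iter n (f b) a.
Proof.
move=> a01; elim: m => [|m IH]; first by rewrite addn0; case: b.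
have := f_outward b (iter_f_01 b (n + m) a01); rewrite addnS iterS.
case: b IH => IH /ltW H; first exact: le_trans H.
exact: le_trans IH.
Qed.

Lemma outer_iterS b n (a : R) : 0 < a < 1 ->
  outer b (iter n.+1 (f b) a) `<=` outer b (iter n (f b) a).
Proof.
move=> a01 x; have := f_outward b (iter_f_01 b n a01).
rewrite iterS /outer; case: b => fz /=; rewrite !in_itv/= => /andP[? ?];
  apply/andP; split => //; first exact: lt_trans fz _.
exact: lt_trans fz.
Qed.

Lemma outer_iter_sub b n m (a : R) : 0 < a < 1 ->
  outer b (iter (n + m) (f b) a) `<=` outer b (iter n (f b) a).
Proof.
move=> a01; elim: m => [|m IH]; first by rewrite addn0.
by rewrite addnS; apply: subset_trans IH; exact: outer_iterS.
Qed.

(** Next to a fixed point the orbit moves monotonically, so the condition for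
    the last time implies those for the other times. *)
Lemma stay_outer b n (a x : R) : 0 < a < 1 -> outer b a `<=` side c b ->
  (forall j, (j <= n)%N -> outer b a (iter j T x)) <->
  outer b (iter n (f b) a) x.
Proof.
move=> a01 aside; elim: n x => [|n IH] x.
  split=> [H|H j]; first exact: (H 0%N).
  by rewrite leqn0 => /eqP ->.
have sub := @outer_iter_sub b 0 n.+1 a a01; rewrite add0n /= in sub.
split=> [H|H].
- have sx : side c b x by apply: aside; exact: (H 0%N).
  rewrite iterS -(outer_T b (iter_f_01 b n a01) sx); apply/IH => j jn.
  by rewrite -iterSr; apply: H.
- have ax : outer b a x by exact: sub.
  case=> [//|j] jn; rewrite iterSr.
  have /IH : outer b (iter n (f b) a) (T x).
    by apply/(outer_T _ (iter_f_01 b n a01) (aside _ ax)).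
  exact.
Qed.

(** The inverse branch moves points towards its fixed point.  As long as the
    iterates keep a distance [e] from it, expansion makes each step at least as
    large as the one taken at distance [e]; this cannot go on for ever. *)
Lemma iter_f_lim b (a e : R) : 0 < a < 1 -> 0 < e -> exists n,
  if b then 1 - e < iter n (f b) a else iter n (f b) a < e.
Proof.
move=> a01 e0; apply/not_existsP => H.
have e01 n : 0 <= iter n (f b) a <= 1.
  by have /andP[? ?] := iter_f_01 b n a01; rewrite !ltW.
have eb n : branch_lo c b <= iter n.+1 (f b) a <= branch_hi c b.
  by rewrite iterS (f_itv S).
have gb n : g b (iter n.+1 (f b) a) = iter n (f b) a by rewrite iterS (fK S).
have arch (d : R) : 0 < d -> exists n : nat, 1 < n%:R * d.
  move=> d0; exists (Num.trunc d^-1).+1; rewrite -ltr_pdivrMr// mul1r.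
  exact: truncnS_gt.
case: b H e01 eb gb => H e01 eb gb.
- have {}H n : iter n (f true) a <= 1 - e by rewrite leNgt; apply/negP/H.
  have /andP[c1e _] := eb 0%N; have he := H 1%N; rewrite /= in c1e.
  have ce : c <= 1 - e by exact: le_trans c1e he.
  pose d := 1 - e - g true (1 - e).
  have d0 : 0 < d.
    have := tb_expand S (b := true) (x := 1 - e) (y := 1) ce.
    by rewrite gtrBl => /(_ e0 (lexx _)); rewrite (tb_hi S true) /d; lra.
  have step n : iter n (f true) a + d <= iter n.+1 (f true) a.
    have /andP[l _] := eb n; have := H n.+1; rewrite le_eqVlt => /orP[/eqP E|lt].
      by rewrite -[X in X + _]gb E /d; lra.
    have h1 : 1 - e <= branch_hi c true by rewrite /= gerBl ltW.
    have := tb_expand S (b := true) l lt h1; rewrite gb /d; lra.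
  have bnd n : n%:R * d <= iter n (f true) a.
    elim: n => [|n IH]; first by rewrite mul0r; have /andP[] := e01 0%N.
    by apply: le_trans (step n); rewrite -natr1 mulrDl mul1r lerD2r.
  have [n nd] := arch _ d0; have := bnd n; have /andP[_] := e01 n; lra.
- have {}H n : e <= iter n (f false) a by rewrite leNgt; apply/negP/H.
  have /andP[_ c1e] := eb 0%N; have he := H 1%N; rewrite /= in c1e.
  have ec : e <= c by exact: le_trans he c1e.
  pose d := g false e - e.
  have d0 : 0 < d.
    have := tb_expand S (b := false) (x := 0) (y := e) (lexx _) e0 ec.
    by rewrite (tb_lo S false) /d; lra.
  have step n : iter n.+1 (f false) a <= iter n (f false) a - d.
    have /andP[_ h] := eb n; have := H n.+1; rewrite le_eqVlt => /orP[/eqP E|lt].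
      by rewrite -[X in _ <= X - _]gb -E /d; lra.
    have h1 : branch_lo c false <= e by rewrite /= ltW.
    have := tb_expand S (b := false) h1 lt h; rewrite gb /d; lra.
  have bnd n : iter n (f false) a <= 1 - n%:R * d.
    elim: n => [|n IH]; first by rewrite mul0r subr0; have /andP[] := e01 0%N.
    by apply: le_trans (step n) _; rewrite -natr1 mulrDl mul1r; lra.
  have [n nd] := arch _ d0; have := bnd n; have /andP[] := e01 n; lra.
Qed.

End outer_sets.

(** * Excursions from an interval that separates the fixed points *)

Section separated.
Context (R : realType) (c : R) (T : R -> R) (g f : bool -> R -> R) (M1 M : R).
Context (S : two_branches c T g f M1 M).
Context (gam y0 y1 : R) (gam0 : 0 < gam) (gamc : gam < c).
Context (cTg : c < T gam) (Tg1 : T gam < 1) (per : T (T gam) = gam).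
Context (y00 : 0 < y0) (y0g : y0 <= gam) (gy1 : T gam <= y1) (y11 : y1 < 1).

Definition cut b := if b then y1 else y0.
Definition far b : set R := outer b (cut b).
Definition near : set R := `[y0, y1]%classic.

Let y0c : y0 < c. Proof. exact: le_lt_trans gamc. Qed.
Let cy1 : c < y1. Proof. exact: lt_le_trans gy1. Qed.
Let y01 : y0 < y1. Proof. exact: lt_trans cy1. Qed.

Lemma cut_01 b : 0 < cut b < 1.
Proof.
case: b => /=; apply/andP; split => //.
- by apply: lt_trans cy1; have /andP[] := tb_c S.
- by apply: lt_trans y0c _; have /andP[] := tb_c S.
Qed.

Lemma far_side b : far b `<=` side c b.
Proof.
case: b => x /=; rewrite !in_itv/= => /andP[? ?]; apply/andP; split => //.
- exact: lt_trans cy1 _.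
- exact: lt_trans y0c.
Qed.

Lemma far_near_disj b x : far b x -> near x -> False.
Proof.
case: b => /=; rewrite !in_itv/= => /andP[? ?] /andP[? ?].
  by have : y1 < y1 by [exact: lt_le_trans (_ : y1 < x) _]; rewrite ltxx.
by have : y0 < y0 by [exact: le_lt_trans (_ : x < y0)]; rewrite ltxx.
Qed.

Lemma unit_cover x : 0 <= x <= 1 -> [\/ near x, far false x | far true x].
Proof.
move=> /andP[x0 x1]; have [xy0|y0x] := ltP x y0.
  by apply: Or32; rewrite /far /= in_itv/= x0.
have [xy1|y1x] := leP x y1; first by apply: Or31; rewrite /near /= in_itv/= y0x.
by apply: Or33; rewrite /far /= in_itv/= y1x.
Qed.

Lemma far_unit b x : far b x -> 0 <= x <= 1.
Proof.
case: b => /=; rewrite in_itv/= => /andP[? ?]; apply/andP; split => //.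
- by apply: le_trans (_ : y1 <= x); [have /andP[/ltW] := cut_01 true|exact: ltW].
- by apply: le_trans (_ : x <= y0) _; [exact: ltW|have /andP[_ /ltW] := cut_01 false].
Qed.

Lemma near_unit x : near x -> 0 <= x <= 1.
Proof.
rewrite /near /= in_itv/= => /andP[? ?]; apply/andP; split.
  exact: le_trans (ltW y00) _.
exact: le_trans (ltW y11).
Qed.

Let gam_g : g false gam = T gam.
Proof. by rewrite -(side_T S (b := false))//= in_itv/= gamc ltW. Qed.

Let Tgam_g : g true (T gam) = gam.
Proof. by rewrite -(side_T S (b := true))//= in_itv/= cTg ltW. Qed.

(** An orbit cannot jump over [[y0, y1]].  The branch [b] is increasing and maps
    the point of the periodic orbit on its side to the other one, which is why
    [y0] is not larger and [y1] not smaller than the points of that orbit. *)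
Lemma far_step b x : far b x -> far b (T x) \/ near (T x).
Proof.
move=> fx; have sx := far_side fx; have xi := side_itv sx.
have Tx : 0 <= T x <= 1 by rewrite (T_itv S)// (far_unit fx).
have [|f0|f1] := unit_cover Tx; first by right.
- case: b fx sx xi => fx sx xi; last by left.
  exfalso; move: f0; rewrite /far /= in_itv/= => /andP[_]; apply/negP.
  rewrite -leNgt (le_trans y0g)// (side_T S sx) -Tgam_g ltW// (g_ltE S)//.
    by move: fx; rewrite /far /= in_itv/= => /andP[+ _]; exact: le_lt_trans.
  by rewrite !ltW.
- case: b fx sx xi => fx sx xi; first by left.
  exfalso; move: f1; rewrite /far /= in_itv/= => /andP[+ _]; apply/negP.
  rewrite -leNgt; apply: le_trans gy1; rewrite (side_T S sx) -gam_g ltW// (g_ltE S)//.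
    by move: fx; rewrite /far /= in_itv/= => /andP[_]; move/lt_le_trans; apply.
  by rewrite !ltW.
Qed.

Lemma far_disj b x : far b x -> far (~~ b) x -> False.
Proof. by move=> /far_side s1 /far_side s2; have := side_inj s1 s2; case: (b). Qed.

Lemma far_back b x : far b (T x) -> far b x \/ near x.
Proof.
move=> fTx; have Tx := far_unit fTx; rewrite (T_itvE S) in Tx.
have H b' : far b' x -> far b x \/ near x.
  move=> fx; have [f1|/(far_near_disj fTx)//] := far_step fx.
  by left; rewrite (side_inj (far_side fTx) (far_side f1)).
by have [|/H|/H] := unit_cover Tx; [right| |].
Qed.

Lemma near_step x : near x -> [\/ near (T x), far false (T x) | far true (T x)].
Proof. by move=> /near_unit x01; apply: unit_cover; rewrite (T_itv S). Qed.

Let T_near_lt x : y0 <= x -> x < c -> x < T x.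
Proof.
move=> yx xc; have x0 : 0 < x by exact: lt_le_trans yx.
have sx : side c false x by rewrite /= in_itv/= xc ltW.
have := tb_expand S (b := false) (lexx _) x0 (ltW xc).
by rewrite (tb_lo S false) (side_T S sx) /= !subr0.
Qed.

Let T_near_gt x : c < x -> x <= y1 -> T x < x.
Proof.
move=> cx xy; have x1 : x < 1 by exact: le_lt_trans y11.
have sx : side c true x by rewrite /= in_itv/= cx ltW.
have := tb_expand S (b := true) (ltW cx) x1 (lexx _).
by rewrite (tb_hi S true) (side_T S sx) /=; lra.
Qed.

(** An excursion of positive length towards the fixed point of [b] starts in a
    one-sided neighbourhood of the discontinuity, on the side of the other
    branch; [reach b n] is the image of the boundary of this neighbourhood. *)
Let reach b n := iter n (f b) (cut b).

Let reach01 b n : 0 < reach b n < 1.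
Proof. exact: (iter_f_01 S _ _ (cut_01 b)). Qed.

Lemma excursionE b n x :
  excursion T near (far b) n.+1 x <-> near x /\ outer b (reach b n) (T x).
Proof.
split=> -[Yx H]; split => //.
  apply/(stay_outer S n _ (cut_01 b) (@far_side b)) => j jn.
  by rewrite -iterSr; apply: H.
move=> [//|j] jn; rewrite iterSr.
by have /(stay_outer S n _ (cut_01 b) (@far_side b)) := H; apply.
Qed.

Let reach_cut b n : if b then cut b <= reach b n else reach b n <= cut b.
Proof.
elim: n => [|n IH]; first by case: b => /=.
have := f_outward S b (reach01 b n); rewrite /reach iterS -/(reach b n).
case: b IH => IH /ltW H; first exact: le_trans H.
exact: le_trans IH.
Qed.

Let gam01 : 0 <= gam <= 1.
Proof. by rewrite ltW//= ltW// (lt_trans gamc)//; have /andP[] := tb_c S. Qed.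

Let Tgam01 : 0 <= T gam <= 1.
Proof. exact: (T_itv S gam01). Qed.

Let fTg : f false (T gam) = gam.
Proof. by rewrite -gam_g (gK S)// ?gam_g// /= !ltW. Qed.

Let fg : f true gam = T gam.
Proof. by rewrite -[in LHS]Tgam_g (gK S)// ?Tgam_g// /= !ltW. Qed.

Context (mT : measurable_fun setT (T : measurableTypeR R -> measurableTypeR R)).

(** A point of [Y] whose image is beyond [reach b n] must be on the side of the
    other branch, since the branch [b] moves points away from its own fixed
    point.  There the condition on the image is solved by the inverse branch. *)
Lemma excursion_between b t : exists p q,
  [/\ y0 <= p, p < q, q <= y1 & between p q (excursion T near (far b) t)].
Proof.
have mfar : measurable (far b : set (measurableTypeR R)).
  by rewrite /far; case: (b) => /=; exact: measurable_itv.
have mnear : measurable (near : set (measurableTypeR R)) by exact: measurable_itv.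
case: t => [|n].
  exists y0, y1; split => //; split.
  - rewrite (_ : excursion _ _ _ _ = near) //.
    by apply/seteqP; split=> x; [case|split => // j; case: j].
  - move=> x /=; rewrite in_itv/= => /andP[? ?]; split => [|[]//].
    by rewrite /near /= in_itv/= !ltW.
  - by move=> x [].
have /andP[cp0 cp1] := tb_c S.
have r01 := reach01 b n; have /andP[r0 r1] := r01.
have ri : 0 <= reach b n <= 1 by rewrite !ltW.
have mexc : measurable (excursion T near (far b) n.+1 : set (measurableTypeR R)).
  exact: (measurable_excursion mT).
have rc := reach_cut b n.
case: b mfar r01 r0 r1 ri rc mexc => mfar r01 r0 r1 ri rc mexc.
- have pc : f false (reach true n) < c by apply: (f_hi S false); rewrite r1 ltW.
  have y0p : y0 <= f false (reach true n).
    by apply: (le_trans y0g); rewrite -fTg (f_leE S)// (le_trans gy1).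
  have p0 : 0 <= f false (reach true n) by exact: le_trans (ltW y00) y0p.
  exists (f false (reach true n)), c; split => //; first exact: ltW.
  split => // x.
  + move=> xi; have /andP[px xc] : f false (reach true n) < x < c.
      by move: xi; rewrite /= in_itv.
    have sx : side c false x by rewrite /= in_itv/= xc (le_trans p0 (ltW px)).
    apply/excursionE; split.
      by rewrite /near /= in_itv/= (le_trans y0p (ltW px))/= ltW// (lt_trans xc).
    by apply/(outer_T S true r01 sx) => /=; rewrite in_itv/= px/= ltW// (lt_trans xc).
  + move=> /excursionE[Yx]; have := Yx; rewrite /near /= !in_itv/=.
    move=> /andP[yx xy] /andP[rT T1].
    have [xc|cx|->] := ltgtP x c; last by rewrite ltW.
    * have sx : side c false x by rewrite /= in_itv/= xc (le_trans (ltW y00)).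
      have /(outer_T S true r01 sx) : outer true (reach true n) (T x).
        by rewrite /= in_itv/= rT.
      by rewrite /= in_itv/= => /andP[? _]; rewrite ltW.
    * have := T_near_gt cx xy => Tx.
      by have := lt_trans rT (lt_le_trans Tx (le_trans xy rc)); rewrite ltxx.
- have cq : c < f true (reach false n) by apply: (f_lo S true); rewrite r0 ltW.
  have qy1 : f true (reach false n) <= y1.
    by apply: le_trans gy1; rewrite -fg (f_leE S)// (le_trans rc).
  exists c, (f true (reach false n)); split => //; first exact: ltW.
  split => // x.
  + move=> xi; have /andP[cx xq] : c < x < f true (reach false n).
      by move: xi; rewrite /= in_itv.
    have x1 : x <= 1 by rewrite ltW// (lt_trans xq)// (le_lt_trans qy1).
    have sx : side c true x by rewrite /= in_itv/= cx.
    apply/excursionE; split.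
      by rewrite /near /= in_itv/= (le_trans (ltW xq) qy1) andbT ltW// (lt_trans _ cx).
    by apply/(outer_T S false r01 sx) => /=; rewrite in_itv/= xq/= andbT ltW// (lt_trans _ cx).
  + move=> /excursionE[Yx]; have := Yx; rewrite /near /= !in_itv/=.
    move=> /andP[yx xy] /andP[T0 Tr].
    have [xc|cx|->] := ltgtP x c; last by rewrite ltW.
    * have := T_near_lt yx xc => Tx.
      by have := lt_trans (le_lt_trans (le_trans rc yx) Tx) Tr; rewrite ltxx.
    * have sx : side c true x by rewrite /= in_itv/= cx (le_trans xy (ltW y11)).
      have /(outer_T S false r01 sx) : outer false (reach false n) (T x).
        by rewrite /= in_itv/= T0.
      by rewrite /= in_itv/= => /andP[_ ?]; rewrite ltW.
Qed.

(** The image of a point of [Y] other than [c] is at a positive distance from the fixed points,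
    while the iterates [reach b n] converge to one of them. *)
Lemma excursion_infinite b :
  \bigcap_t excursion T near (far b) t `<=` [set c].
Proof.
move=> x Hx; have Yx : near x by case: (Hx 0%N I).
have O n : outer b (reach b n) (T x) by have /excursionE[] := Hx n.+1 I.
have := Yx; rewrite /near /= in_itv/= => /andP[yx xy].
have Tx01 : 0 <= T x <= 1 by rewrite (T_itv S)// near_unit.
have /andP[T0 T1] := Tx01.
have [xc|cx|//] := ltgtP x c.
- exfalso; have Tx := T_near_lt yx xc.
  have x0 : 0 < x by exact: lt_le_trans yx.
  case: b O {Hx} => O; last first.
    have [n] := iter_f_lim S false (cut_01 false) (lt_trans x0 Tx).
    have := O n; rewrite /= in_itv/= => /andP[_ r1] r2.
    by have := lt_trans r1 r2; rewrite ltxx.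
  have sx : side c false x by rewrite /= in_itv/= xc ltW.
  have T1' : T x < 1.
    have hb : branch_lo c false <= branch_hi c false <= branch_hi c false.
      by rewrite lexx /= ltW// (lt_trans x0).
    by rewrite (side_T S sx) -(tb_hi S false) (g_ltE S (side_itv sx) hb).
  have e0 : 0 < 1 - T x by rewrite subr_gt0.
  have [n] := iter_f_lim S true (cut_01 true) e0; rewrite opprB addrC subrK.
  have := O n; rewrite /= in_itv/= => /andP[r1 _] r2.
  by have := lt_trans r1 r2; rewrite ltxx.
- exfalso; have Tx := T_near_gt cx xy.
  have x1 : x < 1 by exact: le_lt_trans y11.
  case: b O {Hx} => O.
    have e0 : 0 < 1 - T x by rewrite subr_gt0 (lt_trans Tx).
    have [n] := iter_f_lim S true (cut_01 true) e0; rewrite opprB addrC subrK.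
    have := O n; rewrite /= in_itv/= => /andP[r1 _] r2.
    by have := lt_trans r1 r2; rewrite ltxx.
  have sx : side c true x by rewrite /= in_itv/= cx ltW.
  have T0' : 0 < T x.
    have hb : branch_lo c true <= branch_lo c true <= branch_hi c true.
      by rewrite lexx /= ltW// (lt_trans cx).
    by rewrite (side_T S sx) -(tb_lo S true) (g_ltE S hb (side_itv sx)).
  have [n] := iter_f_lim S false (cut_01 false) T0'.
  have := O n; rewrite /= in_itv/= => /andP[_ r1] r2.
  by have := lt_trans r1 r2; rewrite ltxx.
Qed.

End separated.

(** * Short sojourns and few visits for orbits that start in a core interval *)

Lemma sum_shift_le (y : nat -> bool) (n i J : nat) : (i < J)%N ->
  (\sum_(1 <= j < n.+1) y (j + i) <= \sum_(1 <= j < (n + J).+1) y j)%N.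
Proof.
move=> iJ; rewrite (_ : \sum_(1 <= j < n.+1) _ =
  \sum_(1 + i <= j < n.+1 + i) y j)%N; last by rewrite big_addn addnK.
rewrite [leqRHS](@big_cat_nat _ _ _ (1 + i))/=; [|lia|lia].
rewrite [X in (_ <= _ + X)%N](@big_cat_nat _ _ _ (n.+1 + i))/=; [|lia|lia].
lia.
Qed.

Section bounds.
Context (R : realType) (c : R) (T : R -> R) (g f : bool -> R -> R) (M1 M : R).
Context (S : two_branches c T g f M1 M).
Context (gam y0 y1 : R) (gam0 : 0 < gam) (gamc : gam < c).
Context (cTg : c < T gam) (Tg1 : T gam < 1) (per : T (T gam) = gam).
Context (y00 : 0 < y0) (y0g : y0 <= gam) (gy1 : T gam <= y1) (y11 : y1 < 1).
Context (mu : {measure set (measurableTypeR R) -> \bar R}) (eta : R).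
Context (mT : measurable_fun setT (T : measurableTypeR R -> measurableTypeR R)).
Context (Tinv : forall A : set (measurableTypeR R), measurable A ->
  mu (T @^-1` A) = mu A).
Context (eta0 : 0 < eta).
Context (mu_ge : forall x y, 0 < x -> x < y -> y < 1 ->
  ((eta * (y - x))%:E <= mu `]x, y[%classic)%E).
Context (mu_fin : forall x y, 0 < x -> y < 1 -> (mu `[x, y]%classic < +oo)%E).
Context (mu_le : forall u v, 0 < u -> v < 1 -> exists2 H, 0 < H &
  forall x y, u <= x -> x < y -> y <= v ->
  (mu `]x, y[%classic <= (H * (y - x))%:E)%E).
Context (mu_pt : forall x, mu [set x] = 0%E).

Let Y : set (measurableTypeR R) := near y0 y1.
Let A b : set (measurableTypeR R) := far y0 y1 b.
Let B b t := excursion T Y (A b) t.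
Let q b t := fine (mu (return_layer T Y (A b) t)).

Let mY : measurable Y. Proof. exact: measurable_itv. Qed.
Let mA b : measurable (A b).
Proof. by rewrite /A /far; case: b; exact: measurable_itv. Qed.
Let Yfin : (mu Y < +oo)%E. Proof. exact: mu_fin. Qed.

Let Ysub_fin (Z : set (measurableTypeR R)) : measurable Z -> Z `<=` Y ->
  (mu Z < +oo)%E.
Proof.
by move=> mZ ZY; apply: le_lt_trans Yfin; apply: le_measure; rewrite ?inE.
Qed.

Let stepA := far_step S gam0 gamc cTg Tg1 per y00 y0g gy1 y11.
Let backA := far_back S gam0 gamc cTg Tg1 per y00 y0g gy1 y11.

Lemma far_return_layer_noninc b s t : (0 < s)%N -> (s <= t)%N -> q b t <= q b s.
Proof.
apply: (return_layer_noninc mT Tinv mY (mA b) Yfin (@far_near_disj _ _ _ b)).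
exact: (@backA b).
Qed.

Lemma far_excursion_ge b s L : (0 < s)%N ->
  q b s - q b (s + L)%N <= fine (mu (B b s)).
Proof.
apply: (excursion_ge mT Tinv mY (mA b) Yfin (@far_near_disj _ _ _ b)).
- exact: (@stepA b).
- exact: (@backA b).
Qed.

Lemma far_excursion_le b t : (0 < t)%N -> fine (mu (B b t)) <= q b t.
Proof.
apply: (excursion_le mT Tinv mY (mA b) Yfin (@far_near_disj _ _ _ b)).
- exact: (@stepA b).
- exact: (@backA b).
- have mc : measurable ([set c] : set (measurableTypeR R)) := measurable_set1 _.
  have mI : measurable (\bigcap_t B b t).
    by apply: bigcap_measurableType => t' _; exact: (measurable_excursion mT).
  have H : \bigcap_t B b t `<=` [set c].
    exact: (excursion_infinite S gamc cTg y00 y0g gy1 y11).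
  by apply/eqP; rewrite eq_le measure_ge0 andbT -(mu_pt c) le_measure ?inE.
Qed.

Let y01 : y0 < y1.
Proof. by rewrite (le_lt_trans y0g)// (lt_le_trans _ gy1)// (lt_trans gamc). Qed.

Let Bbetw b t := excursion_between S gam0 gamc cTg Tg1 per y00 y0g gy1 y11 mT b t.

Let between_gt0 (I : set (measurableTypeR R)) p r :
  y0 <= p -> p < r -> r <= y1 -> between p r I ->
  (mu I < +oo)%E -> 0 < fine (mu I).
Proof.
move=> yp pr ry [mI sub _] Ifin; rewrite -lte_fin fineK ?ge0_fin_numE//.
have mo : measurable (`]p, r[%classic : set (measurableTypeR R)).
  exact: measurable_itv.
apply: lt_le_trans (le_measure mu (mem_set mo) (mem_set mI) sub).
have p0 : 0 < p by exact: lt_le_trans yp.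
have r1 : r < 1 by exact: le_lt_trans y11.
apply: lt_le_trans (mu_ge p0 pr r1).
by rewrite lte_fin mulr_gt0// subr_gt0.
Qed.

Lemma far_excursion_bounds b t : 0 < fine (mu (B b t)) <= fine (mu Y).
Proof.
have mB : measurable (B b t) by exact: (measurable_excursion mT).
have BY : B b t `<=` Y by move=> x [].
have Bfin := Ysub_fin mB BY; apply/andP; split.
  by have [p [r [yp pr ry br]]] := Bbetw b t; exact: (between_gt0 yp pr ry br).
by rewrite fine_le ?ge0_fin_numE ?le_measure ?inE.
Qed.

Context (n0 : nat).
Let u := iter n0 (f false) c.
Let v := iter n0 (f true) c.
Context (uy0 : u <= y0) (y1v : y1 <= v).

Let Om : set (measurableTypeR R) := `[u, v]%classic.
Let D b : set (measurableTypeR R) := outer b (iter n0 (f b) c).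
Let J := n0.+1.

Let u0 : 0 < u.
Proof. by have /andP[] := iter_f_01 S false n0 (tb_c S). Qed.
Let v1 : v < 1.
Proof. by have /andP[] := iter_f_01 S true n0 (tb_c S). Qed.

Let mOm : measurable Om. Proof. exact: measurable_itv. Qed.
Let mD b : measurable (D b).
Proof. by rewrite /D; case: b; exact: measurable_itv. Qed.

Let Omfin : (mu Om < +oo)%E. Proof. exact: mu_fin. Qed.

(** The core [Om] is the complement of the sets [D b], and [D b] is described
    by the first [J] symbols. *)
Let DP b x : D b x <-> forall j, (j < J)%N -> side c b (iter j T x).
Proof.
have cs : outer b c `<=` side c b by move=> z /outer_side.
have := stay_outer S n0 x (tb_c S) cs; rewrite -/(D b) => <-.
by case: b {cs}.
Qed.

Let DA b : D b `<=` A b.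
Proof.
case: b => x /=; rewrite !in_itv/= => /andP[? ?]; apply/andP; split => //.
- exact: le_lt_trans y1v _.
- exact: lt_le_trans uy0.
Qed.

Let AD b x : (forall i, (i < J)%N -> A b (iter i T x)) -> D b x.
Proof.
by move=> H; apply/DP => j /H; exact: (far_side gamc cTg y0g gy1).
Qed.

Let OmP x : Om x <-> 0 <= x <= 1 /\ (forall b, ~ D b x).
Proof.
split=> [|[/andP[x0 x1] nD]].
  rewrite /Om /= in_itv/= => /andP[ux xv]; split.
    by rewrite (le_trans (ltW u0) ux) (le_trans xv (ltW v1)).
  case=> /=; rewrite in_itv/= => /andP[]; [move=> + _|move=> _]; apply/negP; by rewrite -leNgt.
rewrite /Om /= in_itv/= !leNgt; apply/andP; split; apply/negP => xu.
- by apply: (nD false); rewrite /D /= in_itv/= x0.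
- by apply: (nD true); rewrite /D /= in_itv/= x1 andbT.
Qed.

(** Outside of [Y], an orbit that avoids [Y] for [J] steps stays on one side
    all that time, so its starting point is in one of the sets [D b]. *)
Lemma core_entry x : Om x -> exists2 i, (i < J)%N & Y (iter i T x).
Proof.
move=> /OmP[x01 nD].
have H b : A b x -> exists2 i, (i < J)%N & Y (iter i T x).
  move=> Ax; apply: contrapT => /forall2NP nY; apply: (nD b); apply: AD.
  elim=> [//|i IH] iJ.
  have [//|Yi] := stepA (IH (ltnW iJ)); exfalso.
  by case: (nY i.+1).
have [Yx|/H//|/H//] := unit_cover y0 y1 x01.
by exists 0%N.
Qed.

(** All parts of the event [short_past] can be read off the symbols before time
    [k], apart from the visit to [Y] at time [k], which is assumed. *)
Let short_past_det b m k w x x' : (J <= k)%N -> size w = k ->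
  cylinder c T w x -> cylinder c T w x' ->
  y0 <= iter k T x <= y1 -> y0 <= iter k T x' <= y1 ->
  short_past T Y (D b) Om J m k x -> short_past T Y (D b) Om J m k x'.
Proof.
move=> Jk wk wx wx' Yx Yx' [[Omx _] fx].
have sideE b' j : (j < k)%N -> side c b' (iter j T x) <-> side c b' (iter j T x').
  move=> jk; have s1 := cylinder_side wx (j := j); have s2 := cylinder_side wx' (j := j).
  rewrite wk in s1 s2; have {}s1 := s1 jk; have {}s2 := s2 jk.
  by split=> H; [rewrite (side_inj H s1)|rewrite (side_inj H s2)].
have DE b' i : (i + J <= k)%N -> D b' (iter i T x) <-> D b' (iter i T x').
  move=> iJ; rewrite !DP; split=> H j jJ; rewrite -iterD;
    have jk : (j + i < k)%N by rewrite addnC (leq_trans _ iJ)// ltn_add2l.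
    by apply/sideE => //; rewrite iterD; exact: H.
  by apply/sideE => //; rewrite iterD; exact: H.
split; first split.
- apply/OmP; have /OmP[x01 nD] := Omx; split.
    have := cylinder_side (j := 0%N) wx'; rewrite wk => /(_ (leq_trans (ltn0Sn _) Jk)).
    case: (nth _ _ _) => /=; rewrite in_itv/= => /andP[? ?]; apply/andP; split=> //.
    + by apply: le_trans (ltW (_ : c < x')) => //; have /andP[/ltW] := tb_c S.
    + by apply: le_trans (ltW (_ : x' < c)) _ => //; have /andP[_ /ltW] := tb_c S.
  by move=> b' /(DE b' 0%N) => /(_ Jk); exact: nD.
- by rewrite /Y /near /= in_itv.
- move: fx; rewrite /few_visits /=; apply: leq_trans.
  rewrite big_nat_cond [leqRHS]big_nat_cond; apply: leq_sum => i.
  rewrite andbT => /andP[i1 ik].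
  have [/set_mem DX|//] := boolP (iter i T x' \in D b).
  rewrite mem_set//; apply/DE => //.
  by rewrite -(subnK Jk) leq_add2r -ltnS.
Qed.

Lemma sojourn_bound : exists2 K, 0 <= K & forall b m n,
  (n.+1 - J - m)%:R * fine (mu (Om `&` few_visits T (A b) m n)) <=
  (J%:R + K ^+ 2 * fine (mu Om) / fine (mu (B b (m + J)))) *
    \sum_(0 <= t < n.+1) fine (mu (B (~~ b) t)).
Proof.
have [H H0 muH] := mu_le u0 v1.
pose K := (H / eta) ^+ 2 * expR (M * M1 / eta * fine (mu `]y0, y1[%classic)).
have K0 : 0 <= K by rewrite mulr_ge0 ?expR_ge0// exprn_even_ge0.
have Ybetw : between y0 y1 Y.
  split => // x /=; rewrite /near !in_itv/= => /andP[? ?].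
  by apply/andP; split; exact: ltW.
exists K => // b m n.
have mE k : measurable (short_past T Y (D b) Om J m k).
  apply: measurableI; last exact: (measurable_few_visits mT).
  by apply: measurableI => //; exact: (measurable_iter mT).
have Esub k : short_past T Y (D b) Om J m k `<=` `[u, v]%classic by move=> x [[]].
have QI k I I' p1 p2 r1 r2 : (J <= k)%N -> y0 <= p1 -> p1 < p2 -> p2 <= y1 ->
    y0 <= r1 -> r1 < r2 -> r2 <= y1 -> between p1 p2 I -> between r1 r2 I' ->
    fine (mu (short_past T Y (D b) Om J m k `&` iter k T @^-1` I)) * fine (mu I')
    <= K * (fine (mu (short_past T Y (D b) Om J m k `&` iter k T @^-1` I')) *
      fine (mu I)).
  move=> Jk; apply: (quasi_independence S mT Tinv eta0 mu_ge mu_fin mu_pt y00 y01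
    y11 u0 v1 uy0 y1v H0 muH (mE k) (@Esub k)).
  by move=> w x x'; exact: short_past_det.
have EY k : short_past T Y (D b) Om J m k `&` iter k T @^-1` Y =
    short_past T Y (D b) Om J m k.
  by apply/setIidPl => x [[]].
apply: (measure_short_sojourn mT Tinv mY Yfin (D := D b)) => //.
- by move=> x; exact: far_near_disj.
- by move=> x; exact: (@stepA b).
- by move=> x; exact: (@stepA (~~ b)).
- move=> x /(near_step S y00 y11)[]; first by move=> ?; apply: Or31.
    by case: (b) => ?; [apply: Or33|apply: Or32].
  by case: (b) => ?; [apply: Or32|apply: Or33].
- exact: AD.
- exact: core_entry.
- move=> k t Jk; have [p [r [yp pr ry br]]] := Bbetw (~~ b) t.
  by have := QI _ _ _ _ _ _ _ Jk yp pr ry (lexx _) y01 (lexx _) br Ybetw; rewrite EY.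
- move=> k Jk; have [p [r [yp pr ry br]]] := Bbetw b (m + J)%N.
  by have := QI _ _ _ _ _ _ _ Jk (lexx _) y01 (lexx _) yp pr ry Ybetw br; rewrite EY.
- exact: (between_gt0 (lexx _) y01 (lexx _) Ybetw).
- by have /andP[] := far_excursion_bounds b (m + J).
Qed.

(** The orbit enters [Y] within [J] steps, and the visits made until then can be
    discarded by invariance at the cost of a factor [J]. *)
Lemma visits_bound N n :
  n.+1%:R * fine (mu (Om `&` few_visits T Y N (n + J))) <=
  J%:R * (N.+1%:R * \sum_(0 <= t < n.+1)
    (fine (mu (B false t)) + fine (mu (B true t)))).
Proof.
pose V := Y `&` few_visits T Y N n.
have mV : measurable V by apply: measurableI => //; exact: (measurable_few_visits mT).
have Vfin : (mu V < +oo)%E.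
  by apply: Ysub_fin => //; exact: subIsetl.
have mX : measurable (Om `&` few_visits T Y N (n + J)).
  by apply: measurableI => //; exact: (measurable_few_visits mT).
have Xfin : (mu (Om `&` few_visits T Y N (n + J)) < +oo)%E.
  by apply: le_lt_trans Omfin; apply: le_measure; rewrite ?inE//; exact: subIsetl.
have XV : fine (mu (Om `&` few_visits T Y N (n + J))) <= J%:R * fine (mu V).
  rewrite -[leLHS]mul1r.
  rewrite (_ : J%:R * _ = \sum_(0 <= i < J) fine (mu (iter i T @^-1` V))); last first.
    rewrite (eq_bigr (fun=> fine (mu V))) => [|i _]; last by rewrite (measure_iter mT Tinv).
    by rewrite sumr_const_nat subn0 mulr_natl.
  apply: (@fine_measure_count_ge _ _ _ mu _ (index_iota 0 J)
    (fun i => iter i T @^-1` V) _ _ 1) => //.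
  - by move=> i; exact: (measurable_iter mT).
  - by move=> i; rewrite (measure_iter mT Tinv).
  - move=> x [/core_entry[i iJ Yi] xN].
    rewrite (bigD1_seq i) ?iota_uniq ?mem_index_iota//.
    rewrite mem_set// ?leq_addr//; split => //; apply: leq_trans xN.
    under eq_bigr do rewrite -iterD.
    exact: (@sum_shift_le (fun j => iter j T x \in Y)).
apply: (le_trans (ler_wpM2l _ XV)) => //; rewrite mulrCA ler_wpM2l//.
apply: (le_trans (measure_few_visits mT Tinv mY Yfin N n)); rewrite ler_wpM2l//.
apply: ler_sum => t _.
have mB b : measurable (B b t) by exact: (measurable_excursion mT).
have Bfin b : (mu (B b t) < +oo)%E.
  by apply: (Ysub_fin (mB b)) => x [].
have mC : measurable (excursion T Y (~` Y) t).
  by apply: (measurable_excursion mT) => //; exact: measurableC.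
have Cfin : (mu (excursion T Y (~` Y) t) < +oo)%E.
  by apply: (Ysub_fin mC) => x [].
rewrite -lee_fin EFinD !fineK ?ge0_fin_numE//.
apply: le_trans (measureU2 mu (mB false) (mB true)).
apply: (le_measure mu (mem_set mC) (mem_set (measurableU _ _ (mB false) (mB true)))).
move=> x [Yx H]; have Hn i : (0 < i <= t)%N -> ~ Y (iter i T x) by move=> /H.
case: t {mB Bfin mC Cfin} H Hn => [|t] H Hn; first by left; split => // -[].
have side b' : A b' (T x) -> B b' t.+1 x.
  by move=> A1; split => //; exact: (@iter_side _ T Y (A b') x 0 t.+1 (@stepA b') A1 Hn).
have [Y1|/side|/side] := near_step S y00 y11 Yx; [|by left|by right].
by case: (Hn 1%N).
Qed.

End bounds.

(** * Consequences of regular variation *)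

Lemma leq_double_pred m : (2 <= m)%N -> (m <= m.-1 * 2)%N.
Proof. lia. Qed.

Section regular_variation.
Context (R : realType) (alpha : R) (l : R -> R).
Context (alpha01 : 0 < alpha < 1) (hl : slowly_varying_pinfty l).

Definition reg_var (n : nat) : R := n%:R `^ (1 - alpha) * l n%:R.
Local Notation rho := reg_var.

Let lpos t : 0 < t -> 0 < l t. Proof. by have [[]] := hl => + _ _; exact. Qed.

Lemma reg_var_gt0 n : (0 < n)%N -> 0 < rho n.
Proof. by move=> n0; rewrite mulr_gt0 ?powR_gt0 ?lpos// ltr0n. Qed.

Lemma reg_var_scale (L : nat) : (0 < L)%N ->
  rho (L * n)%N / rho n @[n --> \oo] --> L%:R `^ (1 - alpha).
Proof.
move=> L0; have L0R : 0 < L%:R :> R by rewrite ltr0n.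
have cl : l (L%:R * n%:R) / l n%:R @[n --> \oo] --> (1 : R).
  have [_ /(_ _ L0R) H] := hl.
  exact: cvg_comp (@cvgr_idn R) H.
have : L%:R `^ (1 - alpha) * (l (L%:R * n%:R) / l n%:R) @[n --> \oo] -->
  L%:R `^ (1 - alpha) * 1 by exact: cvgMl_tmp.
rewrite mulr1; apply: cvg_trans.
apply: near_eq_cvg; near=> n.
have n0 : (0 < n)%N by near: n; exact: nbhs_infty_gt.
have n0R : 0 < n%:R :> R by rewrite ltr0n.
rewrite /rho natrM powRM// /=; field.
by rewrite !gt_eqF ?powR_gt0 ?lpos.
Unshelve. all: by end_near. Qed.

Lemma asymp_const_gt0 (w : nat -> R) bet : (forall n, 0 <= w n) ->
  asymp_equiv \oo w (fun n => bet * rho n) -> 0 < bet.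
Proof.
move=> w0 /cvgrPdist_le/(_ (1 / 2)) H; have {}H := H ltac:(lra).
have [N _ HN] := H; have := HN N.+1 (leqnSn _); rewrite /= => Hn.
have rn := @reg_var_gt0 N.+1 isT.
rewrite ltNge; apply/negP => b0; move: Hn; apply/negP; rewrite -ltNge.
have : w N.+1 / (bet * rho N.+1) <= 0.
  by rewrite mulr_ge0_le0// invr_le0 mulr_le0_ge0// ltW.
move: (w _ / _) => z z0; apply: lt_le_trans (ler_norm _).
by lra.
Qed.

Lemma asymp_scale (w : nat -> R) bet L : (0 < L)%N -> 0 < bet ->
  asymp_equiv \oo w (fun n => bet * rho n) ->
  w (L * n)%N / rho n @[n --> \oo] --> bet * L%:R `^ (1 - alpha).
Proof.
move=> L0 b0 H.
have H1 : w (L * n)%N / (bet * rho (L * n)%N) @[n --> \oo] --> (1 : R).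
  have HL : (L * n)%N @[n --> \oo] --> \oo.
    apply/cvgnyPge => A; near=> n; apply: leq_trans (leq_pmull n L0).
    by near: n; exact: nbhs_infty_ge.
  exact: cvg_comp HL H.
have Hb : bet * (rho (L * n)%N / rho n) @[n --> \oo] --> bet * L%:R `^ (1 - alpha).
  exact: (cvgMl_tmp (reg_var_scale L0)).
have : w (L * n)%N / (bet * rho (L * n)%N) * (bet * (rho (L * n)%N / rho n))
    @[n --> \oo] --> 1 * (bet * L%:R `^ (1 - alpha)) by exact: cvgM.
rewrite mul1r; apply: cvg_trans.
apply: near_eq_cvg; near=> n.
have n0 : (0 < n)%N by near: n; exact: nbhs_infty_gt.
have r1 := reg_var_gt0 n0; have r2 : 0 < rho (L * n) by rewrite reg_var_gt0// muln_gt0 L0.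
by rewrite /=; field; rewrite !gt_eqF.
Unshelve. all: by end_near. Qed.

Let near_le (x : nat -> R) (y z : R) : x n @[n --> \oo] --> y -> y < z ->
  \forall n \near \oo, x n <= z.
Proof. by move=> xy yz; apply: (cvgr_le _ xy). Qed.

Let near_ge (x : nat -> R) (y z : R) : x n @[n --> \oo] --> y -> z < y ->
  \forall n \near \oo, z <= x n.
Proof. by move=> xy yz; apply: (cvgr_ge _ xy). Qed.

(** Tauberian estimates for a sequence that is nonincreasing from index [1] on
    and whose partial sums are regularly varying of exponent [1 - alpha].  In
    the application the index [0] stands for [Y] itself. *)
Section tails.
Context (q : nat -> R) (bet : R) (q0 : forall n, 0 <= q n).
Context (q_noninc : forall s t, (0 < s)%N -> (s <= t)%N -> q t <= q s).

Let w n := \sum_(0 <= k < n) q k.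

Context (wrho : asymp_equiv \oo w (fun n => bet * rho n)).

Let w0 n : 0 <= w n. Proof. exact: sumr_ge0. Qed.

Let w_le m n : (m <= n)%N -> w m <= w n.
Proof. by move=> mn; rewrite /w (big_cat_nat (leq0n m) mn)/= lerDl sumr_ge0. Qed.

Lemma tail_const_gt0 : 0 < bet. Proof. exact: asymp_const_gt0 wrho. Qed.

Lemma partial_sum_ge : \forall n \near \oo, bet / 2 * rho n <= w n.
Proof.
have b0 := tail_const_gt0.
have := asymp_scale (isT : (0 < 1)%N) b0 wrho; rewrite powR1 mulr1 => H.
have : bet / 2 < bet by lra.
move=> /(near_ge H); apply: filterS2 (nbhs_infty_gt 0) => n n0.
by rewrite mul1n ler_pdivlMr// reg_var_gt0.
Qed.

Lemma partial_sum_le : exists2 C, 0 < C &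
  \forall n \near \oo, w n.+1 <= C * rho n.
Proof.
have b0 := tail_const_gt0.
have H := asymp_scale (isT : (0 < 2)%N) b0 wrho.
set y := bet * _ in H; have y0 : 0 < y by rewrite mulr_gt0 ?powR_gt0.
exists (2 * y); first by rewrite mulr_gt0.
have : y < 2 * y by lra.
move=> /(near_le H); apply: filterS2 (nbhs_infty_gt 0) => n n0.
rewrite ler_pdivrMr ?reg_var_gt0//; apply: le_trans; apply: w_le; lia.
Qed.

(** The term [b 0] is not controlled by [q], but it is absorbed because the
    partial sums are eventually bounded away from zero. *)
Lemma tail_sum_le (b : nat -> R) : (forall t, (0 < t)%N -> b t <= q t) ->
  exists2 C, 0 < C &
    \forall n \near \oo, \sum_(0 <= t < n.+1) b t <= C * rho n.
Proof.
move=> bq; have b0 := tail_const_gt0; have [C C0 HC] := partial_sum_le.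
have [N _ HN] := partial_sum_ge.
have wN : 0 < w N.+1.
  by apply: lt_le_trans (HN N.+1 (leqnSn _)); rewrite mulr_gt0 ?divr_gt0// reg_var_gt0.
exists (C + `|b 0%N| * C / w N.+1).
  by rewrite ltr_pwDl// mulr_ge0 ?invr_ge0 ?mulr_ge0// ltW.
apply: filterS2 HC (nbhs_infty_ge N) => n HC Nn.
rewrite big_ltn// mulrDl addrC; apply: lerD.
  apply: le_trans HC; rewrite /w [leRHS]big_ltn//= -[leLHS]add0r lerD//.
  by apply: ler_sum_nat => t /andP[t0 _]; exact: bq.
apply: (le_trans (ler_norm _)).
rewrite mulrAC ler_pdivlMr// -mulrA ler_wpM2l//; apply: le_trans HC.
exact: w_le.
Qed.

(** By monotonicity, [q n] is at least the mean of [q] over [[n, 2 n]], which is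
    of order [rho n / n], while [q (L * n)] is at most the mean of [q] up to
    [L * n], of order [L ^ (- alpha) * rho n / n].  For a large constant [L] the
    difference is still of order [rho n / n]. *)
Lemma tail_ge (b : nat -> R) :
  (forall s L, (0 < s)%N -> q s - q (s + L)%N <= b s) ->
  exists2 C, 0 < C & \forall n \near \oo, C * (rho n / n%:R) <= b n.
Proof.
move=> bq; have b0 := tail_const_gt0; have /andP[a0 a1] := alpha01.
pose d := bet * (2 `^ (1 - alpha) - 1).
have d0 : 0 < d.
  have : 1 `^ (1 - alpha) < 2 `^ (1 - alpha) :> R.
    by apply: gt0_ltr_powR; rewrite ?subr_gt0 ?nnegrE// ltr1n.
  by rewrite powR1 => ?; rewrite mulr_gt0// subr_gt0.
pose x := (16 * bet / d) `^ alpha^-1.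
pose L := (Num.trunc x).+2.
have xL : x <= L%:R.
  by apply: ltW; apply: lt_trans (truncnS_gt _) _; rewrite ltr_nat.
have x0 : 0 < x by rewrite powR_gt0// divr_gt0// mulr_gt0.
have La : 16 * bet / d <= L%:R `^ alpha.
  have -> : 16 * bet / d = x `^ alpha.
    by rewrite /x -powRrM mulVf ?gt_eqF// powRr1//; apply/ltW; rewrite divr_gt0// mulr_gt0.
  by rewrite ge0_ler_powR// ?ltW// nnegrE ltW.
have L0 : 0 < L%:R :> R by rewrite ltr0n.
exists (d / 4); first by rewrite divr_gt0.
have H1 := asymp_scale (isT : (0 < 1)%N) b0 wrho; rewrite powR1 mulr1 in H1.
have H2 := asymp_scale (isT : (0 < 2)%N) b0 wrho.
have H2d : w (2 * n)%N / rho n - w (1 * n)%N / rho n @[n --> \oo] --> d.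
  by rewrite /d mulrBr mulr1; exact: cvgB H2 H1.
have HL := asymp_scale (isT : (0 < L)%N) b0 wrho.
set y := bet * _ in HL; have y0 : 0 < y by rewrite mulr_gt0 ?powR_gt0.
have /(near_ge H2d) N1 : d / 2 < d by lra.
have /(near_le HL) N2 : y < 2 * y by lra.
near=> n.
have n0 : (0 < n)%N by near: n; exact: nbhs_infty_gt.
have nR : 0 < n%:R :> R by rewrite ltr0n.
have rn := reg_var_gt0 n0.
have D1 : d / 2 * (rho n / n%:R) <= q n.
  rewrite mulrA ler_pdivrMr//.
  have : d / 2 <= w (2 * n)%N / rho n - w (1 * n)%N / rho n by near: n.
  rewrite -mulrBl ler_pdivlMr// => /le_trans; apply; rewrite mul1n.
  rewrite /w (big_cat_nat (leq0n n) (leq_pmull n (isT : 0 < 2)%N))/=.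
  rewrite addrAC subrr add0r.
  have -> : q n * n%:R = \sum_(n <= k < 2 * n) q n.
    by rewrite sumr_const_nat mulr_natr mul2n -addnn addnK.
  by apply: ler_sum_nat => k /andP[nk _]; exact: q_noninc.
have D2 : q (L * n)%N <= d / 4 * (rho n / n%:R).
  have W : w (L * n)%N <= 2 * y * rho n.
    by rewrite -ler_pdivrMr//; near: n.
  have Ln : (2 <= L * n)%N by rewrite (leq_trans (_ : 2 <= L)%N)// leq_pmulr.
  have QW : q (L * n)%N * (L * n).-1%:R <= w (L * n)%N.
    rewrite /w big_ltn; last exact: leq_trans Ln.
    rewrite -[leLHS]add0r lerD//.
    have -> : q (L * n)%N * (L * n).-1%:R = \sum_(1 <= k < L * n) q (L * n)%N.
      by rewrite sumr_const_nat mulr_natr subn1.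
    by apply: ler_sum_nat => k /andP[k1 kL]; apply: q_noninc => //; exact: ltnW.
  have half : (L * n)%:R / 2 <= (L * n).-1%:R :> R.
    by rewrite ler_pdivrMr// -natrM ler_nat leq_double_pred.
  have QL : q (L * n)%N * ((L * n)%:R / 2) <= 2 * y * rho n.
    by apply: le_trans W; apply: le_trans QW; rewrite ler_wpM2l.
  have yE : y * L%:R `^ alpha = bet * L%:R.
    rewrite /y -mulrA -powRD ?subrK ?powRr1 ?ler0n//.
    by rewrite gt_eqF ?implybT.
  have yL : 16 * y <= d * L%:R.
    rewrite -(ler_pM2r (powR_gt0 alpha L0)) -mulrA yE.
    rewrite (_ : 16 * (bet * L%:R) = d * L%:R * (16 * bet / d)); last first.
      by field; rewrite gt_eqF.
    by rewrite ler_wpM2l// mulr_ge0// ltW.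
  have Ln0 : 0 < L%:R * n%:R :> R by rewrite mulr_gt0.
  rewrite -(ler_pM2r Ln0) (_ : d / 4 * _ * _ = d * L%:R / 4 * rho n); last first.
    by field; rewrite gt_eqF.
  move: QL; rewrite natrM => QL.
  apply: (@le_trans _ _ (4 * y * rho n)).
    rewrite (_ : q _ * _ = 2 * (q (L * n)%N * (L%:R * n%:R / 2))); last by field.
    rewrite (_ : 4 * y * rho n = 2 * (2 * y * rho n)); last by ring.
    by rewrite ler_wpM2l.
  by rewrite ler_wpM2r ?(ltW rn)//; lra.
have : (n + (L * n - n))%N = (L * n)%N by rewrite subnKC// leq_pmull.
have := bq n (L * n - n)%N n0 => /[swap] ->; apply: le_trans.
rewrite (_ : d / 4 * _ = d / 2 * (rho n / n%:R) - d / 4 * (rho n / n%:R)).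
  exact: lerB.
by field; rewrite gt_eqF.
Unshelve. all: by end_near. Qed.

End tails.
Let rho_div n : (0 < n)%N -> n%:R / rho n = n%:R `^ alpha / l n%:R.
Proof.
move=> n0; have nR : 0 < n%:R :> R by rewrite ltr0n.
have E : n%:R = n%:R `^ alpha * n%:R `^ (1 - alpha) :> R.
  rewrite -powRD; last by apply/implyP => _; rewrite gt_eqF.
  by rewrite addrC subrK powRr1 ?ler0n.
rewrite /rho {1}E; have := lpos nR; have := powR_gt0 (1 - alpha) nR.
by move=> ? ?; field; rewrite !gt_eqF.
Qed.

Lemma half_le_sub (n J m : nat) : (4 * J <= n)%N -> (4 * m <= n)%N ->
  n%:R / 2 <= (n.+1 - J - m)%:R :> R.
Proof. by move=> nJ nm; rewrite ler_pdivrMr// -natrM ler_nat; lia. Qed.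

(** The comparison of [l t] with [l s] for [t <= s <= 2 t] is where the uniform
    bound for slowly varying functions enters. *)
Let scale_cancel (A e t s n : R) : 0 <= A -> 0 < e -> 0 < n -> t = e * n -> 0 < t -> 0 < l s ->
  t <= s <= 2 * t -> l t <= 4 * l s ->
  l t / (e `^ alpha * l n) * (A * (s `^ alpha / l s) / (n `^ alpha / l n)) <= 8 * A.
Proof.
move=> A0 e0 n0 tE t0 ls0 /andP[ts s2t] lts; have /andP[a0 a1] := alpha01.
have s0 : 0 < s by exact: lt_le_trans t0 ts.
have ln0 := lpos n0; have pn := powR_gt0 alpha n0; have pe := powR_gt0 alpha e0.
have pt : t `^ alpha = e `^ alpha * n `^ alpha by rewrite tE powRM// ltW.
have pt0 : 0 < t `^ alpha by exact: powR_gt0.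
have st : s `^ alpha <= 2 * t `^ alpha.
  apply: (@le_trans _ _ ((2 * t) `^ alpha)).
    by rewrite ge0_ler_powR ?nnegrE ?mulr_ge0// ltW.
  rewrite powRM ?(ltW t0)// ler_wpM2r ?(ltW pt0)//.
  by apply: ler1_powR; [rewrite ler1n|exact: ltW].
rewrite (_ : _ * _ = A * (l t * s `^ alpha / (l s * t `^ alpha))); last first.
  by rewrite pt; field; rewrite !gt_eqF.
rewrite mulrC ler_wpM2r// ler_pdivrMr ?mulr_gt0//.
rewrite (_ : 8 * _ = (4 * l s) * (2 * t `^ alpha)); last by ring.
by apply: ler_pM => //; [exact/ltW/lpos|exact/ltW/powR_gt0].
Qed.

(** Inserting [m] close to [e n * n] in the sojourn estimate bounds [X m n] by a
    multiple of [(s / rho s) * (rho n / n)] with [s = m + J], and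
    [n / rho n = n ^ alpha / l n]. *)
Lemma sojourn_limsup (X : nat -> nat -> R) (b W : nat -> R) (J : nat)
    (K1 Mb C1 C2 : R) :
  (0 < J)%N -> 0 <= K1 -> 0 < C1 -> 0 < C2 ->
  (forall n, 0 < b n <= Mb) ->
  (forall m n, (n.+1 - J - m)%:R * X m n <= (J%:R + K1 / b (m + J)%N) * W n) ->
  (forall n, 0 <= W n) ->
  (\forall n \near \oo, C1 * (rho n / n%:R) <= b n) ->
  (\forall n \near \oo, W n <= C2 * rho n) ->
  exists2 C, 0 < C & forall e : nat -> R, (forall n, 0 < e n) ->
    e n @[n --> \oo] --> (0 : R) -> e n * n%:R @[n --> \oo] --> +oo ->
    \forall n \near \oo, l (e n * n%:R) / (e n `^ alpha * l n%:R) *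
      X (Num.trunc (e n * n%:R)) n <= C.
Proof.
move=> J0 K10 C10 C20 bP XP W0 bge Wle; have /andP[a0 a1] := alpha01.
have [t0 t00 lt0] := slowly_varying_ratio_bounded hl.
have Mb0 : 0 < Mb by have /andP[b0 /(lt_le_trans b0)] := bP 0%N.
pose A := (J%:R * Mb + K1) * C2 / C1.
have A0 : 0 <= A.
  by rewrite divr_ge0 ?(ltW C10)// mulr_ge0 ?(ltW C20)// addr_ge0// mulr_ge0// ltW.
exists (8 * (2 * A) + 1); first by rewrite ltr_wpDl// mulr_ge0// mulr_ge0.
move=> e e0 ec et; have [N _ HN] := bge.
have etA (B : R) : \forall n \near \oo, B <= e n * n%:R by move: B; apply/cvgryPge.
near=> n.
have n0 : (0 < n)%N by near: n; exact: nbhs_infty_gt.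
have nR : 0 < n%:R :> R by rewrite ltr0n.
have tt0 : t0 <= e n * n%:R by near: n; exact: etA.
have tN : N%:R <= e n * n%:R by near: n; exact: etA.
have tJ : J%:R <= e n * n%:R by near: n; exact: etA.
have e4 : e n <= 1 / 4 by near: n; apply: (cvgr_le _ ec); rewrite divr_gt0.
have nJ : (4 * J <= n)%N by near: n; exact: nbhs_infty_ge.
have Wn : W n <= C2 * rho n by near: n.
set t := e n * n%:R in tt0 tN tJ *.
have tp : 0 < t by rewrite mulr_gt0.
set m := Num.trunc t; set s := (m + J)%N.
have mt : m%:R <= t by rewrite truncn_le// ltW.
have tm : t < m.+1%:R by exact: truncnS_gt.
have ts : t <= s%:R.
  by apply: (le_trans (ltW tm)); rewrite ler_nat /s -addn1 leq_add2l.
have s2t : s%:R <= 2 * t.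
  by rewrite /s natrD (_ : 2 * t = t + t) ?lerD//; ring.
have sN : (N <= s)%N by rewrite -(ler_nat R) (le_trans tN).
have s0 : (0 < s)%N by rewrite /s addn_gt0 J0 orbT.
have sR : 0 < s%:R :> R by rewrite ltr0n.
have nm : (4 * m <= n)%N.
  rewrite -(ler_nat R) natrM; apply: (@le_trans _ _ (4 * t)).
    by rewrite ler_wpM2l.
  rewrite /t mulrA -[leRHS]mul1r ler_wpM2r ?ler0n//.
  by rewrite mulrC -ler_pdivlMr.
have bs := HN s sN; have /andP[bs0 bsM] := bP s.
have rs := reg_var_gt0 s0; have rn := reg_var_gt0 n0.
have ls := lpos sR; have ln := lpos nR.
have X1 : n%:R / 2 * X m n <= A * (s%:R / rho s) * rho n.
  have [X0|/ltW X0] := leP 0 (X m n); last first.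
    apply: (@le_trans _ _ 0).
      by rewrite mulr_ge0_le0 ?divr_ge0.
    by rewrite mulr_ge0 ?(ltW rn)// mulr_ge0// divr_ge0// ltW.
  apply: (le_trans (ler_wpM2r X0 (half_le_sub nJ nm))).
  apply: (le_trans (XP m n)); rewrite -/s.
  apply: (@le_trans _ _ ((J%:R * Mb + K1) / b s * (C2 * rho n))).
    apply: ler_pM => //; first by rewrite addr_ge0// divr_ge0// ltW.
    by rewrite mulrDl lerD2r ler_pdivlMr// ler_wpM2l.
  rewrite (_ : A * _ * _ = (J%:R * Mb + K1) * (C1 * (rho s / s%:R))^-1 * (C2 * rho n)).
    apply: ler_wpM2r; first by rewrite mulr_ge0// ltW.
    apply: ler_wpM2l; first by rewrite addr_ge0// mulr_ge0// ltW.
    by rewrite lef_pV2 ?posrE// mulr_gt0// divr_gt0.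
  by rewrite /A; field; rewrite !gt_eqF.
have X2 : X m n <= 2 * A * (s%:R `^ alpha / l s%:R) / (n%:R `^ alpha / l n%:R).
  rewrite -!rho_div//.
  rewrite [leRHS](_ : _ = 2 * (A * (s%:R / rho s) * rho n) / n%:R); last first.
    by field; rewrite !gt_eqF.
  rewrite ler_pdivlMr// (_ : X m n * n%:R = 2 * (n%:R / 2 * X m n)).
    by rewrite ler_wpM2l.
  by field.
have en := powR_gt0 alpha (e0 n).
apply: (le_trans (ler_wpM2l _ X2)).
  by rewrite divr_ge0 ?mulr_ge0 ?(ltW en) ?(ltW ln) ?(ltW (lpos tp)).
apply: (@le_trans _ _ (8 * (2 * A))); last by rewrite lerDl.
apply: scale_cancel => //; first by rewrite mulr_ge0.
- by rewrite ts.
- have := lt0 t (s%:R / t) tt0; rewrite divfK ?gt_eqF//; apply.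
  by rewrite ler_pdivlMr// mul1r ts ler_pdivrMr.
Unshelve. all: by end_near. Qed.

Lemma visits_limsup (X : nat -> nat -> R) (W QY a : nat -> R) (J : nat)
    (C2 C3 Gam : R) :
  0 < C2 -> 0 < C3 -> 0 < Gam ->
  (forall N n, n.+1%:R * X N (n + J)%N <= J%:R * (N.+1%:R * W n)) ->
  (forall n, 0 <= W n) -> (forall m n, (m <= n)%N -> W m <= W n) ->
  (\forall n \near \oo, W n <= C2 * rho n) ->
  (\forall n \near \oo, C3 * rho n <= QY n) ->
  (forall n, a n = n%:R / (Gam * QY n)) ->
  exists2 C, 0 < C & forall e : nat -> R, (forall n, 0 < e n) ->
    e n * a n @[n --> \oo] --> +oo ->
    \forall n \near \oo, 1 / e n * X (Num.trunc (e n * a n)) n <= C.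
Proof.
move=> C20 C30 G0 XP W0 Wmon Wle Qge aE.
pose A := 4 * J%:R * C2 / (Gam * C3).
have A0 : 0 <= A by rewrite divr_ge0 ?mulr_ge0// ltW.
exists (A + 1); first by rewrite ltr_wpDl.
move=> e e0 ea.
have eaA (B : R) : \forall n \near \oo, B <= e n * a n by move: B; apply/cvgryPge.
near=> n.
have n0 : (0 < n)%N by near: n; exact: nbhs_infty_gt.
have nR : 0 < n%:R :> R by rewrite ltr0n.
have rn := reg_var_gt0 n0.
have nJ : (4 * J <= n)%N by near: n; exact: nbhs_infty_ge.
have Wn : W n <= C2 * rho n by near: n.
have Qn : C3 * rho n <= QY n by near: n.
have Q0 : 0 < QY n by apply: lt_le_trans Qn; rewrite mulr_gt0.
have ea1 : 1 <= e n * a n by near: n; exact: eaA.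
set N := Num.trunc (e n * a n).
have Na : N.+1%:R <= 2 * (e n * a n).
  rewrite -addn1 natrD (_ : 2 * (e n * a n) = e n * a n + e n * a n); last by ring.
  by rewrite lerD// truncn_le// (le_trans ler01).
have Jn : (J <= n)%N by apply: leq_trans nJ; rewrite leq_pmull.
have := XP N (n - J)%N; rewrite subnK// => XN.
have h : n%:R / 2 <= (n - J).+1%:R :> R.
  by have := half_le_sub (m := 0) nJ (leq0n n); rewrite subn0 subSn.
have X1 : n%:R / 2 * X N n <= J%:R * (2 * (e n * a n) * (C2 * rho n)).
  have [X0|/ltW X0] := leP 0 (X N n); last first.
    apply: (@le_trans _ _ 0); first by rewrite mulr_ge0_le0 ?divr_ge0.
    have ea0 : 0 <= e n * a n by exact: le_trans ler01 ea1.
    by apply: mulr_ge0 => //; apply: mulr_ge0; [exact: mulr_ge0|exact/ltW/mulr_gt0].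
  apply: (le_trans (ler_wpM2r X0 h)); apply: (le_trans XN).
  rewrite ler_wpM2l//; apply: ler_pM => //.
  by apply: le_trans Wn; apply: Wmon; exact: leq_subr.
apply: (@le_trans _ _ A); last by rewrite lerDl.
rewrite mul1r mulrC ler_pdivrMr// -(ler_pM2l (_ : 0 < n%:R / 2))//; last by rewrite divr_gt0.
apply: (le_trans X1).
rewrite (_ : J%:R * _ = 2 * J%:R * C2 * e n * rho n * a n); last by ring.
rewrite (_ : n%:R / 2 * _ = 2 * J%:R * C2 * e n * rho n * (n%:R / (Gam * (C3 * rho n)))).
  apply: ler_wpM2l; last rewrite aE.
    by rewrite mulr_ge0 ?(ltW rn)// mulr_ge0 ?(ltW (e0 n))// mulr_ge0// ltW.
  have h1 : 0 < Gam * QY n by exact: mulr_gt0.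
  have h2 : 0 < Gam * (C3 * rho n) by rewrite mulr_gt0// mulr_gt0.
  rewrite ler_wpM2l// lef_pV2 ?posrE//.
  by rewrite ler_wpM2l// ltW.
by rewrite /A; field; rewrite !gt_eqF.
Unshelve. all: by end_near. Qed.

End regular_variation.

(** * Upper limits and bounded weights *)

Lemma limn_esup_le (R : realType) (u : nat -> \bar R) (C : \bar R) :
  (\forall n \near \oo, (u n <= C)%E) -> (limn_esup u <= C)%E.
Proof.
move=> H; apply: (@le_trans _ _ (ereal_sup (u @` [set n | (u n <= C)%E]))).
  by apply: ereal_inf_lbound; exists [set n | (u n <= C)%E].
by apply: ge_ereal_sup => _ [n /= un <-].
Qed.

Lemma weighted_bounded (R : realType)
    (mu : {measure set (measurableTypeR R) -> \bar R})
    (G : measurableTypeR R -> R) (E : set (measurableTypeR R)) :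
  measurable E -> G \in Lfun mu +oo%E -> {ae mu, forall x, 0 <= G x} ->
  {ae mu, forall x, ~ E x -> G x = 0} ->
  exists2 M, 0 < M & forall X : set (measurableTypeR R), measurable X ->
    (weighted mu G X <= M%:E * mu (X `&` E))%E.
Proof.
move=> mE GL G0 GE.
have mG : measurable_fun setT G by have := sub_Lfun_mfun GL; rewrite inE.
have [M M0 GM] : exists2 M, 0 < M & {ae mu, forall x, `|G x| <= M}.
  have := sub_Lfun_finLfun GL; rewrite inE /= /finite_norm unlock /=.
  case: ifPn => [_|mu0 _]; last first.
    exists 1 => //; exists setT; split => //.
    by apply/eqP; rewrite eq_le measure_ge0 andbT leNgt.
  move=> /ess_supr_bounded[M HM]; exists (`|M| + 1); first by rewrite ltr_pwDr.
  near=> x; apply: (@le_trans _ _ M); last by rewrite (le_trans (ler_norm _))// lerDl.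
  by near: x.
exists M => // X mX; rewrite /weighted.
have mGX : measurable_fun X (fun x => (`|G x|)%:E).
  apply/measurable_EFinP; apply: measurableT_comp => //.
  exact: measurable_funTS.
have -> : (\int[mu]_(x in X) (G x)%:E = \int[mu]_(x in X) (`|G x|)%:E)%E.
  apply: ae_eq_integral => //.
    by apply/measurable_EFinP; exact: measurable_funTS.
  by near=> x => _; rewrite ger0_norm//; near: x.
have -> : (M%:E * mu (X `&` E) = \int[mu]_(x in X) (M%:E * (\1_E x)%:E))%E.
  rewrite ge0_integralZl//; last 2 first.
  - by apply/measurable_EFinP; exact: measurable_indic.
  - by rewrite lee_fin ltW.
  by rewrite integral_indic// setIC.
apply: ae_ge0_le_integral => //.
- by move=> x _; rewrite -EFinM lee_fin mulr_ge0// ltW.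
- by apply: measurable_funeM; apply/measurable_EFinP; exact: measurable_indic.
- near=> x => _; rewrite -EFinM lee_fin indicE.
  have [xE|xE] := boolP (x \in E); first by rewrite mulr1; near: x.
  have -> : G x = 0 by move: (xE); rewrite notin_setE; near: x.
  by rewrite normr0 mulr0.
Unshelve. all: by end_near. Qed.

(** * The invariant density *)

Section density.
Context (R : realType) (c : R) (T : R -> R) (g f : bool -> R -> R) (M1 M : R).
Context (S : two_branches c T g f M1 M) (h0 : R -> R).
Context (h0_cont : {within `[0, 1]%classic, continuous h0}).
Context (h0_pos : {in `[0, 1], forall x, 0 < h0 x}).

Let h := thaler_density h0 (f false) (f true).

Lemma f_lipschitz b x y : 0 <= x <= 1 -> 0 <= y <= 1 ->
  `|f b x - f b y| <= `|x - y|.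
Proof.
have H x' y' : 0 <= x' <= 1 -> 0 <= y' <= 1 -> x' < y' ->
    `|f b x' - f b y'| <= `|x' - y'|.
  move=> x01 y01 xy; have fxy : f b x' < f b y' by rewrite (f_ltE S).
  have /andP[l _] := f_itv S b x01; have /andP[_ r] := f_itv S b y01.
  have := tb_expand S l fxy r; rewrite !(fK S)// => /ltW.
  by rewrite !ltr0_norm ?subr_lt0// !opprB.
move=> x01 y01; have [xy|yx|->] := ltgtP x y; last by rewrite !subrr.
- exact: H.
- by rewrite distrC (distrC x); exact: H.
Qed.

Lemma f_within_continuous b : {within `[0, 1]%classic, continuous (f b)}.
Proof.
apply/subspace_continuousP => x; rewrite /= in_itv/= => x01.
apply/cvgrPdist_le => e e0; rewrite near_withinE; apply/nbhs_ballP.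
exists e => // y; rewrite /ball/= in_itv/= => xy y01.
exact: le_trans (f_lipschitz b x01 y01) (ltW xy).
Qed.

(** The denominator of the density.  As inverse branches are contractions that fix
    the endpoints, it is at most [x * (1 - x)], whence a lower bound for the
    density, and it is bounded below away from the endpoints. *)
Let den x := (x - f false x) * (f true x - x).

Lemma den_bounds x : 0 < x < 1 -> 0 < den x <= x * (1 - x).
Proof.
move=> /andP[x0 x1]; have x01 : 0 <= x <= 1 by rewrite !ltW.
have /andP[l0 r0] := f_itv S false x01; have /andP[l1 r1] := f_itv S true x01.
have fx0 : 0 < f false x by apply: (f_lo S false); rewrite x0 ltW.
have fx1 : f true x < 1 by apply: (f_hi S true); rewrite x1 ltW.
have := tb_expand S (b := false) (lexx _) fx0 r0.
have := tb_expand S (b := true) l1 fx1 (lexx _).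
rewrite !(fK S)// (tb_lo S false) (tb_hi S true) /= => e1 e0.
apply/andP; split; first by rewrite mulr_gt0// subr_gt0; lra.
by apply: ler_pM; rewrite ?subr_ge0; lra.
Qed.

Lemma density_ge : exists2 eta, 0 < eta & forall x, 0 < x < 1 -> eta <= h x.
Proof.
have [p pin Hp] := EVT_min ler01 h0_cont.
exists (h0 p); first exact: h0_pos.
move=> x x01; have /andP[d0 d1] := den_bounds x01; have /andP[x0 x1] := x01.
have xin : x \in `[0, 1] by rewrite in_itv/= !ltW.
apply: (le_trans (Hp _ xin)); rewrite /h /thaler_density -/(den x).
rewrite ler_peMr//; first exact/ltW/h0_pos.
by rewrite ler_pdivlMr// mul1r.
Qed.

Lemma density_le u v : 0 < u -> v < 1 -> exists2 H, 0 < H &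
  forall x, u <= x <= v -> h x <= H.
Proof.
move=> u0 v1; have [uv|vu] := leP u v; last first.
  by exists 1 => // x /andP[ux /(le_trans ux)]; rewrite leNgt vu.
have [p pin Hp] := EVT_max ler01 h0_cont.
have u1 : u < 1 by exact: le_lt_trans v1.
have v0 : 0 < v by exact: lt_le_trans uv.
have fu : 0 < u - f false u.
  have ui : 0 <= u <= 1 by rewrite !ltW.
  have fu0 : 0 < f false u by apply: (f_lo S false); rewrite u0 ltW.
  have /andP[_ r0] := f_itv S false ui.
  have := tb_expand S (b := false) (lexx _) fu0 r0.
  by rewrite !(fK S)// (tb_lo S false) /=; lra.
have fv : 0 < f true v - v.
  have vi : 0 <= v <= 1 by rewrite !ltW.
  have fv1 : f true v < 1 by apply: (f_hi S true); rewrite v1 ltW.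
  have /andP[l1 _] := f_itv S true vi.
  have := tb_expand S (b := true) l1 fv1 (lexx _).
  by rewrite !(fK S)// (tb_hi S true) /=; lra.
have m0 : 0 < (u - f false u) * (f true v - v) by exact: mulr_gt0.
exists (h0 p / ((u - f false u) * (f true v - v))).
  by rewrite divr_gt0// h0_pos.
move=> x /andP[ux xv].
have x0 : 0 < x by exact: lt_le_trans ux.
have x1 : x < 1 by exact: le_lt_trans v1.
have x01 : 0 < x < 1 by rewrite x0.
have xi : 0 <= x <= 1 by rewrite !ltW.
have xin : x \in `[0, 1] by rewrite in_itv.
have /andP[d0 _] := den_bounds x01.
have ui : 0 <= u <= 1 by rewrite !ltW.
have vi : 0 <= v <= 1 by rewrite !ltW.
have mon b y z : 0 <= y <= 1 -> 0 <= z <= 1 -> y <= z -> f b z - f b y <= z - y.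
  move=> y01 z01 yz; have := f_lipschitz b z01 y01.
  have fyz : f b y <= f b z by rewrite (f_leE S).
  by rewrite !ger0_norm// subr_ge0.
have dle : (u - f false u) * (f true v - v) <= den x.
  have := mon false u x ui xi ux; have := mon true x v xi vi xv => m1 m2.
  by rewrite /den; apply: ler_pM; [exact: ltW|exact: ltW| |]; lra.
rewrite /h /thaler_density -/(den x); apply: ler_pM.
- exact/ltW/h0_pos.
- by apply: divr_ge0; [rewrite mulr_ge0 ?subr_ge0 ?(ltW x0) ?(ltW x1)|exact: ltW].
- exact: Hp.
- rewrite ler_pdivrMr// [leRHS]mulrC ler_pdivlMr//; apply: le_trans dle.
  by rewrite ler_piMl ?(ltW m0)// mulr_ile1 ?subr_ge0 ?(ltW x1) ?(ltW x0)//; lra.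
Qed.

Lemma measurable_density : measurable_fun (`]0, 1[%classic : set (measurableTypeR R)) h.
Proof.
have m01 (k : R -> R) : {within `[0, 1]%classic, continuous k} ->
    measurable_fun (`]0, 1[%classic : set (measurableTypeR R)) k.
  move=> kc; apply: (@measurable_funS _ _ _ _ (`[0, 1]%classic : set (measurableTypeR R))).
  - exact: measurable_itv.
  - by move=> x /=; rewrite !in_itv/= => /andP[? ?]; rewrite !ltW.
  - by apply: subspace_continuous_measurable_fun => //; exact: measurable_itv.
have mden : measurable_fun (`]0, 1[%classic : set (measurableTypeR R)) den.
  have mf b : measurable_fun (`]0, 1[%classic : set (measurableTypeR R)) (f b).
    by apply: m01; exact: f_within_continuous.
  apply: measurable_funM; apply: measurable_funB => //; exact: mf.
apply: (@eq_measurable_fun _ _ _ _ _ (fun x => h0 x * (x * (1 - x) * den x `^ (-1)))).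
  move=> x; rewrite inE /= in_itv/= => x01; have /andP[d0 _] := den_bounds x01.
  by rewrite powR_inv1 ?(ltW d0).
apply: measurable_funM; first exact: m01.
apply: measurable_funM.
  by apply: measurable_funM => //; exact: measurable_funB.
by apply: (measurableT_comp (measurable_powR _)).
Qed.

Context (mu : {measure set (measurableTypeR R) -> \bar R}).
Context (mu_dens : has_density01 mu h).

Let mh (A : set (measurableTypeR R)) : measurable A -> A `<=` `]0, 1[%classic ->
  measurable_fun A (fun x => (h x)%:E).
Proof.
move=> mA A01; apply/measurable_EFinP.
by apply: measurable_funS A01 measurable_density; exact: measurable_itv.
Qed.

Let h_ge0 x : 0 < x < 1 -> 0 <= h x.
Proof. by have [eta e0 H] := density_ge => /H; apply: le_trans; exact: ltW. Qed.

Let lebesgue_oo (x y : R) : x < y ->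
  lebesgue_measure (`]x, y[%classic : set (measurableTypeR R)) = (y - x)%:E.
Proof. by move=> xy; rewrite lebesgue_measure_itv/= lte_fin xy EFinB. Qed.

Let mu_oo x y : 0 < x -> y < 1 ->
  mu `]x, y[%classic = (\int[lebesgue_measure]_(z in `]x, y[%classic) (h z)%:E)%E.
Proof.
move=> x0 y1; rewrite mu_dens; last exact: measurable_itv.
rewrite (setIidl (A := `]x, y[%classic))// => z /=; rewrite !in_itv/= => /andP[xz zy].
by rewrite (lt_trans x0 xz) (lt_trans zy).
Qed.

Lemma density_mu_ge : exists2 eta, 0 < eta & forall x y, 0 < x -> x < y -> y < 1 ->
  ((eta * (y - x))%:E <= mu `]x, y[%classic)%E.
Proof.
have [eta e0 H] := density_ge; exists eta => // x y x0 xy y1; rewrite mu_oo//.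
have sub z : z \in `]x, y[ -> 0 < z < 1.
  by rewrite in_itv/= => /andP[xz zy]; rewrite (lt_trans x0 xz) (lt_trans zy).
have -> : (eta * (y - x))%:E =
    (\int[lebesgue_measure]_(z in `]x, y[%classic) (cst eta%:E) z)%E.
  rewrite integral_cst; last exact: measurable_itv.
  by rewrite EFinM; congr (_ * _)%E; exact/esym/lebesgue_oo.
apply: ge0_le_integral; first exact: measurable_itv.
- by move=> z _; rewrite lee_fin ltW.
- exact: measurable_cst.
- by apply: mh; [exact: measurable_itv|move=> z /sub; rewrite /= in_itv].
- by move=> z /sub z01; rewrite lee_fin H.
Qed.

Lemma density_mu_le u v : 0 < u -> v < 1 -> exists2 H, 0 < H &
  forall x y, u <= x -> x < y -> y <= v ->
  (mu `]x, y[%classic <= (H * (y - x))%:E)%E.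
Proof.
move=> u0 v1; have [H H0 hH] := density_le u0 v1; exists H => // x y ux xy yv.
have x0 : 0 < x by exact: lt_le_trans ux.
have y1 : y < 1 by exact: le_lt_trans v1.
rewrite mu_oo//.
have sub z : z \in `]x, y[ -> 0 < z < 1.
  by rewrite in_itv/= => /andP[xz zy]; rewrite (lt_trans x0 xz) (lt_trans zy).
have -> : (H * (y - x))%:E =
    (\int[lebesgue_measure]_(z in `]x, y[%classic) (cst H%:E) z)%E.
  rewrite integral_cst; last exact: measurable_itv.
  by rewrite EFinM; congr (_ * _)%E; exact/esym/lebesgue_oo.
apply: ge0_le_integral; first exact: measurable_itv.
- by move=> z /sub z01; rewrite lee_fin h_ge0.
- by apply: mh; [exact: measurable_itv|move=> z /sub; rewrite /= in_itv].
- exact: measurable_cst.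
- move=> z /=; rewrite in_itv/= => /andP[xz zy]; rewrite lee_fin hH//.
  by rewrite (le_trans ux (ltW xz)) (le_trans (ltW zy)).
Qed.

Lemma density_mu_pt x : mu [set x] = 0%E.
Proof.
rewrite mu_dens; last exact: measurable_set1.
have mI : measurable ([set x] `&` `]0, 1[%classic : set (measurableTypeR R)).
  by apply: measurableI; [exact: measurable_set1|exact: measurable_itv].
apply: null_set_integral => //; first exact: mh.
apply: (subset_measure0 mI (measurable_set1 x)) => //.
exact: lebesgue_measure_set1.
Qed.

Lemma density_mu_out : mu (~` `[0, 1]%classic) = 0%E.
Proof.
rewrite mu_dens; last by apply: measurableC; exact: measurable_itv.
rewrite (_ : _ `&` _ = set0) ?integral_set0//.
rewrite -subset0 => x [/= n01]; rewrite in_itv/= => /andP[x0 x1].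
by apply: n01; rewrite /= in_itv/= !ltW.
Qed.

Lemma density_mu_fin x y : 0 < x -> y < 1 -> (mu `[x, y]%classic < +oo)%E.
Proof.
move=> x0 y1; have [xy|yx] := leP x y; last first.
  by rewrite set_itv_ge ?measure0 ?ltry// bnd_simp -ltNge.
pose u := x / 2; pose v := (y + 1) / 2.
have u0 : 0 < u by rewrite divr_gt0.
have ux : u < x by rewrite /u; lra.
have v1 : v < 1 by rewrite /v; lra.
have yv : y < v by rewrite /v; lra.
have [H H0 muH] := density_mu_le u0 v1.
have uv : u < v by apply: lt_trans ux (le_lt_trans xy yv).
apply: le_lt_trans (ltry (H * (v - u))); apply: le_trans (muH _ _ (lexx _) uv (lexx _)).
apply: le_measure; rewrite ?inE; [exact: measurable_itv|exact: measurable_itv|].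
move=> z /=; rewrite !in_itv/= => /andP[xz zy].
by rewrite (lt_le_trans ux xz) (le_lt_trans zy).
Qed.

End density.

(** * Thaler maps as maps with two branches *)

(** The values of [T] outside of [[0, 1]] are arbitrary, so they are replaced by
    those of the identity in order to get a map that preserves [[0, 1]] and its
    complement. *)
Definition unit_ext (R : realType) (T : R -> R) (x : R) : R :=
  if 0 <= x <= 1 then T x else x.

Section thaler.
Context (R : realType) (T : R -> R) (c : R) (T0 T1 : R -> R) (p a : R).
Context (lstar : R -> R) (hT : thaler_map T c T0 T1 p a lstar).

Let c0 : 0 < c. Proof. by have := thaler_c hT; rewrite in_itv/= => /andP[]. Qed.
Let c1 : c < 1. Proof. by have := thaler_c hT; rewrite in_itv/= => /andP[]. Qed.

Lemma unit_ext_self x : 0 <= x <= 1 -> 0 <= unit_ext T x <= 1.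
Proof.
by move=> x01; rewrite /unit_ext x01; have := thaler_self hT; move=> /(_ x); rewrite !in_itv; exact.
Qed.

Lemma iter_unit_ext k x : 0 <= x <= 1 -> iter k (unit_ext T) x = iter k T x /\
  0 <= iter k T x <= 1.
Proof.
move=> x01; elim: k => //= k [-> k01]; split; first by rewrite /unit_ext k01.
by rewrite -[X in _ <= X <= _](_ : unit_ext T (iter k T x) = _) ?unit_ext_self// /unit_ext k01.
Qed.

Lemma thaler_two_branches f0 f1 :
  inverse_branch `[0, c]%classic T0 f0 -> inverse_branch `[c, 1]%classic T1 f1 ->
  exists M1 M, two_branches c (unit_ext T) (fun b => if b then T1 else T0)
    (fun b => if b then f1 else f0) M1 M.
Proof.
move=> hf0 hf1.
have d0 x : 0 < x < c -> 1 < derive_on `[0, c]%classic T0 x.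
  by move=> /andP[x0 xc]; apply: (thaler_d0 hT); rewrite in_itv/= x0 ltW.
have d1 x : c < x < 1 -> 1 < derive_on `[c, 1]%classic T1 x.
  by move=> /andP[x0 xc]; apply: (thaler_d1 hT); rewrite in_itv/= xc ltW.
have [e0 [M10 [M0 [M101 M00 lip0 dist0]]]] :=
  expanding_branch c0 (thaler_C2_0 hT) d0.
have [e1 [M11 [M1' [M111 M10' lip1 dist1]]]] :=
  expanding_branch c1 (thaler_C2_1 hT) d1.
exists (M10 + M11), (M0 + M1').
have inv0 y : 0 <= y <= 1 -> 0 <= f0 y <= c /\ T0 (f0 y) = y.
  by move=> y01; have := hf0 y; rewrite !in_itv/= => /(_ y01).
have inv1 y : 0 <= y <= 1 -> c <= f1 y <= 1 /\ T1 (f1 y) = y.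
  by move=> y01; have := hf1 y; rewrite !in_itv/= => /(_ y01).
have ran0 x : 0 <= x <= c -> 0 <= T0 x <= 1.
  by move=> xin; have := thaler_ran0 hT; move=> /(_ x); rewrite !in_itv; exact.
have ran1 x : c <= x <= 1 -> 0 <= T1 x <= 1.
  by move=> xin; have := thaler_ran1 hT; move=> /(_ x); rewrite !in_itv; exact.
have o01 : (0 <= 1 :> R) && (1 <= 1 :> R) by rewrite ler01 /=.
have zz : (0 <= 0 :> R) && (0 <= 1 :> R) by rewrite ler01 /= lexx.
have T00 : T0 0 = 0.
  have [/andP[l h] E] := inv0 0 zz.
  move: l; rewrite le_eqVlt => /orP[/eqP {1}->//|lt].
  have := e0 _ _ (lexx 0) lt h; have /andP[+ _] : 0 <= T0 0 <= 1.
    by apply: ran0; rewrite lexx ltW.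
  by rewrite E; lra.
have T0c : T0 c = 1.
  have [/andP[l h] E] := inv0 1 o01.
  move: h; rewrite le_eqVlt => /orP[/eqP {1}<-//|lt].
  have := e0 _ _ l lt (lexx _); have /andP[_ +] : 0 <= T0 c <= 1.
    by apply: ran0; rewrite lexx ltW.
  by rewrite E; lra.
have T1c : T1 c = 0.
  have [/andP[l h] E] := inv1 0 zz.
  move: l; rewrite le_eqVlt => /orP[/eqP {1}->//|lt].
  have := e1 _ _ (lexx c) lt h; have /andP[+ _] : 0 <= T1 c <= 1.
    by apply: ran1; rewrite lexx ltW.
  by rewrite E; lra.
have T11 : T1 1 = 1.
  have [/andP[l h] E] := inv1 1 o01.
  move: h; rewrite le_eqVlt => /orP[/eqP {1}<-//|lt].
  have := e1 _ _ l lt (lexx _); have /andP[_ +] : 0 <= T1 1 <= 1.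
    by apply: ran1; rewrite lexx ltW.
  by rewrite E; lra.
split.
- by rewrite c0.
- by rewrite -[leLHS]addr0 lerD// (le_trans ler01).
- exact: addr_ge0.
- by case; [exact: e1|exact: e0].
- case=> x y lx xy yh /=.
    apply: (le_trans (lip1 x y lx xy yh)); rewrite ler_wpM2r ?lerDr ?subr_ge0 ?(ltW xy)//.
    exact: le_trans M101.
  apply: (le_trans (lip0 x y lx xy yh)); rewrite ler_wpM2r ?lerDl ?subr_ge0 ?(ltW xy)//.
  exact: le_trans M111.
- case=> s t x y x' y' ls ht sx xy yt sx' xy' yt' /=.
    apply: (le_trans (dist1 s t x y x' y' ls ht sx xy yt sx' xy' yt')).
    apply: ler_wpM2r; last first.
      by rewrite lerD2l ler_wpM2r ?lerDr// subr_ge0 (le_trans sx)// (le_trans (ltW xy)).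
    have ux' : c <= x' by exact: le_trans sx'.
    have yv' : y' <= 1 by exact: le_trans ht.
    have := e1 _ _ ux' xy' yv' => lt.
    by rewrite mulr_ge0 ?subr_ge0 ?(ltW xy)// -subr_ge0 (le_trans _ (ltW lt))// subr_ge0 ltW.
  apply: (le_trans (dist0 s t x y x' y' ls ht sx xy yt sx' xy' yt')).
  apply: ler_wpM2r; last first.
    by rewrite lerD2l ler_wpM2r ?lerDl// subr_ge0 (le_trans sx)// (le_trans (ltW xy)).
  have ux' : 0 <= x' by exact: le_trans sx'.
  have yv' : y' <= c by exact: le_trans ht.
  have := e0 _ _ ux' xy' yv' => lt.
  by rewrite mulr_ge0 ?subr_ge0 ?(ltW xy)// -subr_ge0 (le_trans _ (ltW lt))// subr_ge0 ltW.
- by case=> y y01 /=; [exact: inv1|exact: inv0].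
- move=> x /andP[x0 xc]; rewrite /unit_ext x0 (le_trans (ltW xc) (ltW c1)) /=.
  by rewrite (thaler_ext0 hT)// in_itv/= x0.
- move=> x /andP[cx x1]; rewrite /unit_ext x1 (le_trans (ltW c0) (ltW cx)) /=.
  by rewrite (thaler_ext1 hT)// in_itv/= cx.
- by case.
- by case.
- by apply: unit_ext_self; rewrite !ltW.
- by move=> x n01; rewrite /unit_ext ifN//; exact/negP.
Qed.

Lemma measurable_unit_ext :
  measurable_fun setT (unit_ext T : measurableTypeR R -> measurableTypeR R).
Proof.
have cont0 : {within `[0, c]%classic, continuous T0}.
  by apply: derivable_on_within_continuous; case: (thaler_C2_0 hT).
have cont1 : {within `[c, 1]%classic, continuous T1}.
  by apply: derivable_on_within_continuous; case: (thaler_C2_1 hT).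
have m0 : measurable_fun (`[0, c]%classic : set (measurableTypeR R)) T0.
  by apply: subspace_continuous_measurable_fun => //; exact: measurable_itv.
have m1 : measurable_fun (`[c, 1]%classic : set (measurableTypeR R)) T1.
  by apply: subspace_continuous_measurable_fun => //; exact: measurable_itv.
move=> _ B mB; rewrite setTI.
have -> : unit_ext T @^-1` B =
   (`[0, c[%classic `&` (`[0, c]%classic `&` T0 @^-1` B)) `|`
   (`]c, 1]%classic `&` (`[c, 1]%classic `&` T1 @^-1` B)) `|`
   ([set c] `&` (if T c \in B then setT else set0)) `|`
   (~` `[0, 1]%classic `&` B).
  apply/seteqP; split => x.
    rewrite /= /unit_ext; case: ifP => [/andP[x0 x1]|n01] Bx; last first.
      by right; split => //; rewrite /= in_itv/= n01.
    left; have [xc|cx|xc] := ltgtP x c.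
    - left; left; rewrite /= !in_itv/= x0 xc ltW//; split => //; split => //.
      by rewrite (thaler_ext0 hT)// in_itv/= x0.
    - left; right; rewrite /= !in_itv/= x1 cx ltW//; split => //; split => //.
      by rewrite (thaler_ext1 hT)// in_itv/= cx.
    - by right; split => //; rewrite -xc mem_set.
  rewrite /= /unit_ext !in_itv/=.
  move=> [[[[/andP[x0 xc] [_ Bx]]|[/andP[cx x1] [_ Bx]]]|[-> Bx]]|[n01 Bx]].
  - rewrite x0 (le_trans (ltW xc) (ltW c1)) /=.
    by rewrite -(thaler_ext0 hT)// in_itv/= x0.
  - rewrite x1 (le_trans (ltW c0) (ltW cx)) /=.
    by rewrite -(thaler_ext1 hT)// in_itv/= cx.
  - by rewrite !ltW//=; move: Bx; case: ifP => // /set_mem.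
  - by case: ifP => // /n01.
apply: measurableU; first apply: measurableU; first apply: measurableU.
- by apply: measurableI; [exact: measurable_itv|apply: m0 => //; exact: measurable_itv].
- by apply: measurableI; [exact: measurable_itv|apply: m1 => //; exact: measurable_itv].
- by apply: measurableI; [exact: measurable_set1|case: ifP].
- by apply: measurableI => //; apply: measurableC; exact: measurable_itv.
Qed.

Lemma unit_ext_preserving (mu : {measure set (measurableTypeR R) -> \bar R}) :
  preserves01 mu T -> mu (~` `[0, 1]%classic) = 0%E ->
  forall A : set (measurableTypeR R), measurable A ->
    mu (unit_ext T @^-1` A) = mu A.
Proof.
move=> inv out A mA; rewrite -(inv A mA).
have m01 : measurable (`[0, 1]%classic : set (measurableTypeR R)) by exact: measurable_itv.
have mp : measurable (unit_ext T @^-1` A : set (measurableTypeR R)).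
  by rewrite -[X in measurable X]setTI; exact: measurable_unit_ext.
have -> : `[0, 1]%classic `&` T @^-1` A = unit_ext T @^-1` A `&` `[0, 1]%classic.
  by apply/seteqP; split => x /=; rewrite in_itv/= /unit_ext => -[]; [move=> ->|move=> + x01; rewrite x01].
have mC : measurable (unit_ext T @^-1` A `\` `[0, 1]%classic : set (measurableTypeR R)).
  exact: measurableD.
rewrite -[in LHS](setUIDK (unit_ext T @^-1` A) `[0, 1]%classic).
rewrite measureU0//; first exact: measurableI.
apply/eqP; rewrite eq_le measure_ge0 andbT -out; apply: le_measure; rewrite ?inE//.
exact: measurableC.
Qed.

End thaler.

(** * Wandering rates, occupation times and last visits *)

Lemma hitting_timeE (R : realType) (T : R -> R) (Y : set R) n x :
  hitting_time T Y x = n.+1%:R%:E <->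
  Y (iter n.+1 T x) /\ forall j, (0 < j < n.+1)%N -> ~ Y (iter j T x).
Proof.
have attained k : (1 <= k)%N -> Y (iter k T x) ->
    (forall j, (0 < j < k)%N -> ~ Y (iter j T x)) -> hitting_time T Y x = k%:R%:E.
  move=> k1 Yk H; apply/eqP; rewrite eq_le; apply/andP; split.
    by apply: ereal_inf_lbound; exists k.
  apply: le_ereal_inf_tmp => _ [j [j1 Yj] <-]; rewrite lee_fin ler_nat leqNgt.
  by apply/negP => jk; apply: (H j) => //; rewrite j1.
split=> [E|[Yn H]]; last exact: attained.
have [[k [k1 Yk]]|none] := pselect (exists k, (1 <= k)%N /\ Y (iter k T x)); last first.
  move: E; rewrite /hitting_time (_ : [set _ | _ in _] = set0) ?ereal_inf0//.
  by rewrite -subset0 => y [k Hk _]; apply: none; exists k.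
have ex : exists k, (1 <= k)%N && `[< Y (iter k T x) >].
  by exists k; rewrite k1; apply/asboolP.
have [m /andP[m1 /asboolP Ym] mmin] := ex_minnP ex.
have mH j : (0 < j < m)%N -> ~ Y (iter j T x).
  move=> /andP[j0 jm] Yj; have := mmin j; rewrite j0 => /(_ (asboolT Yj)).
  by rewrite leqNgt jm.
have := attained m m1 Ym mH; rewrite E => -[] /eqP.
by rewrite eqr_nat => /eqP ->.
Qed.

Lemma last_visit_le (R : realType) (T : R -> R) (Y : set R) n m x :
  (last_visit T Y n x <= m)%N <->
  (forall k, (m < k <= n)%N -> ~ Y (iter k T x)).
Proof.
rewrite /last_visit; split.
  move=> /bigmax_leqP_seq H k /andP[mk kn] Yk.
  have := H k; rewrite mem_index_iota ltnS kn => /(_ isT (mem_set Yk)).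
  by rewrite leqNgt mk.
move=> H; apply/bigmax_leqP_seq => k; rewrite mem_index_iota ltnS => /andP[_ kn].
move=> /set_mem Yk; rewrite leqNgt; apply/negP => mk.
by apply: (H k) => //; rewrite mk.
Qed.

Lemma Gamma_ge0 (R : realType) (x : R) : 0 <= Gamma x.
Proof.
rewrite /Gamma /Rintegral fine_ge0//; apply: integral_ge0 => t _.
by rewrite lee_fin mulr_ge0 ?powR_ge0 ?expR_ge0.
Qed.

Section transfer.
Context (R : realType) (T : R -> R) (c : R) (T0 T1 : R -> R) (p a : R).
Context (lstar : R -> R) (hT : thaler_map T c T0 T1 p a lstar).
Context (g f : bool -> R -> R) (M1 M : R).
Let U := unit_ext T.
Context (S : two_branches c U g f M1 M).
Context (gam y0 y1 : R) (gam0 : 0 < gam) (gamc : gam < c).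
Context (cTg : c < U gam) (Tg1 : U gam < 1) (per : U (U gam) = gam).
Context (y00 : 0 < y0) (y0g : y0 <= gam) (gy1 : U gam <= y1) (y11 : y1 < 1).
Context (mu : {measure set (measurableTypeR R) -> \bar R}).
Context (mU : measurable_fun setT (U : measurableTypeR R -> measurableTypeR R)).
Context (Uinv : forall A : set (measurableTypeR R), measurable A ->
  mu (U @^-1` A) = mu A).
Context (mu_fin : forall x y, 0 < x -> y < 1 -> (mu `[x, y]%classic < +oo)%E).

Let Y : set (measurableTypeR R) := near y0 y1.
Let A b : set (measurableTypeR R) := far y0 y1 b.

Let mY : measurable Y. Proof. exact: measurable_itv. Qed.
Let mA b : measurable (A b).
Proof. by rewrite /A /far; case: b; exact: measurable_itv. Qed.
Let Yfin : (mu Y < +oo)%E. Proof. exact: mu_fin. Qed.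

Let iterU k x : 0 <= x <= 1 -> iter k U x = iter k T x.
Proof. by move=> x01; have [] := iter_unit_ext hT k x01. Qed.

Let stepA := far_step S gam0 gamc cTg Tg1 per y00 y0g gy1 y11.

Lemma layer_return_layer b n : layer T Y n.+1 `&` A b = return_layer U Y (A b) n.+1.
Proof.
apply/seteqP; split => x.
  move=> [[[x01 nYx] /hitting_timeE[Yn H]] Ax].
  have {}x01 : 0 <= x <= 1 by move: x01; rewrite /= in_itv.
  split; last by rewrite iterU.
  elim=> [//|j IH] jn; have [//|] := stepA (IH (ltnW jn)).
  rewrite -[U (iter j U x)]/(iter j.+1 U x) iterU// => Yj.
  by exfalso; apply: (H j.+1).
move=> [HA Yn]; have Ax : A b x by exact: (HA 0%N).
have x01 := far_unit S gamc cTg y00 y0g gy1 y11 Ax.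
split => //; split; first split.
- by rewrite /= in_itv.
- by move=> Yx; apply: (far_near_disj Ax).
- apply/hitting_timeE; split; first by rewrite -iterU.
  move=> j /andP[_ jn]; rewrite -iterU// => Yj.
  by apply: (far_near_disj (HA j jn)).
Qed.

Let layer_split n : layer T Y n.+1 = return_layer U Y (A false) n.+1 `|`
  return_layer U Y (A true) n.+1.
Proof.
rewrite -!layer_return_layer -setIUr; apply/esym/setIidl => x [[x01 nYx] _].
have {}x01 : 0 <= x <= 1 by move: x01; rewrite /= in_itv.
by have [Yx|Ax|Ax] := unit_cover y0 y1 x01; [|left|right].
Qed.

Lemma measurable_layer n : measurable (layer T Y n : set (measurableTypeR R)).
Proof.
case: n => [|n]; first exact: mY.
by rewrite layer_split; apply: measurableU; exact: (measurable_return_layer mU).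
Qed.

Lemma layer_le n : (mu (layer T Y n) <= mu Y)%E.
Proof.
rewrite -[leRHS](measure_iter mU Uinv n mY); apply: le_measure; rewrite ?inE.
- exact: measurable_layer.
- exact: (measurable_iter mU).
- by case: n => [//|n]; rewrite layer_split => x [] [].
Qed.

Let layer_fin n : (mu (layer T Y n) < +oo)%E.
Proof. exact: le_lt_trans (layer_le n) Yfin. Qed.

Lemma wandering_on_le b n : wandering_on mu T Y (A b) n <= wandering mu T Y n.
Proof.
apply: ler_sum => k _.
have mI : measurable (layer T Y k `&` A b : set (measurableTypeR R)).
  by apply: measurableI => //; exact: measurable_layer.
have le : (mu (layer T Y k `&` A b) <= mu (layer T Y k))%E.
  by apply: le_measure; rewrite ?inE//; exact: measurable_layer.
by apply: fine_le => //; rewrite ge0_fin_numE// (le_lt_trans le).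
Qed.

(** Keep the terms with [k < n] of the series, for which the exponential is at
    least [expR (- 1)].  The series converges since all layers have measure at
    most [mu Y]; this matters as the limit of a divergent series is a default
    value. *)
Lemma laplace_wandering_ge n : (0 < n)%N ->
  expR (- 1) * wandering mu T Y n <= laplace_wandering mu T Y n%:R^-1.
Proof.
move=> n0; have nR : 0 < n%:R :> R by rewrite ltr0n.
pose F k := expR (- (k%:R * n%:R^-1)) *
  (wandering mu T Y k.+1 - wandering mu T Y k).
have wS k : wandering mu T Y k.+1 - wandering mu T Y k = fine (mu (layer T Y k)).
  by rewrite /wandering big_nat_recr//= addrAC subrr add0r.
have F0 k : 0 <= F k by rewrite /F wS mulr_ge0 ?expR_ge0 ?fine_ge0.
pose z : R := expR (- n%:R^-1).
have FG k : F k <= geometric (fine (mu Y)) z k.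
  rewrite /F /geometric /= wS mulrC; apply: ler_pM => //.
  - by apply: fine_le; rewrite ?ge0_fin_numE ?layer_le.
  - by rewrite /z -expRM_natl mulrN.
have z1 : `|z| < 1.
  by rewrite ger0_norm ?expR_ge0// expR_lt1 oppr_lt0 invr_gt0.
have cF : cvgn (series F).
  apply: (series_le_cvg F0 _ FG).
    by move=> k; rewrite /geometric /= mulr_ge0 ?fine_ge0// exprn_ge0// expR_ge0.
  exact: is_cvg_geometric_series.
have ndF : nondecreasing_seq (series F).
  by apply/nondecreasing_seqP => k; rewrite /series /= big_nat_recr//= lerDl.
apply: le_trans (nondecreasing_cvgn_le ndF cF n).
rewrite /series /= /wandering mulr_sumr; apply: ler_sum_nat => k /andP[_ kn].
rewrite /F wS ler_wpM2r ?fine_ge0// ler_expR lerN2 ler_pdivrMr// mul1r ler_nat.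
exact: ltnW.
Qed.

Lemma occupation_count (B : set R) n x : 0 <= x <= 1 ->
  occupation T B n x = (\sum_(1 <= i < n.+1) (iter i U x \in B))%N%:R.
Proof.
move=> x01; rewrite /occupation natr_sum; apply: eq_bigr => i _.
by rewrite indicE iterU.
Qed.

Lemma occupation_event (B : set R) n (t : R) : 0 <= t ->
  [set x | (x \in `[0, 1]) /\ occupation T B n x <= t] =
  `[0, 1]%classic `&` few_visits (U : measurableTypeR R -> measurableTypeR R) B (Num.trunc t) n.
Proof.
move=> t0; apply/seteqP; split => x [/= x01].
  rewrite in_itv /= in x01; rewrite occupation_count// => Bt; split.
    by rewrite in_itv.
  by rewrite /few_visits /= -ltnS -(ltr_nat R) (le_lt_trans Bt)// truncnS_gt.
move=> fB; split => //; rewrite in_itv /= in x01; rewrite occupation_count//.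
by apply: le_trans (_ : (Num.trunc t)%:R <= _); [rewrite ler_nat|rewrite truncn_le].
Qed.

Lemma last_visit_event n m :
  [set x | (x \in `[0, 1]) /\ (last_visit T Y n x <= m)%N] =
  `[0, 1]%classic `&`
    \bigcap_(k in [set k | (m < k <= n)%N]) (iter k U @^-1` (~` Y)).
Proof.
apply/seteqP; split => x [/= x01].
  move=> /last_visit_le H; split => // k /= km; rewrite iterU; first exact: H.
  by rewrite in_itv in x01.
move=> H; split => //; apply/last_visit_le => k km; rewrite -iterU; first exact: H.
by rewrite in_itv in x01.
Qed.

(** After time [m] the orbit is on a single side, so that the visits to the
    far set of the other side all happen before. *)
Lemma last_visit_sojourn n m x : 0 <= x <= 1 -> (last_visit T Y n x <= m)%N ->
  exists b, few_visits (U : measurableTypeR R -> measurableTypeR R) (A b) m n x.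
Proof.
move=> x01 /last_visit_le H.
have H' k : (m < k <= n)%N -> ~ Y (iter k U x) by move=> /H; rewrite iterU.
have cnt (y : nat -> bool) : (forall k, (m < k <= n)%N -> ~~ y k) ->
    (\sum_(1 <= i < n.+1) y i <= m)%N.
  move=> yk; have [nm|mn] := leqP n m.
    apply: (@leq_trans (\sum_(1 <= i < n.+1) 1)%N); first by apply: leq_sum => i _; case: (y i).
    by rewrite sum_nat_const_nat muln1 subn1.
  rewrite (@big_cat_nat _ _ _ m.+1)/=; last 2 first.
  - by [].
  - by rewrite ltnS ltnW.
  rewrite [X in (_ + X)%N]big_nat_cond [X in (_ + X)%N]big1 ?addn0.
    apply: (@leq_trans (\sum_(1 <= i < m.+1) 1)%N); first by apply: leq_sum => i _; case: (y i).
    by rewrite sum_nat_const_nat muln1 subn1.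
  by move=> i; rewrite andbT ltnS => /yk /negbTE ->.
have [nm|mn] := leqP n m.
  by exists false; apply: cnt => k; rewrite ltnNge => /andP[/negP mk kn]; case: mk; exact: leq_trans kn nm.
have Um01 : 0 <= iter m.+1 U x <= 1 by rewrite iterU//; have [] := iter_unit_ext hT m.+1 x01.
have avoid b : A b (iter m.+1 U x) -> few_visits (U : measurableTypeR R -> measurableTypeR R) (A (~~ b)) m n x.
  move=> Am; apply: cnt => k km; apply/negP => /set_mem Ak.
  have /(far_disj gamc cTg y0g gy1) := @iter_side _ U Y (A b) x m n (@stepA b) Am H' k km.
  exact.
have [Ym|Am|Am] := unit_cover y0 y1 Um01.
- by case: (H' m.+1); rewrite ?ltnSn.
- by exists true; exact: (avoid false).
- by exists false; exact: (avoid true).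
Qed.

End transfer.

(** * Scaled bounds on the core interval *)

Section asymptotics.
Context (R : realType) (T : R -> R) (c : R) (T0 T1 : R -> R) (p a : R).
Context (lstar : R -> R) (hT : thaler_map T c T0 T1 p a lstar).
Context (g f : bool -> R -> R) (M1 M : R).
Let U := unit_ext T.
Context (S : two_branches c U g f M1 M).
Context (gam y0 y1 : R) (gam0 : 0 < gam) (gamc : gam < c).
Context (cTg : c < U gam) (Tg1 : U gam < 1) (per : U (U gam) = gam).
Context (y00 : 0 < y0) (y0g : y0 <= gam) (gy1 : U gam <= y1) (y11 : y1 < 1).
Context (mu : {measure set (measurableTypeR R) -> \bar R}) (eta : R).
Context (mU : measurable_fun setT (U : measurableTypeR R -> measurableTypeR R)).
Context (Uinv : forall A : set (measurableTypeR R), measurable A ->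
  mu (U @^-1` A) = mu A).
Context (eta0 : 0 < eta).
Context (mu_ge : forall x y, 0 < x -> x < y -> y < 1 ->
  ((eta * (y - x))%:E <= mu `]x, y[%classic)%E).
Context (mu_fin : forall x y, 0 < x -> y < 1 -> (mu `[x, y]%classic < +oo)%E).
Context (mu_le : forall u v, 0 < u -> v < 1 -> exists2 H, 0 < H &
  forall x y, u <= x -> x < y -> y <= v ->
  (mu `]x, y[%classic <= (H * (y - x))%:E)%E).
Context (mu_pt : forall x, mu [set x] = 0%E).
Context (n0 : nat).
Let u := iter n0 (f false) c.
Let v := iter n0 (f true) c.
Context (uy0 : u <= y0) (y1v : y1 <= v).
Context (alpha : R) (l : R -> R).
Context (alpha01 : 0 < alpha < 1) (hl : slowly_varying_pinfty l).

Let Y : set (measurableTypeR R) := near y0 y1.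
Let A b : set (measurableTypeR R) := far y0 y1 b.
Let Om : set (measurableTypeR R) := `[u, v]%classic.
Let B b t := excursion U Y (A b) t.

Context (bet : bool -> R) (hw : forall b, asymp_equiv \oo (wandering_on mu T Y (A b))
  (fun n => bet b * reg_var alpha l n)).

Let q b k := fine (mu (layer T Y k `&` A b)).

Let q0 b k : 0 <= q b k. Proof. exact: fine_ge0. Qed.

Let qE b k : (0 < k)%N -> q b k = fine (mu (return_layer U Y (A b) k)).
Proof.
case: k => // k _.
by rewrite /q (layer_return_layer hT S gam0 gamc cTg Tg1 per y00 y0g gy1 y11).
Qed.

Let q_noninc b s t : (0 < s)%N -> (s <= t)%N -> q b t <= q b s.
Proof.
move=> s0 st; rewrite !qE ?(leq_trans s0 st)//.
exact: (far_return_layer_noninc S gam0 gamc cTg Tg1 per y00 y0g gy1 y11 mU Uinv).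
Qed.

Lemma excursion_tail_ge b : exists2 C, 0 < C &
  \forall n \near \oo, C * (reg_var alpha l n / n%:R) <= fine (mu (B b n)).
Proof.
apply: (tail_ge alpha01 hl (@q0 b) (@q_noninc b) (hw b)) => s L s0.
rewrite !qE ?addn_gt0 ?s0//.
exact: (far_excursion_ge S gam0 gamc cTg Tg1 per y00 y0g gy1 y11 mU Uinv).
Qed.

Lemma excursion_sum_le b : exists2 C, 0 < C &
  \forall n \near \oo, \sum_(0 <= t < n.+1) fine (mu (B b t)) <= C * reg_var alpha l n.
Proof.
apply: (tail_sum_le alpha01 hl (@q0 b) (hw b)) => t t0; rewrite qE//.
exact: (far_excursion_le S gam0 gamc cTg Tg1 per y00 y0g gy1 y11 mU Uinv).
Qed.

Lemma sojourn_scaled_bounded b : exists2 C, 0 < C & forall e : nat -> R,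
  (forall n, 0 < e n) -> e n @[n --> \oo] --> (0 : R) ->
  e n * n%:R @[n --> \oo] --> +oo ->
  \forall n \near \oo, l (e n * n%:R) / (e n `^ alpha * l n%:R) *
    fine (mu (Om `&` few_visits (U : measurableTypeR R -> measurableTypeR R)
      (A b) (Num.trunc (e n * n%:R)) n)) <= C.
Proof.
have [K K0 HK] := sojourn_bound S gam0 gamc cTg Tg1 per y00 y0g gy1 y11 mU Uinv eta0
  mu_ge mu_fin mu_le mu_pt uy0 y1v.
have [C1 C10 H1] := excursion_tail_ge b; have [C2 C20 H2] := excursion_sum_le (~~ b).
apply: (sojourn_limsup alpha01 hl (isT : (0 < n0.+1)%N) _ C10 C20 _ (HK b) _ H1 H2).
- by rewrite mulr_ge0 ?exprn_ge0 ?fine_ge0.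
- by move=> n; exact: (far_excursion_bounds S gam0 gamc cTg Tg1 per y00 y0g gy1 y11 mU eta0 mu_ge mu_fin).
- by move=> n; apply: sumr_ge0 => t _; exact: fine_ge0.
Qed.

Lemma visits_scaled_bounded : 0 < Gamma (1 + alpha) -> exists2 C, 0 < C &
  forall e : nat -> R, (forall n, 0 < e n) ->
  e n * return_seq mu T Y alpha n%:R @[n --> \oo] --> +oo ->
  \forall n \near \oo, 1 / e n *
    fine (mu (Om `&` few_visits (U : measurableTypeR R -> measurableTypeR R)
      Y (Num.trunc (e n * return_seq mu T Y alpha n%:R)) n)) <= C.
Proof.
move=> G0.
have b0 : 0 < bet true by apply: (tail_const_gt0 hl (@q0 true)); exact: hw.
have [C2 C20 H2] := excursion_sum_le false; have [C3 C30 H3] := excursion_sum_le true.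
refine (@visits_limsup _ _ _ alpha01 hl
  (fun N n => fine (mu (Om `&` few_visits (U : measurableTypeR R -> measurableTypeR R) Y N n)))
  (fun n => \sum_(0 <= t < n.+1) (fine (mu (B false t)) + fine (mu (B true t))))
  (fun n => laplace_wandering mu T Y n%:R^-1)
  (fun n => return_seq mu T Y alpha n%:R) n0.+1 (C2 + C3)
  (expR (- 1) * (bet true / 2)) (Gamma (1 + alpha)) _ _ G0 _ _ _ _ _ _).
- exact: addr_gt0.
- by rewrite mulr_gt0 ?expR_gt0 ?divr_gt0.
- move=> N n.
  exact: (visits_bound S gam0 gamc cTg Tg1 per y00 y0g gy1 y11 mU Uinv mu_fin).
- by move=> n; apply: sumr_ge0 => t _; apply: addr_ge0; exact: fine_ge0.
- move=> m n mn; rewrite [leRHS](@big_cat_nat _ _ _ m.+1)//= lerDl.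
  by apply: sumr_ge0 => t _; apply: addr_ge0; exact: fine_ge0.
- near=> n; rewrite big_split/= mulrDl; apply: lerD; near: n; [exact: H2|exact: H3].
- have H := partial_sum_ge hl (@q0 true) (hw true).
  near=> n; have npos : (0 < n)%N by near: n; exact: nbhs_infty_gt.
  apply: le_trans (laplace_wandering_ge hT S gam0 gamc cTg Tg1 per y00 y0g gy1 y11
    mU Uinv mu_fin npos).
  rewrite -mulrA ler_wpM2l ?expR_ge0//.
  apply: le_trans (wandering_on_le hT S gam0 gamc cTg Tg1 per y00 y0g gy1 y11
    mU Uinv mu_fin true n).
  by near: n; exact: H.
- by [].
Unshelve. all: by end_near. Qed.

End asymptotics.

(** * Weighted measures and the upper limits *)

Lemma core_radius (R : realType) (c : R) (T : R -> R) (g f : bool -> R -> R)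
    (M1 M : R) (S : two_branches c T g f M1 M) (s t : R) : 0 < s -> t < 1 ->
  exists n, iter n (f false) c <= s /\ t <= iter n (f true) c.
Proof.
move=> s0 t1; have c01 := tb_c S.
have [m Hm] := iter_f_lim S false c01 s0.
have t1' : 0 < 1 - t by rewrite subr_gt0.
have [n Hn] := iter_f_lim S true c01 t1'.
exists (m + n)%N; split.
- exact: le_trans (iter_f_mono S false m n c01) (ltW Hm).
- have := iter_f_mono S true n m c01; rewrite addnC; apply: le_trans.
  by apply: ltW; move: Hn; rewrite opprB addrC subrK.
Qed.

Lemma fine_measure_setIU_le d (X : measurableType d) (R : realType)
    (mu : {measure set X -> \bar R}) (Om V W : set X) :
  measurable Om -> (mu Om < +oo)%E -> measurable V -> measurable W ->
  fine (mu (Om `&` (V `|` W))) <= fine (mu (Om `&` V)) + fine (mu (Om `&` W)).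
Proof.
move=> mOm Omfin mV mW.
have fI (Z : set X) : measurable Z -> mu (Om `&` Z) \is a fin_num.
  move=> mZ; rewrite ge0_fin_numE//; apply: le_lt_trans Omfin.
  by apply: le_measure; rewrite ?inE//; exact: measurableI.
rewrite -fineD ?fI// fine_le ?fin_numD ?fI//; first exact: measurableU.
by rewrite setIUr measureU2//; exact: measurableI.
Qed.

Lemma weighted_limsup (R : realType)
    (mu : {measure set (measurableTypeR R) -> \bar R}) (G : measurableTypeR R -> R)
    (E Om : set (measurableTypeR R)) (W C : R) (k : nat -> R)
    (Z X : nat -> set (measurableTypeR R)) :
  (forall X : set (measurableTypeR R), measurable X ->
    (weighted mu G X <= W%:E * mu (X `&` E))%E) ->
  0 <= W -> measurable E -> measurable Om -> (mu Om < +oo)%E ->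
  (forall n, measurable (X n)) ->
  (\forall n \near \oo, [/\ 0 <= k n, measurable (Z n),
     Z n `&` E `<=` Om `&` X n & k n * fine (mu (Om `&` X n)) <= C]) ->
  (limn_esup (fun n => (k n)%:E * weighted mu G (Z n)) <= (W * C)%:E)%E.
Proof.
move=> HW W0 mE mOm Omfin mX H; apply: limn_esup_le.
apply: filterS H => n [k0 mZ ZE kC].
have mI : measurable (Om `&` X n) by exact: measurableI.
have Xfin : mu (Om `&` X n) \is a fin_num.
  rewrite ge0_fin_numE//; apply: le_lt_trans Omfin.
  by apply: le_measure; rewrite ?inE//; exact: subIsetl.
apply: (@le_trans _ _ ((k n)%:E * (W%:E * mu (Om `&` X n)))%E).
  rewrite lee_wpmul2l ?lee_fin//; apply: le_trans (HW _ mZ) _.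
  rewrite lee_wpmul2l ?lee_fin//; apply: le_measure; rewrite ?inE//.
  exact: measurableI.
rewrite -(fineK Xfin) -!EFinM lee_fin mulrCA.
exact: ler_wpM2l.
Qed.

Theorem theorem8p4 (R : realType)
  (* Thaler map *)
  (T : R -> R) (c : R) (T0 T1 : R -> R) (p a : R) (lstar : R -> R)
  (hT : thaler_map T c T0 T1 p a lstar)
  (* invariant measure *)
  (f0 f1 h0 : R -> R)
  (hf0 : inverse_branch `[0, c]%classic T0 f0)
  (hf1 : inverse_branch `[c, 1]%classic T1 f1)
  (h0_cont : {within `[0, 1]%classic, continuous h0})
  (h0_pos : {in `[0, 1], forall x, 0 < h0 x})
  (mu : {measure set (measurableTypeR R) -> \bar R})
  (mu_dens : has_density01 mu (thaler_density h0 f0 f1))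
  (mu_inv : preserves01 mu T)
  (* 2-periodic point and the sets A_0, Y, A_1 *)
  (gam c0 c1 : R)
  (hgam : gam \in `]0, c[) (hTgam : T gam \in `]c, 1[)
  (hper : T (T gam) = gam)
  (hc0 : c0 \in `]0, gam]) (hc1 : c1 \in `[T gam, 1[)
  (A0 Y A1 : set R)
  (hA0 : A0 = `[0, c0[%classic) (hY : Y = `[c0, c1]%classic) (hA1 : A1 = `]c1, 1]%classic)
  (* parameters *)
  (alpha : R) (halpha : alpha = 1 / p)
  (l : R -> R) (hl : slowly_varying_pinfty l)
  (hw0 : asymp_equiv \oo (wandering_on mu T Y A0)
    (fun n : nat => beta0 T c a * (n%:R `^ (1 - alpha) * l n%:R)))
  (hw1 : asymp_equiv \oo (wandering_on mu T Y A1)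
    (fun n : nat => (1 - beta0 T c a) * (n%:R `^ (1 - alpha) * l n%:R)))
  (* the weight G *)
  (G : measurableTypeR R -> R) (hG : G \in Lfun mu +oo%E)
  (G_ge0 : {ae mu, forall x, 0 <= G x})
  (eps : R) (heps : eps \in `]0, 1 / 2[)
  (G_supp : {ae mu, forall x, x \notin `[eps, 1 - eps] -> G x = 0}) :
  exists C2 : R, 0 < C2 /\
    forall cn ctn : nat -> R,
      (forall n, 0 < cn n) -> (forall n, 0 < ctn n) ->
      cn n @[n --> \oo] --> (0 : R) ->
      cn n * n%:R @[n --> \oo] --> +oo ->
      ctn n @[n --> \oo] --> (0 : R) ->
      ctn n * return_seq mu T Y alpha n%:R @[n --> \oo] --> +oo ->
      [/\ (limn_esup (fun n : nat =>
             (l (cn n * n%:R) / (cn n `^ alpha * l n%:R))%:E *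
             weighted mu G
               [set x | (x \in `[0, 1])%R /\
                        ((last_visit T Y n x)%:R / n%:R <= cn n)%R])
           <= C2%:E)%E,
          (limn_esup (fun n : nat =>
             (1 / ctn n)%:E *
             weighted mu G
               [set x | (x \in `[0, 1])%R /\
                        (occupation T Y n x / return_seq mu T Y alpha n%:R
                           <= ctn n)%R])
           <= C2%:E)%E,
          (limn_esup (fun n : nat =>
             (l (cn n * n%:R) / (cn n `^ alpha * l n%:R))%:E *
             weighted mu G
               [set x | (x \in `[0, 1])%R /\
                        (occupation T A0 n x / n%:R <= cn n)%R])
           <= C2%:E)%E &
          (limn_esup (fun n : nat =>
             (l (cn n * n%:R) / (cn n `^ alpha * l n%:R))%:E *
             weighted mu G
               [set x | (x \in `[0, 1])%R /\
                        (occupation T A1 n x / n%:R <= cn n)%R])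
           <= C2%:E)%E].
Proof.
have [M1 [M S]] := thaler_two_branches hT hf0 hf1.
have /andP[c_gt0 c_lt1] := tb_c S.
move: hgam hTgam hc0 hc1 heps.
rewrite !in_itv/= => /andP[gam0 gamc] /andP[cTg Tg1] /andP[y00 y0g] /andP[gy1 y11] /andP[e0 e2].
have gam01 : 0 <= gam <= 1 by rewrite !ltW// (lt_trans gamc).
have Tgam01 : 0 <= T gam <= 1 by rewrite !ltW// (lt_trans c_gt0).
have Ug : unit_ext T gam = T gam by rewrite /unit_ext gam01.
have UUg : unit_ext T (unit_ext T gam) = gam by rewrite Ug /unit_ext Tgam01.
rewrite -Ug in cTg Tg1 gy1.
have [eta eta0 mu_ge] := density_mu_ge S h0_cont h0_pos mu_dens.
have mu_le := density_mu_le S h0_cont h0_pos mu_dens.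
have mu_fin := density_mu_fin S h0_cont h0_pos mu_dens.
have mu_pt := density_mu_pt S h0_cont mu_dens.
have mU := measurable_unit_ext hT.
have Uinv := unit_ext_preserving hT mu_inv (density_mu_out (f := fun b => if b then f1 else f0) mu_dens).
(* The core interval has to contain both [Y] and the support of [G]. *)
have s0 : 0 < Num.min c0 eps by rewrite lt_min y00.
have t1 : Num.max c1 (1 - eps) < 1 by rewrite gt_max y11/=; lra.
have [n0 [uy0 y1v]] := core_radius S s0 t1.
move: uy0 y1v; rewrite le_min ge_max => /andP[uy0 ue] /andP[y1v ev].
have alpha01 : 0 < alpha < 1.
  have p1 := thaler_p hT; have p0 : 0 < p by exact: lt_trans p1.
  by rewrite halpha divr_gt0//= ltr_pdivrMr// mul1r.
pose E : set (measurableTypeR R) := `[eps, 1 - eps]%classic.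
have mE : measurable E by exact: measurable_itv.
have [W W0 HW] : exists2 W, 0 < W & forall X : set (measurableTypeR R), measurable X ->
    (weighted mu G X <= W%:E * mu (X `&` E))%E.
  apply: weighted_bounded => //.
  by near=> x => nE; move: (nE : ~ x \in `[eps, 1 - eps]) => /negP; near: x.
subst A0 Y A1.
pose Y : set (measurableTypeR R) := near c0 c1.
pose A b : set (measurableTypeR R) := far c0 c1 b.
have mY : measurable Y by exact: measurable_itv.
have mA b : measurable (A b) by rewrite /A /far; case: b; exact: measurable_itv.
pose Om : set (measurableTypeR R) := `[iter n0 f0 c, iter n0 f1 c]%classic.
have mOm : measurable Om by exact: measurable_itv.
have Omfin : (mu Om < +oo)%E.
  apply: mu_fin.
  - by have /andP[] := iter_f_01 S false n0 (tb_c S).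
  - by have /andP[] := iter_f_01 S true n0 (tb_c S).
have EOm : E `<=` Om.
  move=> x; rewrite /E /Om /= !in_itv/= => /andP[ex xe].
  by rewrite (le_trans ue ex) (le_trans xe ev).
pose bet b := if b then 1 - beta0 T c a else beta0 T c a.
have hw b : asymp_equiv \oo (wandering_on mu T Y (A b))
    (fun n => bet b * reg_var alpha l n) by case: b.
pose U : measurableTypeR R -> measurableTypeR R := unit_ext T.
pose V (B : set (measurableTypeR R)) m n := few_visits U B m n.
have mV B m n : measurable B -> measurable (V B m n) by exact: measurable_few_visits.
have m01 : measurable (`[0, 1]%classic : set (measurableTypeR R)) by exact: measurable_itv.
have l0 t : 0 < t -> 0 < l t by have [[+ _] _] := hl; exact.
have SOJ b := sojourn_scaled_bounded hT S gam0 gamc cTg Tg1 UUg y00 y0g gy1 y11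
  mU Uinv eta0 mu_ge mu_fin mu_le mu_pt uy0 y1v alpha01 hl hw b.
have [C0 C00 H0] := SOJ false; have [C1 C10 H1] := SOJ true.
have [Cv Cv0 Hv] : exists2 C, 0 < C & forall e : nat -> R, (forall n, 0 < e n) ->
    e n * return_seq mu T Y alpha n%:R @[n --> \oo] --> +oo ->
    \forall n \near \oo, 1 / e n *
      fine (mu (Om `&` V Y (Num.trunc (e n * return_seq mu T Y alpha n%:R)) n)) <= C.
  (* A zero of [Gamma] would make the return sequence vanish, as its definition
     divides by [Gamma (1 + alpha)]; this contradicts the hypothesis on [e]. *)
  have := Gamma_ge0 (1 + alpha); rewrite le_eqVlt => /orP[/eqP G0|G0].
    exists 1 => // e _ /cvgryPge/(_ 1); apply: filterS => n.
    by rewrite /return_seq -G0 mul0r invr0 !mulr0 ler10.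
  exact: (visits_scaled_bounded hT S gam0 gamc cTg Tg1 UUg y00 y0g gy1 y11
    mU Uinv mu_fin mu_pt n0 alpha01 hl hw).
exists (W * (C0 + C1 + Cv)); split; first by rewrite mulr_gt0// !addr_gt0.
move=> cn ctn cn0 ctn0 cnc cnn ctnc ctna.
have k0 n : (0 < n)%N -> 0 <= l (cn n * n%:R) / (cn n `^ alpha * l n%:R).
  move=> n_gt0; have nR : 0 < n%:R :> R by rewrite ltr0n.
  by rewrite ltW// divr_gt0 ?mulr_gt0 ?l0 ?mulr_gt0 ?powR_gt0.
have occE (B : set (measurableTypeR R)) n (t : R) : 0 <= t -> measurable B ->
    let Z := [set x : R | (x \in `[0, 1]) /\ occupation T B n x <= t] in
    measurable (Z : set (measurableTypeR R)) /\
    Z `&` E `<=` Om `&` V B (Num.trunc t) n.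
  move=> t0 mB /=; rewrite (occupation_event hT)//; split.
    by apply: measurableI => //; exact: mV.
  by move=> x [[_ Vx] /EOm Ox].
have SOJ' b C : 0 <= C -> C <= C0 + C1 + Cv ->
   (\forall n \near \oo, l (cn n * n%:R) / (cn n `^ alpha * l n%:R) *
      fine (mu (Om `&` V (A b) (Num.trunc (cn n * n%:R)) n)) <= C) ->
  (limn_esup (fun n : nat =>
             (l (cn n * n%:R) / (cn n `^ alpha * l n%:R))%:E *
             weighted mu G
               [set x | (x \in `[0, 1])%R /\
                        (occupation T (A b) n x / n%:R <= cn n)%R])
           <= (W * (C0 + C1 + Cv))%:E)%E.
  move=> C_ge0 Cle H.
  apply: (weighted_limsup (Om := Om)
    (X := fun n => V (A b) (Num.trunc (cn n * n%:R)) n) HW) => //; first exact: ltW.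
    by move=> n; exact: mV.
  apply: filterS2 H (nbhs_infty_gt 0) => n Hn n_gt0.
  have nR : 0 < n%:R :> R by rewrite ltr0n.
  have [mZ ZE] := occE (A b) n _ (ltW (mulr_gt0 (cn0 n) nR)) (mA b).
  have ZZ : [set x : R | x \in `[0, 1] /\ occupation T (A b) n x / n%:R <= cn n] =
      [set x : R | (x \in `[0, 1]) /\ occupation T (A b) n x <= cn n * n%:R].
    by apply/seteqP; split => x /= [x01 H]; split => //; move: H; rewrite ler_pdivrMr.
  rewrite ZZ; split => //; first exact: k0.
  exact: le_trans Hn Cle.
have C0' := ltW C00; have C1' := ltW C10; have Cv' := ltW Cv0.
split.
- apply: (weighted_limsup (Om := Om)
    (X := fun n => V (A false) (Num.trunc (cn n * n%:R)) n `|`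
       V (A true) (Num.trunc (cn n * n%:R)) n) HW) => //; first exact: ltW.
    by move=> n; apply: measurableU; exact: mV.
  apply: filterS3 (H0 _ cn0 cnc cnn) (H1 _ cn0 cnc cnn) (nbhs_infty_gt 0) => n h0n h1n n_gt0.
  have nR : 0 < n%:R :> R by rewrite ltr0n.
  have t0 := mulr_gt0 (cn0 n) nR.
  set m := Num.trunc _ in h0n h1n *.
  have ZZ : [set x : R | x \in `[0, 1] /\ (last_visit T `[c0, c1]%classic n x)%:R / n%:R <= cn n] =
      [set x : R | (x \in `[0, 1]) /\ (last_visit T Y n x <= m)%N].
    apply/seteqP; split => x /= [x01]; rewrite ler_pdivrMr// -truncn_ge_nat ?(ltW t0)//.
  have mVm b : measurable (V (A b) m n) by exact: mV.
  rewrite ZZ; split; first exact: k0.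
  + rewrite (last_visit_event hT); apply: measurableI => //.
    by apply: bigcap_measurableType => k _; apply: (measurable_iter mU); exact: measurableC.
  + move=> x [/= [x01 /(last_visit_sojourn hT S gam0 gamc cTg Tg1 UUg y00 y0g gy1 y11) L] /EOm Ox].
    rewrite in_itv/= in x01; have [[] Lb] := L x01; split => //; by [right|left].
  + apply: le_trans (_ : C0 + C1 <= _); last by rewrite lerDl.
    have U2 := fine_measure_setIU_le mOm Omfin (mVm false) (mVm true).
    have {}U2 := ler_wpM2l (k0 n n_gt0) U2; rewrite mulrDr in U2.
    exact: le_trans U2 (lerD h0n h1n).
- apply: (weighted_limsup (Om := Om) (X := fun n =>
      V Y (Num.trunc (ctn n * return_seq mu T Y alpha n%:R)) n) HW) => //; first exact: ltW.
    by move=> n; exact: mV.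
  move: (ctna) => /cvgryPge/(_ 1) near1.
  apply: filterS2 (Hv _ ctn0 ctna) near1 => n Hn ge1.
  have r0 : 0 < return_seq mu T Y alpha n%:R.
    by rewrite -(pmulr_rgt0 _ (ctn0 n)) (lt_le_trans ltr01).
  have [mZ ZE] := occE Y n _ (ltW (mulr_gt0 (ctn0 n) r0)) mY.
  have ZZ : [set x : R | x \in `[0, 1] /\ occupation T `[c0, c1]%classic n x /
        return_seq mu T `[c0, c1]%classic alpha n%:R <= ctn n] =
      [set x : R | (x \in `[0, 1]) /\ occupation T Y n x <= ctn n * return_seq mu T Y alpha n%:R].
    by apply/seteqP; split => x /= [x01 H]; split => //; move: H; rewrite ler_pdivrMr.
  rewrite ZZ; split => //; first by rewrite divr_ge0// ltW.
  by apply: (le_trans Hn); rewrite lerDr addr_ge0.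
- by apply: (SOJ' false C0) => //; [rewrite -addrA lerDl addr_ge0|exact: H0].
- by apply: (SOJ' true C1) => //; [rewrite -addrA addrCA lerDl addr_ge0|exact: H1].
Unshelve. all: by end_near. Qed.
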